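(* Let $\alpha>0$, let $\mu$ be a positive Borel measure on $(0,\infty)$, let $1\le p\le2$ and let $\frac1p+\frac1{p'}=1$. (i) If $\sum_{n=0}^\infty \mu_n^{p}(n+1)^{\frac{2-p}{2}}<\infty$, then $\mathcal{H}_\mu:F^{p'}_\alpha\to F^{p'}_\alpha$ is $p$-summing. (ii) If $\mathcal{H}_\mu:F^{p'}_\alpha\to F^{p'}_\alpha$ is $p$-summing, then $\sum_{n=0}^\infty \mu_n^{p}(n+1)^{\frac{p-2}{2}}<\infty$. (iii) If $\mathcal{H}_\mu:F^{p}_\alpha\to F^{p}_\alpha$ is $p'$-summing, then $(\mu_n)_{n\ge0}\in\ell_{p'}$.
   Context: For $\alpha>0$, $F^p_\alpha$ is the space of entire functions $f$ with $\|f\|_{p,\alpha}<\infty$, where $\|f\|_{p,\alpha}=\left(\frac{\alpha p}{2\pi}\int_{\mathbb C}|f(z)e^{-\frac{\alpha}{2}|z|^2}|^p\,dA(z)\right)^{1/p}$ for $1\le p<\infty$ ($dA$ is area measure) and $\|f\|_{\infty,\alpha}=\sup_{z\in\mathbb C}|f(z)|e^{-\frac{\alpha}{2}|z|^2}$. The Hausdorff operator is $\mathcal{H}_\mu(f)(z)=\int_0^\infty f\left(\frac{z}{t}\right)\frac{d\mu(t)}{t}$ for entire $f$, and $\mu_n=\int_0^\infty\frac{d\mu(t)}{t^{n+1}}$ for $n=0,1,2,\dots$. For $1\le s<\infty$, a bounded operator $T:X\to Y$ between Banach spaces is $s$-summing if $\sum_n\|T(x_n)\|_Y^s<\infty$ for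 every sequence $(x_n)\subset X$ such that $\sum_n|\langle x^*,x_n\rangle|^s<\infty$ for all $x^*\in X^*$; ''$\infty$-summing'' means bounded. Saying $\mathcal{H}_\mu$ is summing on a space includes that it is well defined and bounded there. *)

(* Defs.v *)
From HB Require Import structures.
From mathcomp Require Import all_boot all_order all_algebra.
From mathcomp Require Import all_classical all_reals all_analysis.
From mathcomp Require Export complex.
Import Order.TTheory GRing.Theory Num.Theory.
Import numFieldTopology.Exports numFieldNormedType.Exports.

Set Implicit Arguments.
Unset Strict Implicit.
Unset Printing Implicit Defensive.

Local Open Scope classical_set_scope.
Local Open Scope ring_scope.
Local Open Scope complex_scope.
Local Open Scope ereal_scope.

(* The modulus of a complex number as an element of [R]; the library's [`|z|]
   lives in [R[i]]. *)
Notation modulus := ComplexField.Normc.normc.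

Section ComplexIntegral.
Context {R : realType} {d : measure_display} {T : measurableType d}.
Variables (mu : {measure set T -> \bar R}) (D : set T).

Definition integrableC (g : T -> R[i]) : Prop :=
  mu.-integrable D (fun t => (complex.Re (g t))%:E) /\
  mu.-integrable D (fun t => (complex.Im (g t))%:E).

Definition integralC (g : T -> R[i]) : R[i] :=
  Complex (\int[mu]_(t in D) complex.Re (g t))%R
          (\int[mu]_(t in D) complex.Im (g t))%R.

End ComplexIntegral.

Section FockSpace.
Context {R : realType}.

Definition entire (f : R[i] -> R[i]) : Prop :=
  forall z : R[i], derivable (f : R[i]^o -> R[i]^o) z 1%R.

Definition gauss_modulus (alpha : R) (f : R[i] -> R[i]) (z : R[i]) : R :=
  (modulus (f z) * expR (- (alpha / 2 * modulus z ^+ 2)))%R.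

(* Area measure is the product Lebesgue measure on [R * R], [w] being the pair of
   real and imaginary parts. The value at [-oo] is irrelevant: exponents lie in
   [1, +oo]. *)
Definition Fock_norm (alpha : R) (p : \bar R) (f : R[i] -> R[i]) : \bar R :=
  match p with
  | r%:E => ((alpha * r / (2 * pi))%R%:E *
             \int[(@lebesgue_measure R \x @lebesgue_measure R)%E]_w
               (gauss_modulus alpha f (Complex w.1 w.2) `^ r)%R%:E) `^ r^-1
  | +oo => ereal_sup (range (fun z => (gauss_modulus alpha f z)%:E))
  | -oo => 0
  end.

Definition Fock (alpha : R) (p : \bar R) : set (R[i] -> R[i]) :=
  [set f | entire f /\ Fock_norm alpha p f < +oo].

End FockSpace.

(* In this section a normed space is given as a linear subspace [X] of a complex
   vector space [V] together with a norm [NX : V -> \bar R], finite on [X];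
   operators and functionals are functions on [V] of which only the restriction
   to [X] matters. *)
Section Summing.
Context {R : realType} {V W : lmodType R[i]}.

Definition linear_on (X : set V) (T : V -> W) : Prop :=
  forall (a : R[i]) (u v : V), X u -> X v ->
    T (a *: u + v)%R = (a *: T u + T v)%R.

Definition bounded_operator (X : set V) (NX : V -> \bar R)
    (Y : set W) (NY : W -> \bar R) (T : V -> W) : Prop :=
  [/\ forall u, X u -> Y (T u),
      linear_on X T &
      exists M : R, forall u, X u -> NY (T u) <= M%:E * NX u].

Definition bounded_functional (X : set V) (NX : V -> \bar R)
    (phi : V -> R[i]) : Prop :=
  (forall (a : R[i]) (u v : V), X u -> X v ->
    phi (a *: u + v)%R = (a * phi u + phi v)%R) /\
  exists M : R, forall u, X u -> (modulus (phi u))%:E <= M%:E * NX u.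

Definition summing (s : \bar R) (X : set V) (NX : V -> \bar R)
    (Y : set W) (NY : W -> \bar R) (T : V -> W) : Prop :=
  bounded_operator X NX Y NY T /\
  match s with
  | r%:E => forall x : nat -> V, (forall n, X (x n)) ->
      (forall phi, bounded_functional X NX phi ->
        \sum_(0 <= n <oo) (modulus (phi (x n)) `^ r)%R%:E < +oo) ->
      \sum_(0 <= n <oo) (NY (T (x n)) `^ r) < +oo
  | +oo => True
  | -oo => False
  end.

End Summing.

(* A positive Borel measure on (0, +oo) is represented by a Borel measure [mu]
   on the real line of which only the restriction to (0, +oo) is used. *)
Section Hausdorff.
Context {R : realType}.
Variable mu : {measure set (measurableTypeR R) -> \bar R}.

Definition moment (n : nat) : \bar R :=
  \int[mu]_(t in `]0%R, +oo[) ((t ^+ n.+1)^-1)%R%:E.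

Definition hausdorff_integrand (f : R[i] -> R[i]) (z : R[i])
    (t : measurableTypeR R) : R[i] :=
  (f (z / (t : R)%:C) / (t : R)%:C)%R.

Definition hausdorff (f : R[i] -> R[i]) (z : R[i]) : R[i] :=
  integralC mu `]0%R, +oo[ (hausdorff_integrand f z).

Definition hausdorff_summing (alpha : R) (p s : \bar R) : Prop :=
  (forall f, Fock alpha p f -> forall z,
    integrableC mu `]0%R, +oo[ (hausdorff_integrand f z)) /\
  summing s (Fock alpha p) (Fock_norm alpha p)
            (Fock alpha p) (Fock_norm alpha p) hausdorff.

End Hausdorff.

Definition ell {R : realType} (s : \bar R) (u : nat -> \bar R) : Prop :=
  match s with
  | r%:E => \sum_(0 <= n <oo) (`|u n| `^ r) < +oo
  | +oo => ereal_sup (range (fun n => `|u n|)) < +oo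
  | -oo => False
  end.

(* Main.v *)
(* Write [mu_n] for the moments, [a_n] for the Taylor coefficients of [f] and
   [V_n] for the integral of [|z|^(2n) exp (- alpha |z|^2)], so that [H f] has
   coefficients [mu_n a_n].

   Sufficiency. Integrating [f] against [conj z ^ n] gives functionals
   [phi_n f = a_n V_n^(1/2) (n+1)^(1/2-1/p)] that are uniformly bounded on [F^q],
   [q = p'] (Hoelder). Conversely Parseval and a Cauchy-Schwarz sup bound show, as
   [q >= 2], that the [F^q] norm of a power series is at most a constant times the
   [l^2] norm of its coefficients weighted by [V_n^(1/2)]. Since [l^p] embeds in
   [l^2], [||H f||^p] is at most a constant times
   [\sum_n mu_n^p (n+1)^((2-p)/2) |phi_n f|^p], and by the uniform boundedness
   principle [\sum_k |phi_n (x_k)|^p] is bounded in [n] for weakly [p]-summable [x_k].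

   Necessity. Normalised reproducing kernels [k_w] at the points [w_n] of a lattice,
   numbered so that [alpha |w_n|^2 <= n], are weakly summable because the Gaussian
   bumps [|k_w(z)| exp (- alpha |z|^2 / 2)] have bounded sum. The weighted value of
   [H k_w] at [w] is the integral of [exp (L (1/t - 1)) / t], [L = alpha |w|^2].
   Boundedness of [H] thus bounds the [mu_n], so that [mu] vanishes on (0, 1), and
   then that value is at least [mu_n] for [w = w_n]: [mu_n <= C ||H k_(w_n)||]. *)
From HB Require Import structures.
Require Import Defs.
From mathcomp Require Import all_boot all_order all_algebra.
From mathcomp Require Import all_classical all_reals all_analysis.
From mathcomp Require Import measurable_realfun.
From mathcomp Require Import ring lra.
Import Order.TTheory GRing.Theory Num.Theory.
Import numFieldTopology.Exports numFieldNormedType.Exports.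

Set Implicit Arguments.
Unset Strict Implicit.
Unset Printing Implicit Defensive.

Local Open Scope classical_set_scope.
Local Open Scope ring_scope.
Local Open Scope complex_scope.

(** * Complex calculus *)

(** Both directions hinge on one reformulation: [x] is weakly [b]-summable exactly when the finite
    combinations of the [x_k] with coefficients in the unit ball of the conjugate sequence space
    stay bounded. These are the [test_vector]s. For sufficiency they carry the passage from single
    functionals to all [phi_n] at once; the functional built on the way is a geometric series, so
    the completeness at work is that of the dual. For necessity they reduce weak summability of the
    kernels to a norm estimate, which the almost disjoint Gaussian bumps provide. The obstacle with
    [mu] is the behaviour near [0], where the functions [1 / t^(n+1)] have no common majorant and
    Taylor series cannot be integrated term by term; on [t >= 1] they are all dominated by [1 / t].
    Parts (ii) and (iii) come from one statement: if [H] is [b]-summing on the space whose exponent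
    is conjugate to [b], then [(mu_n)] is in [l^b]. For (iii) the conjugate pair is swapped; for
    (ii) the weight is at most [1] because [p <= 2]. An infinite summing exponent in (iii) only asks
    for bounded moments. *)

Lemma eq_ler {R : realDomainType} (x y : R) : x = y -> x <= y.
Proof. by move->. Qed.

Section Modulus.
Context {R : realType}.
Implicit Types (z w : R[i]) (x y : R).

Lemma modulusE z : (modulus z)%:C = `|z|.
Proof. by []. Qed.

Lemma modulus_ge0 z : 0 <= modulus z.
Proof. by have := normr_ge0 z; rewrite -modulusE ler0c. Qed.
Hint Resolve modulus_ge0 : core.

Lemma ler_modulusD z w : modulus (z + w) <= modulus z + modulus w.
Proof. exact: le_normcD. Qed.

Lemma modulusN z : modulus (- z) = modulus z.
Proof. exact: normcN. Qed.

Lemma modulusBC z w : modulus (z - w) = modulus (w - z).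
Proof. by rewrite -modulusN opprB. Qed.

Lemma ler_modulusB z w : modulus (z - w) <= modulus z + modulus w.
Proof. by rewrite -(modulusN w); exact: ler_modulusD. Qed.

Lemma lerB_modulus z w : modulus z - modulus w <= modulus (z - w).
Proof. by have := ler_modulusD (z - w) w; rewrite subrK; lra. Qed.

Lemma modulusM z w : modulus (z * w) = modulus z * modulus w.
Proof. exact: ComplexField.Normc.normcM. Qed.

Lemma modulusV z : modulus z^-1 = (modulus z)^-1.
Proof. exact: ComplexField.Normc.normcV. Qed.

Lemma modulus0 : modulus (0 : R[i]) = 0.
Proof. exact: ComplexField.Normc.normc0. Qed.

Lemma modulus1 : modulus (1 : R[i]) = 1.
Proof. exact: ComplexField.Normc.normc1. Qed.

Lemma modulusX z n : modulus (z ^+ n) = modulus z ^+ n.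
Proof. by elim: n => [|n ih]; rewrite ?expr0 ?modulus1// !exprS modulusM ih. Qed.

Lemma modulus_eq0 z : (modulus z == 0) = (z == 0).
Proof.
apply/eqP/eqP => [|->]; last exact: modulus0.
exact: ComplexField.Normc.eq0_normc.
Qed.

Lemma modulus_gt0 z : (0 < modulus z) = (z != 0).
Proof. by rewrite lt_neqAle modulus_ge0 andbT eq_sym modulus_eq0. Qed.

Lemma modulus_real x : modulus x%:C = `|x|.
Proof. by rewrite /= expr0n addr0 sqrtr_sqr. Qed.

Lemma sqr_modulus z : modulus z ^+ 2 = complex.Re z ^+ 2 + complex.Im z ^+ 2.
Proof. by case: z => x y /=; rewrite sqr_sqrtr// addr_ge0 ?sqr_ge0. Qed.

Lemma Re_le_modulus z : `|complex.Re z| <= modulus z.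
Proof.
by rewrite -ler_sqr ?nnegrE// sqr_modulus real_normK ?num_real// lerDl sqr_ge0.
Qed.

Lemma Im_le_modulus z : `|complex.Im z| <= modulus z.
Proof.
by rewrite -ler_sqr ?nnegrE// sqr_modulus real_normK ?num_real// lerDr sqr_ge0.
Qed.

Lemma modulus_le_ReIm z : modulus z <= `|complex.Re z| + `|complex.Im z|.
Proof.
rewrite -ler_sqr ?nnegrE ?addr_ge0// sqr_modulus sqrrD !real_normK ?num_real//.
by rewrite [leRHS]addrAC lerDl mulrn_wge0// mulr_ge0.
Qed.

Lemma ler_modulus_sum I (s : seq I) (P : pred I) (F : I -> R[i]) :
  modulus (\sum_(i <- s | P i) F i) <= \sum_(i <- s | P i) modulus (F i).
Proof.
elim/big_rec2: _ => [|i a b _ h]; first by rewrite modulus0.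
by apply: le_trans (ler_modulusD _ _) _; rewrite lerD2l.
Qed.

Lemma cRe_sum I (s : seq I) (P : pred I) (F : I -> R[i]) :
  complex.Re (\sum_(i <- s | P i) F i) = \sum_(i <- s | P i) complex.Re (F i).
Proof.
elim/big_rec2: _ => // i a b _ <-.
by case: (F i) b => ? ? [].
Qed.

Lemma cIm_sum I (s : seq I) (P : pred I) (F : I -> R[i]) :
  complex.Im (\sum_(i <- s | P i) F i) = \sum_(i <- s | P i) complex.Im (F i).
Proof.
elim/big_rec2: _ => // i a b _ <-.
by case: (F i) b => ? ? [].
Qed.

Lemma cReD z w : complex.Re (z + w) = complex.Re z + complex.Re w.
Proof. by case: z w => ? ? []. Qed.

Lemma cImD z w : complex.Im (z + w) = complex.Im z + complex.Im w.
Proof. by case: z w => ? ? []. Qed.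

Lemma cReN z : complex.Re (- z) = - complex.Re z.
Proof. by case: z. Qed.

Lemma cImN z : complex.Im (- z) = - complex.Im z.
Proof. by case: z. Qed.

Lemma cReM z w :
  complex.Re (z * w) = complex.Re z * complex.Re w - complex.Im z * complex.Im w.
Proof. by case: z w => ? ? []. Qed.

Lemma cImM z w :
  complex.Im (z * w) = complex.Re z * complex.Im w + complex.Im z * complex.Re w.
Proof. by case: z w => ? ? []. Qed.

End Modulus.

#[global] Hint Extern 0 (is_true (0 <= modulus _)) => exact: modulus_ge0 : core.

(** * Complex differentiability by first-order expansions *)

Section EpsilonDelta.
Context {R : realType}.

Lemma is_derive_approx (f : R -> R) (x l : R) : is_derive x 1 f l ->
  forall e : R, 0 < e -> exists2 d : R, 0 < d &
    forall h, `|h| <= d -> `|f (x + h) - f x - l * h| <= e * `|h|.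
Proof.
move=> [df fl] e e0; have := df.
move/cvg_ex => [l' cl].
have ll' : l' = l by rewrite -fl /derive; apply/esym/cvg_lim.
rewrite {l'}ll' in cl.
move/cvgrPdist_le: cl => /(_ _ e0); rewrite near_withinE.
move=> /nbhs_ballP[d /= d0 dP]; exists (d / 2); first by rewrite divr_gt0.
move=> h hd; have [->|h0] := eqVneq h 0.
  by rewrite addr0 subrr mulr0 subrr normr0 mulr0.
have := dP h; rewrite /ball/= sub0r normrN => /(_ _ h0).
have -> : `|h| < d by apply: le_lt_trans hd _; rewrite ltr_pdivrMr// ltr_pMr// ltr1n.
move=> /(_ isT); rewrite -[h *: 1]/(h * 1) mulr1 -[_ *: _]/(_ * _) => H.
have -> : f (x + h) - f x - l * h = - (l - h^-1 * (f (h + x) - f x)) * h.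
  by rewrite (addrC h x); field.
by rewrite normrM normrN ler_wpM2r.
Qed.

(** Differentiability without a quotient: [h = 0] is allowed, so the rules for sums, products and
    composites need no case distinction. *)
Definition cdiff (f : R[i] -> R[i]) (z l : R[i]) :=
  forall e : R, 0 < e -> exists2 d : R, 0 < d & forall h, modulus h <= d ->
    modulus (f (z + h) - f z - l * h) <= e * modulus h.

Definition ccont (f : R[i] -> R[i]) (z : R[i]) :=
  forall e : R, 0 < e -> exists2 d : R, 0 < d & forall h, modulus h <= d ->
    modulus (f (z + h) - f z) <= e.

Lemma entireP (f : R[i] -> R[i]) :
  entire f <-> forall z, exists l, cdiff f z l.
Proof.
split=> [ef z|df z].
  have /cvg_ex[l /= cl] := ef z; exists l => e e0.
  move/cvgrPdist_le: cl => /(_ e%:C); rewrite ltcR => /(_ e0).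
  rewrite near_withinE.
  move=> /nbhs_ballP[d /= d0 dP].
  have [d' dE] : exists d', d = d'%:C.
    by exists (complex.Re d); rewrite RRe_real// gtr0_real.
  move: d0 dP; rewrite dE ltcR => d0 dP.
  exists (d' / 2); first by rewrite divr_gt0.
  move=> h hd; have [->|h0] := eqVneq h 0.
    by rewrite addr0 subrr mulr0 subrr modulus0 mulr0.
  have := dP h; rewrite /ball/= sub0r normrN => /(_ _ h0).
  rewrite -modulusE ltcR.
  have -> : modulus h < d'.
    by apply: le_lt_trans hd _; rewrite ltr_pdivrMr// ltr_pMr// ltr1n.
  move=> /(_ isT); rewrite -[h *: 1]/(h * 1) mulr1 -[_ *: _]/(_ * _).
  rewrite -modulusE lecR => H.
  have -> : f (z + h) - f z - l * h = - (l - h^-1 * (f (h + z) - f z)) * h.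
    by rewrite (addrC h z); field.
  by rewrite modulusM modulusN ler_wpM2r.
have [l dl] := df z; apply/cvg_ex; exists l; apply/cvgrPdist_le => e e0.
have [e' eE] : exists e', e = e'%:C.
  by exists (complex.Re e); rewrite RRe_real// gtr0_real.
move: e0; rewrite eE ltcR => e0; have [d d0 dP] := dl _ e0.
rewrite near_withinE.
apply/nbhs_ballP; exists d%:C; first by rewrite /= ltcR.
move=> h; rewrite /ball/= sub0r normrN -modulusE ltcR => hd h0.
rewrite -[h *: 1]/(h * 1) mulr1 -[_ *: _]/(_ * _) -modulusE lecR.
have -> : l - h^-1 * (f (h + z) - f z) = - (f (z + h) - f z - l * h) * h^-1.
  by rewrite (addrC h z); field.
rewrite modulusM modulusN modulusV ler_pdivrMr ?modulus_gt0//.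
by apply: dP; exact: ltW.
Qed.

Lemma cdiff_cont f z l : cdiff f z l -> ccont f z.
Proof.
move=> dl e e0; have [d d0 dP] := dl _ (@ltr01 R).
have k0 : 0 < 1 + modulus l by rewrite ltr_pwDl.
exists (Num.min d (e / (1 + modulus l))).
  by rewrite lt_min d0 divr_gt0.
move=> h; rewrite le_min => /andP[hd he].
have -> : f (z + h) - f z = (f (z + h) - f z - l * h) + l * h by rewrite subrK.
apply: le_trans (ler_modulusD _ _) _; rewrite modulusM.
have := dP _ hd; rewrite mul1r; move: he; rewrite ler_pdivlMr// => he hh.
by apply: le_trans (lerD hh (lexx _)) _; rewrite -{1}(mul1r (modulus h)) -mulrDl mulrC.
Qed.

Lemma cdiff_cst c z : cdiff (fun=> c) z 0.
Proof.
by move=> e e0; exists 1 => // h _; rewrite subrr mul0r subr0 modulus0 mulr_ge0// ltW.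
Qed.

Lemma cdiff_id z : cdiff id z 1.
Proof.
move=> e e0; exists 1 => // h _.
by rewrite mul1r (addrC z) addrK subrr modulus0 mulr_ge0// ltW.
Qed.

Lemma cdiffD f g z l m : cdiff f z l -> cdiff g z m ->
  cdiff (fun w => f w + g w) z (l + m).
Proof.
move=> df dg e e0; have e20 : 0 < e / 2 by rewrite divr_gt0.
have [d d0 dP] := df _ e20; have [d' d'0 d'P] := dg _ e20.
exists (Num.min d d'); first by rewrite lt_min d0.
move=> h; rewrite le_min => /andP[hd hd'].
have -> : f (z + h) + g (z + h) - (f z + g z) - (l + m) * h =
  (f (z + h) - f z - l * h) + (g (z + h) - g z - m * h) by ring.
apply: le_trans (ler_modulusD _ _) _; apply: le_trans (lerD (dP _ hd) (d'P _ hd')) _.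
by rewrite -mulrDl -splitr.
Qed.

Lemma cdiffM f g z l m : cdiff f z l -> cdiff g z m ->
  cdiff (fun w => f w * g w) z (l * g z + f z * m).
Proof.
move=> df dg e e0.
pose K := modulus (f z) + modulus (g z) + modulus l + 2.
have K0 : 0 < K by rewrite /K ltr_wpDl// !addr_ge0.
have [d1 d10 d1P] := df _ (divr_gt0 e0 (mulr_gt0 (ltr0n _ 3) K0)).
have [d2 d20 d2P] := dg _ (divr_gt0 e0 (mulr_gt0 (ltr0n _ 3) K0)).
have ek0 : 0 < Num.min 1 (e / (3 * K)).
  by rewrite lt_min ltr01 divr_gt0// mulr_gt0.
have [d3 d30 d3P] := cdiff_cont dg ek0.
exists (Num.min d1 (Num.min d2 d3)); first by rewrite !lt_min d10 d20.
move=> h; rewrite !le_min => /andP[h1 /andP[h2 h3]].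
have -> : f (z + h) * g (z + h) - f z * g z - (l * g z + f z * m) * h =
  (f (z + h) - f z - l * h) * g (z + h) + f z * (g (z + h) - g z - m * h)
   + l * h * (g (z + h) - g z) by ring.
have := d3P _ h3; rewrite le_min => /andP[g1 g2].
have gK : modulus (g (z + h)) <= modulus (g z) + 1.
  rewrite -(subrK (g z) (g (z + h))) addrC; apply: le_trans (ler_modulusD _ _) _.
  by rewrite lerD2l.
apply: le_trans (ler_modulusD _ _) _.
apply: le_trans (lerD (ler_modulusD _ _) (lexx _)) _.
rewrite !modulusM.
have eE : e = e / (3 * K) * K * 3 by field; rewrite gt_eqF.
set c := e / (3 * K) in eE d1P d2P g2.
have c0 : 0 <= c by rewrite /c divr_ge0// ?mulr_ge0// ltW.
have A1 : modulus (f (z + h) - f z - l * h) * modulus (g (z + h)) <=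
   c * modulus h * K.
  apply: ler_pM => //; first exact: d1P.
  by apply: le_trans gK _; rewrite /K; have := modulus_ge0 (f z); have := modulus_ge0 l; lra.
have A2 : modulus (f z) * modulus (g (z + h) - g z - m * h) <= K * (c * modulus h).
  apply: ler_pM => //; last exact: d2P.
  by rewrite /K; have := modulus_ge0 (g z); have := modulus_ge0 l; lra.
have A3 : modulus l * modulus h * modulus (g (z + h) - g z) <= K * modulus h * c.
  apply: ler_pM => //; first by rewrite mulr_ge0.
  rewrite ler_wpM2r//.
  by rewrite /K; have := modulus_ge0 (g z); have := modulus_ge0 (f z); lra.
rewrite eE; apply: le_trans (lerD (lerD A1 A2) A3) _.
by apply: eq_ler; ring.
Qed.

Lemma cdiff_comp f g z l m : cdiff f (g z) l -> cdiff g z m ->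
  cdiff (fun w => f (g w)) z (l * m).
Proof.
move=> df dg e e0.
pose K := modulus m + modulus l + 1.
have K0 : 0 < K by rewrite /K ltr_wpDl// !addr_ge0.
have c0 : 0 < e / (2 * K) by rewrite divr_gt0// mulr_gt0.
have c10 : 0 < Num.min 1 (e / (2 * K)) by rewrite lt_min ltr01.
have [d1 d10 d1P] := df _ c0.
have [d2 d20 d2P] := dg _ c10.
have [d3 d30 d3P] := cdiff_cont dg d10.
exists (Num.min d2 d3); first by rewrite lt_min d20.
move=> h; rewrite le_min => /andP[h2 h3].
set k := g (z + h) - g z.
have gE : g (z + h) = g z + k by rewrite /k [RHS]addrC subrK.
rewrite gE.
have -> : f (g z + k) - f (g z) - l * m * h =
  (f (g z + k) - f (g z) - l * k) + l * (k - m * h) by ring.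
apply: le_trans (ler_modulusD _ _) _; rewrite modulusM.
have k1 := d1P _ (d3P _ h3); rewrite -/k in k1.
have := d2P _ h2; rewrite -/k => k2.
have kK : modulus k <= K * modulus h.
  rewrite -(subrK (m * h) k); apply: le_trans (ler_modulusD _ _) _.
  rewrite modulusM; apply: le_trans (lerD k2 (lexx _)) _.
  rewrite -mulrDl ler_wpM2r// /K.
  have : Num.min 1 (e / (2 * K)) <= 1 by rewrite ge_min lexx.
  by have := modulus_ge0 l; lra.
have A1 : e / (2 * K) * modulus k <= e / (2 * K) * (K * modulus h).
  by rewrite ler_wpM2l// ltW.
have A2 : modulus l * modulus (k - m * h) <= K * (e / (2 * K) * modulus h).
  apply: ler_pM => //; first by rewrite /K; have := modulus_ge0 m; lra.
  apply: le_trans k2 _; rewrite ler_wpM2r//.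
  by rewrite ge_min lexx orbT.
apply: le_trans (lerD (le_trans k1 A1) A2) _.
by apply: eq_ler; field; rewrite gt_eqF.
Qed.

Lemma cdiff_inv z : z != 0 -> cdiff (fun w => w^-1) z (- z ^- 2).
Proof.
move=> z0 e e0.
have m0 : 0 < modulus z by rewrite modulus_gt0.
exists (Num.min (modulus z / 2) (e * modulus z ^+ 3 / 2)).
  by rewrite lt_min !divr_gt0// mulr_gt0// exprn_gt0.
move=> h; rewrite le_min => /andP[h1 h2].
have zh : modulus z / 2 <= modulus (z + h).
  have := lerB_modulus z (- h); rewrite modulusN opprK.
  by move: h1; rewrite ler_pdivlMr// ler_pdivrMr//; lra.
have zh0 : z + h != 0.
  by rewrite -modulus_gt0; apply: lt_le_trans zh; rewrite divr_gt0.
have -> : (z + h)^-1 - z^-1 - - z ^- 2 * h = h * (h * (z ^- 2 * (z + h)^-1)).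
  by field; rewrite zh0.
rewrite !modulusM mulrC ler_wpM2r// !modulusV modulusX.
have : (modulus (z + h))^-1 <= (modulus z / 2)^-1.
  by rewrite lef_pV2 ?posrE// ?modulus_gt0// divr_gt0.
move=> H; apply: (@le_trans _ _ (e * modulus z ^+ 3 / 2 *
  ((modulus z ^+ 2)^-1 * (modulus z / 2)^-1))).
  apply: ler_pM => //; first by rewrite mulr_ge0// invr_ge0 ?exprn_ge0.
  by rewrite ler_wpM2l// invr_ge0 exprn_ge0.
by apply: eq_ler; field; rewrite gt_eqF.
Qed.

Lemma cdiff_near f g z l d : 0 < d ->
  (forall h, modulus h <= d -> f (z + h) = g (z + h)) ->
  cdiff f z l -> cdiff g z l.
Proof.
move=> d0 fg df e e0; have [d' d'0 d'P] := df _ e0.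
exists (Num.min d d'); first by rewrite lt_min d0.
move=> h; rewrite le_min => /andP[h1 h2].
have := fg 0; rewrite addr0 modulus0 => /(_ (ltW d0)) <-.
by rewrite -fg// d'P.
Qed.

End EpsilonDelta.

(** * The complex exponential *)

Section ComplexExponential.
Context {R : realType}.
Implicit Types z w : R[i].

Definition cexp z : R[i] :=
  Complex (expR (complex.Re z) * cos (complex.Im z))
          (expR (complex.Re z) * sin (complex.Im z)).

Lemma cexpD z w : cexp (z + w) = cexp z * cexp w.
Proof.
case: z w => x y [x' y']; rewrite /cexp /= expRD cosD sinD.
by apply/eqP; rewrite eq_complex /=; apply/andP; split; apply/eqP; ring.
Qed.

Lemma cexp0 : cexp 0 = 1.
Proof. by rewrite /cexp/= expR0 cos0 sin0 mulr1 mulr0. Qed.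

Lemma cexp_neq0 z : cexp z != 0.
Proof.
apply/eqP => z0; have := cexpD z (- z); rewrite subrr cexp0 z0 mul0r.
by move/eqP; rewrite oner_eq0.
Qed.

Lemma modulus_cexp z : modulus (cexp z) = expR (complex.Re z).
Proof.
rewrite /cexp /= !exprMn -mulrDr cos2Dsin2 mulr1 sqrtr_sqr ger0_norm// expR_ge0.
Qed.

Lemma cexp_real (x : R) : cexp x%:C = (expR x)%:C.
Proof. by rewrite /cexp /= cos0 sin0 mulr1 mulr0. Qed.

Lemma cexpMn z n : cexp (n%:R * z) = cexp z ^+ n.
Proof.
elim: n => [|n ih]; first by rewrite mul0r cexp0 expr0.
by rewrite -addn1 natrD mulrDl mul1r cexpD ih exprD expr1.
Qed.

(** By [cexpD] the increment at [z] is [cexp z] times the increment at [0], and there the expansions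
    of [expR], [cos] and [sin] combine. *)
Lemma cdiff_cexp z : cdiff cexp z (cexp z).
Proof.
suff H : cdiff cexp 0 1.
  move=> e e0; have ez : 0 < e / modulus (cexp z).
    by rewrite divr_gt0// modulus_gt0 cexp_neq0.
  have [d d0 dP] := H _ ez; exists d => // h hd.
  have -> : cexp (z + h) - cexp z - cexp z * h =
     cexp z * (cexp (0 + h) - cexp 0 - 1 * h).
    by rewrite cexpD add0r cexp0; ring.
  rewrite modulusM; apply: le_trans (ler_wpM2l _ (dP _ hd)) _ => //.
  by rewrite mulrA [_ * (e / _)]mulrC divfK// gt_eqF// modulus_gt0 cexp_neq0.
move=> e e0.
(* The errors [T1], [T2], [T3] and [B3] below are at most [1], [2], [4] and [1] times [c * m], in
   all [8 * c * m]. *)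
pose c := Num.min 1 (e / 8).
have c0 : 0 < c by rewrite lt_min ltr01 divr_gt0.
have c1 : c <= 1 by rewrite /c ge_min lexx.
have ce : c <= e / 8 by rewrite /c ge_min lexx orbT.
clearbody c.
have [d1 d10 d1P] := is_derive_approx (is_derive_expR (0 : R)) c0.
have [d2 d20 d2P] := is_derive_approx (is_derive_cos (0 : R)) c0.
have [d3 d30 d3P] := is_derive_approx (is_derive_sin (0 : R)) c0.
exists (Num.min c (Num.min d1 (Num.min d2 d3))).
  by rewrite !lt_min c0 d10 d20 d30.
move=> h; rewrite !le_min => /andP[h0 /andP[h1 /andP[h2 h3]]].
apply: le_trans (modulus_le_ReIm _) _.
have := Re_le_modulus h; have := Im_le_modulus h.
set m := modulus h in h0 h1 h2 h3 *.
case: h @m h0 h1 h2 h3 => x y m h0 h1 h2 h3 /= yh xh.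
have A1 := d1P x (le_trans xh h1).
have A2 := d2P y (le_trans yh h2).
have A3 := d3P y (le_trans yh h3).
rewrite add0r expR0 mul1r in A1.
rewrite add0r cos0 sin0 oppr0 mul0r subr0 in A2.
rewrite add0r cos0 sin0 mul1r subr0 in A3.
have m0 : 0 <= m by exact: modulus_ge0.
have B1 : `|expR x - 1 - x| <= c * m by apply: le_trans A1 _; rewrite ler_wpM2l// ltW.
have B2 : `|cos y - 1| <= c * m by apply: le_trans A2 _; rewrite ler_wpM2l// ltW.
have B3 : `|sin y - y| <= c * m by apply: le_trans A3 _; rewrite ler_wpM2l// ltW.
rewrite !add0r expR0 cos0 sin0 !mulr1.
have -> : 1 * x - 0 * y = x by ring.
have -> : 1 * y + 0 * x = y by ring.
have -> : expR x * cos y - 1 - x = (expR x - 1 - x) * cos y + (1 + x) * (cos y - 1).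
  by ring.
have -> : expR x * sin y - 1 * 0 - y = (expR x - 1) * sin y + (sin y - y) by ring.
have C1 : `|cos y| <= 1 by rewrite ler_norml cos_geN1 cos_le1.
have x1 : `|x| <= 1 by apply: le_trans xh _; apply: le_trans c1.
have y1 : `|y| <= c by apply: le_trans yh _.
have T1 : `|(expR x - 1 - x) * cos y| <= c * m.
  by rewrite normrM -[leRHS]mulr1; apply: ler_pM.
have T2 : `|(1 + x) * (cos y - 1)| <= 2 * (c * m).
  rewrite normrM; apply: ler_pM => //.
  by apply: le_trans (ler_normD _ _) _; rewrite normr1; lra.
have T3 : `|(expR x - 1) * sin y| <= 2 * m * (2 * c).
  have cm : c * m <= m by rewrite ler_piMl.
  have mc : c * m <= c by rewrite ler_piMr ?(ltW c0)// (le_trans h0).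
  rewrite normrM; apply: ler_pM => //.
    have -> : expR x - 1 = (expR x - 1 - x) + x by ring.
    by apply: le_trans (ler_normD _ _) _; lra.
  have -> : sin y = (sin y - y) + y by ring.
  by apply: le_trans (ler_normD _ _) _; lra.
have := ler_normD ((expR x - 1 - x) * cos y) ((1 + x) * (cos y - 1)).
have := ler_normD ((expR x - 1) * sin y) (sin y - y).
have : 8 * (c * m) <= e * m by rewrite mulrA ler_wpM2r//; lra.
by nra.
Qed.

End ComplexExponential.

(** * Goursat's lemma *)

Section RectangleInduction.
Context {R : realType}.
Implicit Types a b c d x y : R.

(* Bisection: a property of rectangles that holds for all small rectangles around
   any point and is inherited from the four quarters holds for all rectangles. *)
Lemma rectangle_ind (Q : R -> R -> R -> R -> Prop) a b c d : a <= b -> c <= d ->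
  (forall x y, a <= x <= b -> c <= y <= d -> exists2 e : R, 0 < e &
    forall a' b' c' d', a' <= x <= b' -> c' <= y <= d' ->
      b' - a' <= e -> d' - c' <= e -> Q a' b' c' d') ->
  (forall a' b' c' d', a' <= b' -> c' <= d' ->
    let m := (a' + b') / 2 in let n := (c' + d') / 2 in
    Q a' m c' n -> Q m b' c' n -> Q a' m n d' -> Q m b' n d' -> Q a' b' c' d') ->
  Q a b c d.
Proof.
move=> ab cd Qloc Qsplit; apply: contrapT => nQ.
pose P (s : (R * R) * (R * R)) :=
  [/\ s.1.1 <= s.1.2, s.2.1 <= s.2.2 & ~ Q s.1.1 s.1.2 s.2.1 s.2.2].
pose half (u v : R * R) := [/\ u.1 <= v.1, v.2 <= u.2 & v.2 - v.1 = (u.2 - u.1) / 2].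
(* A rectangle without [Q] has a quarter without [Q]; iterating gives nested rectangles. *)
have step (s : {s | P s}) : {t : {t | P t} |
    half (sval s).1 (sval t).1 /\ half (sval s).2 (sval t).2}.
  apply: cid; case: s => -[[a' b'] [c' d']] [/= ab' cd' nQ'].
  have := Qsplit _ _ _ _ ab' cd' => /=; set m := _ / 2; set n := _ / 2 => S.
  have hl u v : half (u, v) (u, (u + v) / 2) \/ ~ (u <= v).
    by case: (leP u v) => h; [left|right; lra]; split => /=; lra.
  have [h1|h1] := pselect (Q a' m c' n); last first.
    have Pt : P ((a', m), (c', n)) by split => //=; rewrite /m /n; lra.
    by exists (exist _ _ Pt); rewrite /half /= /m /n; split; split; lra.
  have [h2|h2] := pselect (Q m b' c' n); last first.
    have Pt : P ((m, b'), (c', n)) by split => //=; rewrite /m /n; lra.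
    by exists (exist _ _ Pt); rewrite /half /= /m /n; split; split; lra.
  have [h3|h3] := pselect (Q a' m n d'); last first.
    have Pt : P ((a', m), (n, d')) by split => //=; rewrite /m /n; lra.
    by exists (exist _ _ Pt); rewrite /half /= /m /n; split; split; lra.
  have [h4|h4] := pselect (Q m b' n d'); last first.
    have Pt : P ((m, b'), (n, d')) by split => //=; rewrite /m /n; lra.
    by exists (exist _ _ Pt); rewrite /half /= /m /n; split; split; lra.
  by have := nQ' (S h1 h2 h3 h4).
have P0 : P ((a, b), (c, d)) by split.
pose f s := sval (step s).
pose t n := iter n f (exist _ _ P0).
have tS n : half (sval (t n)).1 (sval (t n.+1)).1 /\
            half (sval (t n)).2 (sval (t n.+1)).2 := svalP (step (t n)).
(* The common point of the nested intervals is the supremum of the left endpoints. *)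
have nested (u : nat -> R * R) : (forall n, half (u n) (u n.+1)) -> (u 0%N).1 <= (u 0%N).2 ->
    exists x, forall n, (u n).1 <= x <= (u n).2 /\
       (u n).2 - (u n).1 = ((u 0%N).2 - (u 0%N).1) / 2 ^+ n.
  move=> hu u0.
  have len n : (u n).2 - (u n).1 = ((u 0%N).2 - (u 0%N).1) / 2 ^+ n.
    elim: n => [|n ih]; first by rewrite expr0 divr1.
    by have [_ _ ->] := hu n; rewrite ih exprS; field; rewrite expf_neq0.
  have un n : (u n).1 <= (u n).2.
    by rewrite -subr_ge0 len divr_ge0 ?subr_ge0// exprn_ge0.
  have mono1 n k : (u n).1 <= (u (k + n)%N).1.
    elim: k => // k ih; apply: le_trans ih _; rewrite addSn.
    by have [] := hu (k + n)%N.
  have mono2 n k : (u (k + n)%N).2 <= (u n).2.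
    elim: k => // k ih; apply: le_trans ih; rewrite addSn.
    by have [] := hu (k + n)%N.
  have cross n m : (u n).1 <= (u m).2.
    apply: le_trans (mono1 n m) _; apply: le_trans (un _) _.
    by rewrite addnC; apply: mono2.
  pose E := range (fun n => (u n).1).
  have E0 : E !=set0 by exists (u 0%N).1; exists 0%N.
  have Eub m : ubound E (u m).2 by move=> _ [n _ <-]; exact: cross.
  exists (sup E) => n; split => //; apply/andP; split.
    by apply: ub_le_sup; [exists (u 0%N).2|exists n].
  exact: ge_sup.
have [x xP] := nested (fun n => (sval (t n)).1) (fun n => (tS n).1) ab.
have [y yP] := nested (fun n => (sval (t n)).2) (fun n => (tS n).2) cd.
have [] := Qloc x y.
- by have [] := xP 0%N.
- by have [] := yP 0%N.
move=> e e0 eP.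
have [n nP] : exists n, ((b - a) + (d - c)) / 2 ^+ n <= e.
  pose K := ((b - a) + (d - c)) / e.
  exists (Num.truncn K).+1; rewrite ler_pdivrMr ?exprn_gt0// mulrC -ler_pdivrMr//.
  rewrite -/K; apply: le_trans (ltW (truncnS_gt K)) _.
  by rewrite -natrX ler_nat ltnW// ltn_expl.
have [/= _ _] := svalP (t n); apply; apply: eP.
- by have [] := xP n.
- by have [] := yP n.
- have [_ ->] := xP n; apply: le_trans nP => /=.
  by rewrite ler_pM2r ?invr_gt0 ?exprn_gt0// lerDl subr_ge0.
- have [_ ->] := yP n; apply: le_trans nP => /=.
  by rewrite ler_pM2r ?invr_gt0 ?exprn_gt0// lerDr subr_ge0.
Qed.

End RectangleInduction.

Section SegmentIntegral.
Context {R : realType}.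
Implicit Types (a b c x : R) (f g : R -> R).
Notation leb := (@lebesgue_measure R).

Definition sint a b f : R := \int[leb]_(x in `[a, b]) f x.

Lemma eps_continuous f :
  (forall x (e : R), 0 < e -> exists2 d : R, 0 < d &
    forall h, `|h| <= d -> `|f (x + h) - f x| <= e) -> continuous f.
Proof.
move=> H x; apply/cvgrPdist_le => e e0; have [d d0 dP] := H x e e0.
apply/nbhs_ballP; exists d => //= y; rewrite /ball/= => xy.
have -> : y = x + (y - x) by ring.
by rewrite distrC dP// distrC ltW.
Qed.

Lemma continuous_sint f a b : continuous f ->
  leb.-integrable `[a, b] (EFin \o f).
Proof.
move=> cf; apply: continuous_compact_integrable; first exact: segment_compact.
exact: continuous_subspaceT.
Qed.

Lemma sintD f g a b : continuous f -> continuous g ->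
  sint a b (fun x => f x + g x) = sint a b f + sint a b g.
Proof. by move=> cf cg; rewrite /sint RintegralD//; exact: continuous_sint. Qed.

Lemma sintB f g a b : continuous f -> continuous g ->
  sint a b (fun x => f x - g x) = sint a b f - sint a b g.
Proof. by move=> cf cg; rewrite /sint RintegralB//; exact: continuous_sint. Qed.

Lemma sintZ f a b c : continuous f -> sint a b (fun x => c * f x) = c * sint a b f.
Proof. by move=> cf; rewrite /sint RintegralZl//; exact: continuous_sint. Qed.

Lemma sint_cst a b c : a <= b -> sint a b (fun=> c) = c * (b - a).
Proof.
move=> ab; rewrite /sint Rintegral_cst//= lebesgue_measure_itv/= lte_fin.
by move: ab; rewrite le_eqVlt => /predU1P[->|->]//; rewrite ltxx subrr.
Qed.

Lemma sint_le f a b M : a <= b -> continuous f ->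
  (forall x, a <= x <= b -> `|f x| <= M) -> `|sint a b f| <= M * (b - a).
Proof.
move=> ab cf fM; apply: le_trans (le_normr_Rintegral _ _) _ => //.
  exact: continuous_sint.
rewrite -sint_cst//; apply: le_Rintegral => //.
- by apply: (@continuous_sint (fun x => `|f x|)) => x; apply: cvg_norm; exact: cf.
- by apply: (@continuous_sint (fun=> M)) => x; exact: cvg_cst.
Qed.

Lemma sint_split f a m b : continuous f -> a <= m -> m <= b ->
  sint a b f = sint a m f + sint m b f.
Proof.
move=> cf am mb.
have := @Rintegral_itvB R f (BLeft a) (BRight b) m (continuous_sint a b cf).
rewrite !bnd_simp => /(_ am mb) H.
rewrite /sint -[X in _ = _ + X]Rintegral_itv_obnd_cbnd.
  by rewrite -H addrC subrK.
apply: integrableS (continuous_sint a b cf) => //.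
by apply: subset_itv; rewrite bnd_simp.
Qed.

End SegmentIntegral.

Section Goursat.
Context {R : realType}.
Implicit Types a b c d x y : R.

Definition is_linear_approx (P : R -> R -> R) x y p q :=
  forall e : R, 0 < e -> exists2 d : R, 0 < d & forall x' y',
    `|x' - x| <= d -> `|y' - y| <= d ->
    `|P x' y' - P x y - p * (x' - x) - q * (y' - y)| <= e * (`|x' - x| + `|y' - y|).

(** The shared slope [k], of [P] in [y] and of [Q] in [x], says that [P dx + Q dy] is closed at the
    point. Around a small rectangle the linear parts cancel and the error is at most [e] times the
    square of the half perimeter, up to the factor [2]. Four quarters have exactly the same total
    bound, so bisection propagates it, and [e] is arbitrary. *)
Lemma goursat (P Q : R -> R -> R) a b c d : a <= b -> c <= d ->
  (forall y, continuous (P^~ y)) -> (forall x, continuous (Q x)) ->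
  (forall x y, a <= x <= b -> c <= y <= d -> exists p k q,
     is_linear_approx P x y p k /\ is_linear_approx Q x y k q) ->
  sint a b (P^~ c) - sint a b (P^~ d) + (sint c d (Q b) - sint c d (Q a)) = 0.
Proof.
move=> ab cd cP cQ H.
pose I a b c d :=
  sint a b (P^~ c) - sint a b (P^~ d) + (sint c d (Q b) - sint c d (Q a)).
suff K : forall e : R, 0 < e -> `|I a b c d| <= e * 2 * ((b - a) + (d - c)) ^+ 2.
  apply/eqP; rewrite -normr_le0; apply/ler_addgt0Pr => e e0; rewrite add0r.
  set w := ((b - a) + (d - c)) ^+ 2 in K.
  have w0 : 0 <= w by exact: sqr_ge0.
  have w1 : 0 < 2 * (w + 1) by lra.
  apply: le_trans (K _ (divr_gt0 e0 w1)) _.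
  have -> : e / (2 * (w + 1)) * 2 * w = e * (w / (w + 1)) by field; lra.
  by rewrite ler_piMr// ?(ltW e0)// ler_pdivrMr; lra.
move=> e e0.
apply: (@rectangle_ind R (fun a b c d =>
  `|I a b c d| <= e * 2 * ((b - a) + (d - c)) ^+ 2)) => //.
- move=> x y abx cdy; have [p [k [q [aP aQ]]]] := H x y abx cdy.
  have [d1 d10 d1P] := aP _ e0; have [d2 d20 d2P] := aQ _ e0.
  exists (Num.min d1 d2); first by rewrite lt_min d10.
  move=> a' b' c' d' abx' cdy'; rewrite !le_min => /andP[w1 w2] /andP[h1 h2].
  set w := b' - a' in w1 w2 *; set h := d' - c' in h1 h2 *.
  have ab' : a' <= b' by lra.
  have cd' : c' <= d' by lra.
  have D1 u : a' <= u <= b' -> `|u - x| <= w.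
    by move=> ?; rewrite ler_norml /w; lra.
  have D2 u : c' <= u <= d' -> `|u - y| <= h.
    by move=> ?; rewrite ler_norml /h; lra.
  have cc : c' <= c' <= d' by lra.
  have dd : c' <= d' <= d' by lra.
  have aa : a' <= a' <= b' by lra.
  have bb : a' <= b' <= b' by lra.
  have cst_cont (v : R) : continuous (fun _ : R => v) by move=> ?; exact: cvg_cst.
  have cP' : continuous (fun u => P u c' - P u d').
    by move=> u; apply: cvgB; exact: cP.
  have cQ' : continuous (fun u => Q b' u - Q a' u).
    by move=> u; apply: cvgB; exact: cQ.
  (* Adding and subtracting [k * h * w] makes each pair of opposite sides small by itself. *)
  have IE : I a' b' c' d' =
      sint a' b' (fun u => (P u c' - P u d') + k * h) +
      sint c' d' (fun u => (Q b' u - Q a' u) - k * w).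
    rewrite sintD// sintB// !sintB// !sint_cst// -/w -/h /I; ring.
  have B1 : `|sint a' b' (fun u => (P u c' - P u d') + k * h)| <= e * 2 * (w + h) * w.
    apply: sint_le => //; first by move=> u; apply: cvgD; [exact: cP'|exact: cvg_cst].
    move=> u abu.
    have E1 := d1P u c' (le_trans (D1 _ abu) w1) (le_trans (D2 _ cc) h1).
    have E2 := d1P u d' (le_trans (D1 _ abu) w1) (le_trans (D2 _ dd) h1).
    have -> : P u c' - P u d' + k * h =
      (P u c' - P x y - p * (u - x) - k * (c' - y)) -
      (P u d' - P x y - p * (u - x) - k * (d' - y)) by rewrite /h; ring.
    apply: le_trans (ler_normB _ _) _; apply: le_trans (lerD E1 E2) _.
    rewrite -mulrDr -!(mulrA e) ler_wpM2l ?(ltW e0)//.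
    by have := D1 _ abu; have := D2 _ cc; have := D2 _ dd; lra.
  have B2 : `|sint c' d' (fun u => (Q b' u - Q a' u) - k * w)| <= e * 2 * (w + h) * h.
    apply: sint_le => //; first by move=> u; apply: cvgB; [exact: cQ'|exact: cvg_cst].
    move=> u cdu.
    have E1 := d2P b' u (le_trans (D1 _ bb) w2) (le_trans (D2 _ cdu) h2).
    have E2 := d2P a' u (le_trans (D1 _ aa) w2) (le_trans (D2 _ cdu) h2).
    have -> : Q b' u - Q a' u - k * w =
      (Q b' u - Q x y - k * (b' - x) - q * (u - y)) -
      (Q a' u - Q x y - k * (a' - x) - q * (u - y)) by rewrite /w; ring.
    apply: le_trans (ler_normB _ _) _; apply: le_trans (lerD E1 E2) _.
    rewrite -mulrDr -!(mulrA e) ler_wpM2l ?(ltW e0)//.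
    by have := D2 _ cdu; have := D1 _ aa; have := D1 _ bb; lra.
  rewrite IE; apply: le_trans (ler_normD _ _) _; apply: le_trans (lerD B1 B2) _.
  by apply: eq_ler; ring.
- move=> a' b' c' d' ab' cd' m n q1 q2 q3 q4.
  have am : a' <= m by rewrite /m; lra.
  have mb : m <= b' by rewrite /m; lra.
  have cn : c' <= n by rewrite /n; lra.
  have nd : n <= d' by rewrite /n; lra.
  have -> : I a' b' c' d' = (I a' m c' n + I m b' c' n) + (I a' m n d' + I m b' n d').
    rewrite /I (sint_split (cP c') am mb) (sint_split (cP d') am mb).
    rewrite (sint_split (cQ b') cn nd) (sint_split (cQ a') cn nd); ring.
  apply: le_trans (ler_normD _ _) _.
  apply: le_trans (lerD (ler_normD _ _) (ler_normD _ _)) _.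
  apply: le_trans (lerD (lerD q1 q2) (lerD q3 q4)) _.
  by apply: eq_ler; rewrite /m /n; field.
Qed.

End Goursat.

(** * Taylor series of entire functions *)

Section Continuity.
Context {R : realType}.
Implicit Types (f g : R[i] -> R[i]) (z : R[i]).

Definition cdiffable f z := exists l, cdiff f z l.

Lemma cdiffable_cont f z : cdiffable f z -> ccont f z.
Proof. by case=> l; exact: cdiff_cont. Qed.

Lemma cdiffable_cst c z : cdiffable (fun=> c) z.
Proof. by exists 0; exact: cdiff_cst. Qed.

Lemma cdiffable_id z : cdiffable id z.
Proof. by exists 1; exact: cdiff_id. Qed.

Lemma cdiffableD f g z : cdiffable f z -> cdiffable g z ->
  cdiffable (fun w => f w + g w) z.
Proof. by move=> [l fl] [m gm]; exists (l + m); exact: cdiffD. Qed.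

Lemma cdiffableM f g z : cdiffable f z -> cdiffable g z ->
  cdiffable (fun w => f w * g w) z.
Proof. by move=> [l fl] [m gm]; exists (l * g z + f z * m); exact: cdiffM. Qed.

Lemma cdiffableX f n z : cdiffable f z -> cdiffable (fun w => f w ^+ n) z.
Proof.
move=> fz; elim: n => [|n ih].
  by have := cdiffable_cst 1 z.
have := cdiffableM fz ih; congr (cdiffable _ z).
by apply/funext => w; rewrite exprS.
Qed.

Lemma cdiffable_comp f g z : cdiffable f (g z) -> cdiffable g z ->
  cdiffable (fun w => f (g w)) z.
Proof. by move=> [l fl] [m gm]; exists (l * m); exact: cdiff_comp. Qed.

Lemma cdiffable_inv z : z != 0 -> cdiffable (fun w => w^-1) z.
Proof. by move=> z0; exists (- z ^- 2); exact: cdiff_inv. Qed.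

Lemma cdiffable_cexp z : cdiffable cexp z.
Proof. by exists (cexp z); exact: cdiff_cexp. Qed.

Lemma cdiffable_near f g z (d : R) : 0 < d ->
  (forall h, modulus h <= d -> f (z + h) = g (z + h)) ->
  cdiffable f z -> cdiffable g z.
Proof. by move=> d0 fg [l fl]; exists l; exact: cdiff_near d0 fg fl. Qed.

Lemma ccontM f g z : ccont f z -> ccont g z -> ccont (fun w => f w * g w) z.
Proof.
move=> cf cg e e0; pose K := modulus (f z) + modulus (g z) + 1.
have K0 : 0 < K by rewrite /K ltr_wpDl// !addr_ge0.
have c0 : 0 < Num.min 1 (e / (2 * K)) by rewrite lt_min ltr01 divr_gt0// mulr_gt0.
have [d d0 dP] := cf _ c0; have [d' d'0 d'P] := cg _ c0.
exists (Num.min d d'); first by rewrite lt_min d0.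
move=> h; rewrite le_min => /andP[/dP + /d'P].
rewrite !le_min => /andP[_ h1] /andP[h2 h3].
have -> : f (z + h) * g (z + h) - f z * g z =
  (f (z + h) - f z) * g (z + h) + f z * (g (z + h) - g z) by ring.
have gK : modulus (g (z + h)) <= K.
  rewrite -(subrK (g z) (g (z + h))); apply: le_trans (ler_modulusD _ _) _.
  by rewrite /K; have := modulus_ge0 (f z); lra.
have fK : modulus (f z) <= K by rewrite /K; have := modulus_ge0 (g z); lra.
apply: le_trans (ler_modulusD _ _) _; rewrite !modulusM.
apply: le_trans (lerD (ler_pM _ _ h1 gK) (ler_pM _ _ fK h3)) _ => //.
by apply: eq_ler; field; rewrite gt_eqF.
Qed.

Lemma ccont_comp f g z : ccont f (g z) -> ccont g z -> ccont (fun w => f (g w)) z.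
Proof.
move=> cf cg e e0; have [d d0 dP] := cf _ e0; have [d' d'0 d'P] := cg _ d0.
exists d' => // h /d'P gh.
have -> : g (z + h) = g z + (g (z + h) - g z) by rewrite [RHS]addrC subrK.
exact: dP.
Qed.

(** Rectangle induction plays the part of compactness: continuity bounds [f] near each point, and
    the maximum of four bounds serves the union of the quarters. *)
Lemma ccont_bounded f (a b c d : R) : (forall z, ccont f z) -> a <= b -> c <= d ->
  exists M, forall x y, a <= x <= b -> c <= y <= d -> modulus (f (Complex x y)) <= M.
Proof.
move=> cf ab cd; apply: (@rectangle_ind R (fun a b c d => exists M, forall x y,
  a <= x <= b -> c <= y <= d -> modulus (f (Complex x y)) <= M)) => //.
- move=> x y _ _; have [e e0 eP] := cf (Complex x y) 1 ltr01.
  exists (e / 2); first by rewrite divr_gt0.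
  move=> a' b' c' d' abx cdy ab' cd'; exists (modulus (f (Complex x y)) + 1) => u v abu cdv.
  have := eP (Complex (u - x) (v - y)).
  have -> : Complex x y + Complex (u - x) (v - y) = Complex u v.
    by apply/eqP; rewrite eq_complex /=; apply/andP; split; apply/eqP; ring.
  move=> H; rewrite -(subrK (f (Complex x y)) (f (Complex u v))) [leRHS]addrC.
  apply: le_trans (ler_modulusD _ _) _; rewrite lerD2r; apply: H.
  apply: le_trans (modulus_le_ReIm _) _ => /=.
  have : `|u - x| <= e / 2 by rewrite ler_norml; lra.
  have : `|v - y| <= e / 2 by rewrite ler_norml; lra.
  by lra.
- move=> a' b' c' d' ab' cd' m n [M1 H1] [M2 H2] [M3 H3] [M4 H4].
  exists (Num.max (Num.max M1 M2) (Num.max M3 M4)) => x y /andP[x1 x2] /andP[y1 y2].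
  rewrite !le_max; have [xm|/ltW xm] := leP x m; have [yn|/ltW yn] := leP y n.
  + by rewrite H1 ?x1 ?y1.
  + by rewrite H3 ?x1 ?yn ?y2 ?orbT.
  + by rewrite H2 ?xm ?y1 ?x2 ?orbT.
  + by rewrite H4 ?xm ?yn ?x2 ?y2 ?orbT.
Qed.

Lemma ccont_bounded_disc f r : (forall z, ccont f z) ->
  exists M, forall z, modulus z <= r -> modulus (f z) <= M.
Proof.
move=> cf; have [r0|r0] := leP 0 r; last first.
  by exists 0 => z zr; have := modulus_ge0 z; lra.
have [M MP] := @ccont_bounded f (- r) r (- r) r cf ltac:(lra) ltac:(lra).
exists M => -[x y] zr; apply: MP.
- by rewrite -ler_norml; apply: le_trans zr; exact: (Re_le_modulus (Complex x y)).
- by rewrite -ler_norml; apply: le_trans zr; exact: (Im_le_modulus (Complex x y)).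
Qed.

End Continuity.

(** * Integrals of periodic functions along vertical segments *)

Section CircleIntegral.
Context {R : realType}.
Implicit Types (g h : R -> R[i]) (K f : R[i] -> R[i]) (z : R[i]) (r s t : R).

Definition cpath g := forall x (e : R), 0 < e -> exists2 d : R, 0 < d &
  forall h : R, `|h| <= d -> modulus (g (x + h) - g x) <= e.

Lemma cpath_Re g : cpath g -> continuous (fun x => complex.Re (g x)).
Proof.
move=> cg; apply: eps_continuous => x e e0; have [d d0 dP] := cg x e e0.
exists d => // h /dP; apply: le_trans; rewrite -cReN -cReD; exact: Re_le_modulus.
Qed.

Lemma cpath_Im g : cpath g -> continuous (fun x => complex.Im (g x)).
Proof.
move=> cg; apply: eps_continuous => x e e0; have [d d0 dP] := cg x e e0.
exists d => // h /dP; apply: le_trans; rewrite -cImN -cImD; exact: Im_le_modulus.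
Qed.

Definition cint g : R[i] :=
  Complex (sint 0 (2 * pi) (fun x => complex.Re (g x)))
          (sint 0 (2 * pi) (fun x => complex.Im (g x))).

Let twopi_ge0 : 0 <= 2 * pi :> R.
Proof. by rewrite mulr_ge0// pi_ge0. Qed.

Lemma cintD g h : cpath g -> cpath h -> cint (fun x => g x + h x) = cint g + cint h.
Proof.
move=> cg ch; rewrite /cint.
under [X in sint _ _ X]eq_fun do rewrite cReD.
under [X in Complex _ (sint _ _ X)]eq_fun do rewrite cImD.
by rewrite !sintD//; [exact: cpath_Im|exact: cpath_Im|exact: cpath_Re|exact: cpath_Re].
Qed.

Lemma cintZ (c : R[i]) g : cpath g -> cint (fun x => c * g x) = c * cint g.
Proof.
move=> cg; rewrite /cint; case: c => a b.
have cr := cpath_Re cg; have ci := cpath_Im cg.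
have cZ (k : R) (u : R -> R) : continuous u -> continuous (fun x => k * u x).
  by move=> cu x; apply: cvgM; [exact: cvg_cst|exact: cu].
under [X in sint _ _ X]eq_fun do rewrite cReM.
under [X in Complex _ (sint _ _ X)]eq_fun do rewrite cImM.
rewrite sintB ?sintD ?sintZ//; try exact: cZ.
Qed.

Lemma cint_cst (c : R[i]) : cint (fun=> c) = c * (2 * pi)%:C.
Proof.
rewrite /cint !sint_cst// subr0; case: c => a b.
by apply/eqP; rewrite eq_complex /=; apply/andP; split; apply/eqP; ring.
Qed.

Lemma cint_le g (M : R) : cpath g -> (forall x, modulus (g x) <= M) ->
  modulus (cint g) <= 4 * pi * M.
Proof.
move=> cg gM; apply: le_trans (modulus_le_ReIm _) _ => /=.
have H1 : `|sint 0 (2 * pi) (fun x => complex.Re (g x))| <= M * (2 * pi - 0).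
  apply: sint_le => //; first exact: cpath_Re.
  by move=> x _; apply: le_trans (gM x); exact: Re_le_modulus.
have H2 : `|sint 0 (2 * pi) (fun x => complex.Im (g x))| <= M * (2 * pi - 0).
  apply: sint_le => //; first exact: cpath_Im.
  by move=> x _; apply: le_trans (gM x); exact: Im_le_modulus.
apply: le_trans (lerD H1 H2) _; apply: eq_ler; ring.
Qed.

Lemma ccont_cpath f s : (forall z, ccont f z) -> cpath (fun x => f (Complex s x)).
Proof.
move=> cf x e e0; have [d d0 dP] := cf (Complex s x) e e0; exists d => // h hd.
have -> : Complex s (x + h) = Complex s x + Complex 0 h.
  by apply/eqP; rewrite eq_complex /= addr0 !eqxx.
apply: dP; apply: le_trans (modulus_le_ReIm _) _ => /=.
by rewrite normr0 add0r.
Qed.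

(** The Cauchy-Riemann equations, with both slopes read off from [l]. *)
Lemma cdiff_linear_approx f (x y : R) (l : R[i]) : cdiff f (Complex x y) l ->
  is_linear_approx (fun x y => complex.Re (f (Complex x y))) x y
    (complex.Re l) (- complex.Im l) /\
  is_linear_approx (fun x y => complex.Im (f (Complex x y))) x y
    (complex.Im l) (complex.Re l).
Proof.
move=> df.
suff H : forall e : R, 0 < e -> exists2 d : R, 0 < d & forall x' y',
    `|x' - x| <= d -> `|y' - y| <= d ->
    modulus (f (Complex x' y') - f (Complex x y) - l * Complex (x' - x) (y' - y))
     <= e * (`|x' - x| + `|y' - y|).
  split=> e e0; have [d d0 dP] := H e e0; exists d => // x' y' x'd y'd;
    apply: le_trans (dP _ _ x'd y'd).
  - apply: le_trans (Re_le_modulus _); rewrite !(cReD, cReN, cReM) /=.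
    by apply: eq_ler; congr (`|_|); ring.
  - apply: le_trans (Im_le_modulus _); rewrite !(cImD, cImN, cImM) /=.
    by apply: eq_ler; congr (`|_|); ring.
move=> e e0; have [d d0 dP] := df e e0.
exists (d / 2); first by rewrite divr_gt0.
move=> x' y' x'd y'd.
have hd : modulus (Complex (x' - x) (y' - y)) <= `|x' - x| + `|y' - y|.
  exact: (modulus_le_ReIm (Complex (x' - x) (y' - y))).
have := dP (Complex (x' - x) (y' - y)).
have -> : Complex x y + Complex (x' - x) (y' - y) = Complex x' y'.
  by apply/eqP; rewrite eq_complex /=; apply/andP; split; apply/eqP; ring.
move=> H; apply: le_trans (H _) _; last by rewrite ler_wpM2l// ltW.
by lra.
Qed.

(** Cauchy's theorem on a rectangle whose horizontal sides cancel by periodicity. [G1] concerns the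
    imaginary part of [f dz] and [G2] minus its real part; as [dz = i dy] on the vertical sides,
    they yield the real and the imaginary part of the claim. *)
Lemma cint_const f s t : s <= t -> (forall z, ccont f z) ->
  (forall z, s <= complex.Re z <= t -> cdiffable f z) ->
  (forall x, f (Complex x (2 * pi)) = f (Complex x 0)) ->
  cint (fun x => f (Complex s x)) = cint (fun x => f (Complex t x)).
Proof.
move=> st cf df per.
have contx y : cpath (fun x => f (Complex x y)).
  move=> x e e0; have [d d0 dP] := cf (Complex x y) e e0; exists d => // h hd.
  have -> : Complex (x + h) y = Complex x y + Complex h 0.
    by apply/eqP; rewrite eq_complex /= addr0 !eqxx.
  apply: dP; apply: le_trans (modulus_le_ReIm _) _ => /=.
  by rewrite normr0 addr0.
have conty x : cpath (fun y => f (Complex x y)) by exact: ccont_cpath.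
have G1 := @goursat R (fun x y => complex.Im (f (Complex x y)))
  (fun x y => complex.Re (f (Complex x y))) s t 0 (2 * pi) st twopi_ge0
  (fun y => cpath_Im (contx y)) (fun x => cpath_Re (conty x)).
have G2 := @goursat R (fun x y => - complex.Re (f (Complex x y)))
  (fun x y => complex.Im (f (Complex x y))) s t 0 (2 * pi) st twopi_ge0
  (fun y x => cvgN (@cpath_Re _ (contx y) x)) (fun x => cpath_Im (conty x)).
have per1 (F : R[i] -> R) : (fun x => F (f (Complex x (2 * pi)))) =
    (fun x => F (f (Complex x 0))) by apply/funext => x; rewrite per.
apply/eqP; rewrite eq_complex /=; apply/andP; split.
- move: G1; rewrite (per1 (@complex.Im R)) subrr add0r => G1.
  rewrite eq_sym -subr_eq0; apply/eqP; apply: G1 => x y sxt _.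
  have [l dl] := df (Complex x y) sxt.
  have [H1 H2] := cdiff_linear_approx dl.
  by exists (complex.Im l), (complex.Re l), (- complex.Im l).
- move: G2; rewrite (per1 (fun z => - complex.Re z)) subrr add0r => G2.
  rewrite eq_sym -subr_eq0; apply/eqP; apply: G2 => x y sxt _.
  have [l dl] := df (Complex x y) sxt.
  have [H1 H2] := cdiff_linear_approx dl.
  exists (- complex.Re l), (complex.Im l), (complex.Re l); split => //.
  move=> e e0; have [d d0 dP] := H1 e e0; exists d => // x' y' x'd y'd.
  apply: le_trans (dP _ _ x'd y'd); rewrite -normrN.
  by apply: eq_ler; congr (`|_|); ring.
Qed.

(** Continuity of [f] is made uniform along the segment by rectangle induction on a rectangle of
    width [0]. *)
Lemma cint_cont f s : (forall z, ccont f z) -> forall e : R, 0 < e ->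
  exists2 d : R, 0 < d & forall t, `|t| <= d ->
  modulus (cint (fun x => f (Complex (s + t) x)) - cint (fun x => f (Complex s x))) <= e.
Proof.
move=> cf e e0; have pi40 : 0 < 4 * (@pi R) by rewrite mulr_gt0// pi_gt0.
have [d d0 dP] : exists2 d : R, 0 < d & forall t, `|t| <= d -> forall x,
   0 <= x <= 2 * pi ->
   modulus (f (Complex (s + t) x) - f (Complex s x)) <= e / (4 * pi).
  apply: (@rectangle_ind R (fun _ _ c c' => exists2 d : R, 0 < d & forall t,
    `|t| <= d -> forall x, c <= x <= c' ->
    modulus (f (Complex (s + t) x) - f (Complex s x)) <= e / (4 * pi)) s s) => //.
  - move=> x y _ _; have e2 : 0 < e / (4 * pi) / 2 by rewrite !divr_gt0.
    have [d d0 dP] := cf (Complex s y) _ e2.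
    exists (d / 2); first by rewrite divr_gt0.
    move=> _ _ c' d' _ cdy _ cd'; exists (d / 2); first by rewrite divr_gt0.
    move=> t td u cdu.
    have yu : `|u - y| <= d / 2 by rewrite ler_norml; lra.
    have -> : Complex (s + t) u = Complex s y + Complex t (u - y).
      by apply/eqP; rewrite eq_complex /=; apply/andP; split; apply/eqP; ring.
    have -> : Complex s u = Complex s y + Complex 0 (u - y).
      by apply/eqP; rewrite eq_complex /=; apply/andP; split; apply/eqP; ring.
    rewrite -[X in X - _](subrK (f (Complex s y))) -addrA.
    apply: le_trans (ler_modulusD _ _) _; rewrite [leRHS]splitr; apply: lerD.
      apply: dP; apply: le_trans (modulus_le_ReIm _) _ => /=; lra.
    rewrite modulusBC.
    by apply: dP; apply: le_trans (modulus_le_ReIm _) _ => /=; rewrite normr0; lra.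
  - move=> a' b' c' d' _ _ m n [d1 d10 H1] _ [d2 d20 H2] _.
    exists (Num.min d1 d2); first by rewrite lt_min d10.
    move=> t; rewrite le_min => /andP[t1 t2] x /andP[x1 x2].
    have [xn|/ltW xn] := leP x n; first by apply: H1 => //; rewrite x1.
    by apply: H2 => //; rewrite xn.
exists d => // t td.
have H (a b : R) (g h : R -> R) : a <= b -> continuous g -> continuous h ->
   (forall x, a <= x <= b -> `|g x - h x| <= e / (4 * pi)) ->
   `|sint a b g - sint a b h| <= e / (4 * pi) * (b - a).
  move=> ab cg ch gh; rewrite -sintB//; apply: sint_le => //.
  by move=> x; apply: cvgB; [exact: cg|exact: ch].
apply: le_trans (modulus_le_ReIm _) _ => /=.
have K1 := H 0 (2 * pi) _ _ twopi_ge0 (cpath_Re (ccont_cpath (s + t) cf))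
  (cpath_Re (ccont_cpath s cf)).
have K2 := H 0 (2 * pi) _ _ twopi_ge0 (cpath_Im (ccont_cpath (s + t) cf))
  (cpath_Im (ccont_cpath s cf)).
apply: le_trans (lerD (K1 _) (K2 _)) _.
- move=> x xP; apply: le_trans (dP t td x xP).
  by rewrite -cReN -cReD; exact: Re_le_modulus.
- move=> x xP; apply: le_trans (dP t td x xP).
  by rewrite -cImN -cImD; exact: Im_le_modulus.
- have := @pi_gt0 R; clear; move: (@pi R) => p p0.
  by apply: eq_ler; field; rewrite gt_eqF.
Qed.

End CircleIntegral.

Section Taylor.
Context {R : realType}.
Implicit Types (K f : R[i] -> R[i]) (z : R[i]) (r s t : R).

(* The circle of radius [expR s] is parametrized by [cexp (s + i x)]: this turns
   the integrals over all the circles into integrals of one periodic function over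
   vertical segments, to which Goursat's lemma for rectangles applies. *)
Definition circ K s : R[i] := cint (fun x => K (cexp (Complex s x))).

Lemma modulus_cexp_Complex s (x : R) : modulus (cexp (Complex s x)) = expR s.
Proof. by rewrite modulus_cexp. Qed.

Lemma ccont_cexp K : (forall z, z != 0 -> ccont K z) ->
  forall z, ccont (fun w => K (cexp w)) z.
Proof.
move=> cK z; apply: ccont_comp; first by apply: cK; exact: cexp_neq0.
exact: cdiffable_cont (cdiffable_cexp z).
Qed.

Lemma circ_path K s : (forall z, z != 0 -> ccont K z) ->
  cpath (fun x => K (cexp (Complex s x))).
Proof.
by move=> cK; apply: (@ccont_cpath _ (fun w => K (cexp w))) => z; exact: ccont_cexp.
Qed.

Lemma circ_const K s t : s <= t -> (forall z, z != 0 -> ccont K z) ->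
  (forall z, expR s <= modulus z <= expR t -> cdiffable K z) -> circ K s = circ K t.
Proof.
move=> st cK dK; apply: (@cint_const _ (fun w => K (cexp w))) => //.
- exact: ccont_cexp.
- move=> z sz; apply: (@cdiffable_comp _ K); last exact: cdiffable_cexp.
  by apply: dK; rewrite modulus_cexp !ler_expR.
- by move=> x; rewrite /cexp /= mulr_natl cos2pi sin2pi cos0 sin0.
Qed.

Lemma circ_constT K s t : (forall z, z != 0 -> cdiffable K z) -> circ K s = circ K t.
Proof.
move=> dK.
have cK z : z != 0 -> ccont K z by move=> z0; exact: cdiffable_cont (dK z z0).
have dK' a b z : expR a <= modulus z <= expR b -> cdiffable K z.
  move=> /andP[az _]; apply: dK; rewrite -modulus_gt0.
  by apply: lt_le_trans az; exact: expR_gt0.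
have [st|/ltW ts] := leP s t; first exact: circ_const st cK (@dK' _ _).
by symmetry; exact: circ_const ts cK (@dK' _ _).
Qed.

Lemma circ_le K s (M : R) : (forall z, z != 0 -> ccont K z) ->
  (forall z, modulus z = expR s -> modulus (K z) <= M) ->
  modulus (circ K s) <= 4 * pi * M.
Proof.
move=> cK KM; apply: cint_le; first exact: circ_path.
by move=> x; apply: KM; exact: modulus_cexp_Complex.
Qed.

Lemma circ_bound : exists2 B : R, 0 < B & forall K s (M : R),
  (forall z, z != 0 -> ccont K z) ->
  (forall z, modulus z = expR s -> modulus (K z) <= M) -> modulus (circ K s) <= B * M.
Proof.
by exists (4 * pi); [rewrite mulr_gt0// pi_gt0|move=> K s M; exact: circ_le].
Qed.

Lemma circ_cont K s : (forall z, z != 0 -> ccont K z) -> forall e : R, 0 < e ->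
  exists2 d : R, 0 < d & forall t, `|t| <= d ->
  modulus (circ K (s + t) - circ K s) <= e.
Proof.
by move=> cK; apply: (@cint_cont _ (fun w => K (cexp w))) => z; exact: ccont_cexp.
Qed.

(* [K] need not be differentiable on the circle of radius [expR s0]. *)
Lemma circ_eq0 K s0 s (M : R) : s0 < s -> (forall z, z != 0 -> ccont K z) ->
  (forall z, z != 0 -> modulus z != expR s0 -> cdiffable K z) ->
  (forall z, modulus z <= 1 -> modulus (K z) <= M * modulus z) ->
  circ K s = 0.
Proof.
move=> s0s cK dK KM; apply/eqP; rewrite -modulus_eq0 eq_le modulus_ge0 andbT.
apply/ler_addgt0Pr => e e0; rewrite add0r.
have e3 : 0 < e / 3 by rewrite divr_gt0.
have [d d0 dP] := circ_cont s0 cK e3.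
pose t := Num.min d (s - s0).
have t0 : 0 < t by rewrite lt_min d0 subr_gt0.
have td : t <= d by rewrite ge_min lexx.
have ts : t <= s - s0 by rewrite ge_min lexx orbT.
clearbody t.
have E1 : circ K s = circ K (s0 + t).
  symmetry; apply: circ_const => //; first lra.
  move=> z /andP[z1 _]; apply: dK.
    by rewrite -modulus_gt0; apply: lt_le_trans z1; exact: expR_gt0.
  by rewrite gt_eqF//; apply: lt_le_trans z1; rewrite ltr_expR; lra.
have [B B0 BP] := circ_bound.
pose D := 3 * (B * (`|M| + 1)).
have D0 : 0 < D by rewrite /D !mulr_gt0// ltr_wpDl.
(* A circle so small that the vanishing of [K] at [0] makes its integral at most [e / 3]. The
   integral is constant on either side of [s0], and crossing from [s0 - t] to [s0 + t] costs [e / 3]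
   twice by continuity. *)
pose T := Num.min 0 (Num.min (s0 - t) (ln (e / D))).
have T0 : T <= 0 by rewrite ge_min lexx.
have T1 : T <= s0 - t by rewrite !ge_min lexx !orbT.
have T2 : expR T <= e / D.
  rewrite -[leRHS]lnK ?posrE ?divr_gt0// ler_expR /T.
  by rewrite !ge_min lexx !orbT.
clearbody T.
have E2 : circ K T = circ K (s0 - t).
  apply: circ_const => // z /andP[z1 z2]; apply: dK.
    by rewrite -modulus_gt0; apply: lt_le_trans z1; exact: expR_gt0.
  by rewrite lt_eqF//; apply: le_lt_trans z2 _; rewrite ltr_expR; lra.
have E3 : modulus (circ K T) <= e / 3.
  apply: le_trans (BP K T (`|M| * expR T) cK _) _.
    move=> z zT; apply: le_trans (KM z _) _.
      by rewrite zT -expR0 ler_expR.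
    by rewrite zT; apply: ler_wpM2r; [exact: expR_ge0|exact: ler_norm].
  have -> : e / 3 = B * ((`|M| + 1) * (e / D)).
    by rewrite /D; field; rewrite gt_eqF ?gt_eqF// ltr_wpDl.
  apply: ler_wpM2l; first exact: ltW.
  apply: ler_pM; [exact: normr_ge0|exact: expR_ge0| |exact: T2].
  by rewrite lerDl ler01.
have E4 := dP t; have E5 := dP (- t).
rewrite E1.
have X (a b c : R[i]) : a = (a - b) - (c - b) + c by ring.
rewrite (X (circ K (s0 + t)) (circ K s0) (circ K T)) {1}E2.
apply: le_trans (ler_modulusD _ _) _.
apply: le_trans (lerD (ler_modulusB _ _) E3) _.
have {2}-> : e = e / 3 + e / 3 + e / 3 by field.
rewrite lerD2r; apply: lerD; first by apply: E4; rewrite gtr0_norm.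
by apply: E5; rewrite normrN gtr0_norm.
Qed.

(** Cauchy's formula on the unit circle, which is [s = 0]. In this parametrization [dz / (i z)] is
    [dx], hence [n] inverse powers and not [n + 1]. *)
Definition tcoef f n : R[i] := circ (fun z => f z * z^-1 ^+ n) 0 / (2 * pi)%:C.

Lemma cdiffable_Vn n z : z != 0 -> cdiffable (fun z => z^-1 ^+ n) z.
Proof. by move=> z0; apply: cdiffableX; exact: cdiffable_inv. Qed.

Lemma ccont_mulVn f n z : ccont f z -> z != 0 -> ccont (fun z => f z * z^-1 ^+ n) z.
Proof.
by move=> cf z0; apply: ccontM => //; exact: cdiffable_cont (cdiffable_Vn n z0).
Qed.

Let pi2C0 : (2 * pi)%:C != 0 :> R[i].
Proof. by rewrite eq_complex /= eqxx andbT mulf_neq0// gt_eqF// pi_gt0. Qed.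

Lemma tcoefE f n s : (forall z, cdiffable f z) ->
  circ (fun z => f z * z^-1 ^+ n) s = tcoef f n * (2 * pi)%:C.
Proof.
move=> df; rewrite /tcoef (divfK pi2C0).
by apply: circ_constT => z z0; apply: cdiffableM => //; exact: cdiffable_Vn.
Qed.

Lemma tcoefD f g (c : R[i]) n : (forall z, ccont f z) -> (forall z, ccont g z) ->
  tcoef (fun z => c * f z + g z) n = c * tcoef f n + tcoef g n.
Proof.
move=> cf cg; rewrite /tcoef mulrA -mulrDl; congr (_ / _).
rewrite /circ.
have pf := circ_path 0 (fun z => ccont_mulVn n (cf z)).
have pg := circ_path 0 (fun z => ccont_mulVn n (cg z)).
rewrite -cintZ// -cintD//.
  by congr cint; apply/funext => x; ring.
move=> x e e0; have c0 : 0 < e / (modulus c + 1) by rewrite divr_gt0// ltr_wpDl.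
have [d d0 dP] := pf x _ c0; exists d => // h /dP H.
rewrite -mulrBr modulusM.
apply: le_trans (ler_wpM2l _ H) _ => //.
have k0 : 0 < modulus c + 1 by rewrite ltr_wpDl.
rewrite mulrCA ler_piMr ?(ltW e0)// ler_pdivrMr//; lra.
Qed.

(** Cauchy's estimate; the factor [2] is the price of bounding real and imaginary parts separately
    in [cint_le]. *)
Lemma tcoef_le f n r (M : R) : (forall z, cdiffable f z) -> 0 < r ->
  (forall z, modulus z = r -> modulus (f z) <= M) ->
  modulus (tcoef f n) * r ^+ n <= 2 * M.
Proof.
move=> df r0 fM.
have cf z : ccont f z := cdiffable_cont (df z).
have := @circ_le (fun z => f z * z^-1 ^+ n) (ln r) (M * r ^- n)
  (fun z => ccont_mulVn n (cf z)).
rewrite tcoefE// modulusM modulus_real (ger0_norm (mulr_ge0 _ (pi_ge0 R)))// => H.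
have pi0 := @pi_gt0 R.
rewrite -ler_pdivlMr ?exprn_gt0//.
rewrite -(@ler_pM2r _ (2 * pi)) ?mulr_gt0//; apply: le_trans (H _) _.
  move=> z; rewrite lnK ?posrE// => zr.
  rewrite modulusM modulusX modulusV zr exprVn ler_wpM2r ?invr_ge0 ?exprn_ge0 ?(ltW r0)//.
  exact: fM.
by apply: eq_ler; ring.
Qed.

(** Passing from [s] to [s + 1] multiplies the integral by [e^(-n)], yet leaves it unchanged. *)
Lemma circ_Vn n s : (0 < n)%N -> circ (fun z => z^-1 ^+ n) s = 0.
Proof.
move=> n0; pose K := fun z : R[i] => z^-1 ^+ n.
have dK z : z != 0 -> cdiffable K z by exact: cdiffable_Vn.
have cK z : z != 0 -> ccont K z by move=> z0; exact: cdiffable_cont (dK z z0).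
have E : circ K (s + 1) = (expR 1)%:C^-1 ^+ n * circ K s.
  rewrite /circ -cintZ; last exact: circ_path.
  congr cint; apply/funext => x; rewrite /K -exprMn; congr (_ ^+ _).
  rewrite -invfM -cexp_real -cexpD; congr ((cexp _)^-1).
  by apply/eqP; rewrite eq_complex /= add0r addrC !eqxx.
have := circ_constT (s + 1) s dK; rewrite E => /eqP.
rewrite -subr_eq0 -{2}[circ K s]mul1r -mulrBl mulf_eq0 => /orP[|/eqP//].
rewrite subr_eq0 => /eqP H; exfalso.
have : modulus ((expR 1)%:C^-1 ^+ n) < 1 :> R.
  rewrite modulusX modulusV modulus_real gtr0_norm ?expR_gt0//.
  by rewrite exprn_ilt1 ?invr_ge0 ?expR_ge0 -?lt0n// invf_lt1 ?expR_gt0// -expR0 ltr_expR.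
by rewrite H modulus1 ltxx.
Qed.

(** Let [F] be the difference quotient of [f] at [z], [K w = w * F w] and [T n] the circle integral
    of [K w / w^n]. Then [f w - f z = (w - z) * F w] becomes the recursion [TS], and [T 0 = 0] is
    Cauchy's theorem for [F]. Unrolling leaves the remainder [z^n * T n], which is geometric on a
    circle of radius at least [2 |z|]. *)
Lemma taylor f z : (forall w, cdiffable f w) -> exists M : R, forall n, (0 < n)%N ->
  modulus (f z - \sum_(k < n) tcoef f k * z ^+ k) <= M / 2 ^+ n.
Proof.
move=> df; have cf w : ccont f w := cdiffable_cont (df w).
have [l fl] := df z.
pose F w := if w == z then l else (f w - f z) / (w - z).
have dF w : w != z -> cdiffable F w.
  move=> wz; have wz0 : 0 < modulus (w - z) / 2 by rewrite divr_gt0// modulus_gt0 subr_eq0.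
  apply: (@cdiffable_near _ (fun w => (f w + - f z) * (w + - z)^-1) F w _ wz0).
    move=> h hw; rewrite /F; case: eqP => // E; exfalso.
    have : modulus (w - z) <= modulus h.
      by apply: eq_ler; rewrite -modulusN; congr modulus; rewrite -E; ring.
    by lra.
  apply: cdiffableM; first by apply: cdiffableD => //; exact: cdiffable_cst.
  apply: (@cdiffable_comp _ (fun w => w^-1)).
    by apply: cdiffable_inv; rewrite subr_eq0.
  by apply: cdiffableD; [exact: cdiffable_id|exact: cdiffable_cst].
have cF w : ccont F w.
  have [->|wz] := eqVneq w z; last exact: cdiffable_cont (dF w wz).
  move=> e e0; have [d d0 dP] := fl e e0; exists d => // h /dP H.
  rewrite /F eqxx; case: eqP => [_|/eqP hz]; first by rewrite subrr modulus0 ltW.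
  have h0 : h != 0 by apply: contra hz => /eqP->; rewrite addr0.
  have -> : (f (z + h) - f z) / (z + h - z) - l = (f (z + h) - f z - l * h) / h.
    by rewrite (addrC z h) addrK; field.
  by rewrite modulusM modulusV ler_pdivrMr ?modulus_gt0.
have FE w : F w * (w - z) = f w - f z.
  rewrite /F; case: eqP => [->|/eqP wz]; first by rewrite !subrr mulr0.
  by rewrite divfK// subr_eq0.
pose K w := w * F w.
have cK w : ccont K w by apply: ccontM => //; exact: cdiffable_cont (cdiffable_id w).
(* The circle through [z], where [F] is only known to be continuous, is the one on which [circ_eq0]
   does not ask for differentiability. If [z = 0], its radius is arbitrary. *)
pose s0 := if z == 0 then 0 else ln (modulus z).
pose r := 2 * expR s0; pose s := ln r.
have r0 : 0 < r by rewrite mulr_gt0// expR_gt0.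
have rE : expR s = r by rewrite lnK.
have s0s : s0 < s by rewrite -ltr_expR rE /r ltr_pMl ?expR_gt0// ltr1n.
have zr : 2 * modulus z <= r.
  rewrite /r ler_pM2l// /s0; case: eqP => [->|/eqP z0].
    by rewrite modulus0 expR_ge0.
  by rewrite lnK// posrE modulus_gt0.
have K0 : circ K s = 0.
  have [MF MFP] := ccont_bounded_disc 1 cF.
  apply: (@circ_eq0 K s0 s MF) => //.
    move=> w _ ws0; have [wz|wz] := eqVneq w z.
      have z0 : z = 0.
        apply/eqP; apply: contraTT isT => z0; rewrite wz /s0 (negPf z0) in ws0.
        by rewrite lnK ?eqxx ?posrE ?modulus_gt0 in ws0.
      apply: (@cdiffable_near _ (fun w => f w + - f z) K w 1) => //; last first.
        by apply: cdiffableD => //; exact: cdiffable_cst.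
      by move=> h _; rewrite -FE z0 subr0 mulrC.
    by apply: cdiffableM; [exact: cdiffable_id|exact: dF].
  by move=> w w1; rewrite modulusM mulrC ler_wpM2r// MFP.
pose T n := circ (fun w => K w * w^-1 ^+ n) s.
have TS n : tcoef f n * (2 * pi)%:C - f z * circ (fun w => w^-1 ^+ n) s =
    T n - z * T n.+1.
  have p1 := circ_path s (fun w => ccont_mulVn n (cf w)).
  have p2 m := circ_path s (fun w => ccont_mulVn m (cK w)).
  have p3 := circ_path s (fun w w0 => cdiffable_cont (cdiffable_Vn n w0)).
  have pZ (c : R[i]) (g : R -> R[i]) : cpath g -> cpath (fun x => c * g x).
    move=> pg x e e0; have c0 : 0 < e / (modulus c + 1) by rewrite divr_gt0// ltr_wpDl.
    have [d d0 dP] := pg x _ c0; exists d => // h /dP H.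
    rewrite -mulrBr modulusM; apply: le_trans (ler_wpM2l _ H) _ => //.
    have k0 : 0 < modulus c + 1 by rewrite ltr_wpDl.
    by rewrite mulrCA ler_piMr ?(ltW e0)// ler_pdivrMr//; lra.
  rewrite -(tcoefE n s df) /T /circ -!mulNr -(cintZ (- f z) p3).
  rewrite -(cintZ (- z) (p2 n.+1)) -(cintD p1 (pZ _ _ p3)).
  rewrite -(cintD (p2 n) (pZ _ _ (p2 n.+1))).
  congr cint; apply/funext => x; set w := cexp _.
  have w0 : w != 0 by exact: cexp_neq0.
  rewrite exprS /K; have := FE w.
  move=> /(congr1 (fun u => u * w^-1 ^+ n)) => H.
  rewrite mulNr -mulrBl -H.
  have -> : - z * (w * F w * (w^-1 * w^-1 ^+ n)) = - z * F w * (w * w^-1) * w^-1 ^+ n by ring.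
  by rewrite divff//; ring.
have S n : (0 < n)%N -> f z * (2 * pi)%:C =
    (\sum_(k < n) tcoef f k * z ^+ k) * (2 * pi)%:C + z ^+ n * T n.
  elim: n => // n ih _.
  have T0 : T 0%N = 0.
    by rewrite /T -K0; congr (circ _ s); apply/funext => w; rewrite expr0 mulr1.
  have [->|n0] := posnP n.
    have := TS 0%N; rewrite T0 big_ord1 expr0 mulr1 expr1 /circ.
    under eq_fun do rewrite expr0.
    rewrite cint_cst mul1r sub0r => /eqP; rewrite subr_eq => /eqP ->.
    by rewrite addrAC addNr add0r.
  rewrite big_ord_recr /= [in RHS]mulrDl ih//.
  have := TS n; rewrite circ_Vn// mulr0 subr0 => H.
  rewrite -addrA mulrAC H exprS; congr (_ + _).
  by move: (T n) (T n.+1) => a b; ring.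
have [MK MKP] := ccont_bounded_disc r cK.
exists (2 * MK) => n n0.
have pi0 := @pi_gt0 R.
have Tn : modulus (T n) <= 4 * pi * (MK / r ^+ n).
  apply: circ_le => w; first exact: ccont_mulVn.
  rewrite rE => wr; rewrite modulusM modulusX modulusV wr exprVn.
  by rewrite ler_wpM2r ?invr_ge0 ?exprn_ge0 ?(ltW r0)// MKP// wr.
rewrite -(@ler_pM2r _ (modulus (2 * pi)%:C)); last by rewrite modulus_gt0.
rewrite -modulusM mulrBl (S n n0) addrC addKr modulusM modulusX.
rewrite modulus_real ger0_norm; last by apply: mulr_ge0; [exact: ler0n|exact: ltW].
have MK0 : 0 <= MK.
  by apply: le_trans (modulus_ge0 _) (MKP 0 _); rewrite modulus0; exact: ltW.
have zn : modulus z ^+ n <= (r / 2) ^+ n.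
  by rewrite lerXn2r ?nnegrE ?divr_ge0 ?(ltW r0)//; lra.
apply: le_trans (ler_pM _ _ zn Tn) _; rewrite ?exprn_ge0//.
have X (u v w : R) : u != 0 -> w != 0 ->
  u / w * (4 * v * (MK / u)) = 2 * MK / w * (2 * v) by move=> u0 w0; field; rewrite w0 u0.
by rewrite expr_div_n X ?expf_neq0 ?gt_eqF.
Qed.

End Taylor.

(** * Integration over the plane *)

Section ComplexLimits.
Context {R : realType}.
Implicit Types (u v : nat -> R[i]) (l m : R[i]).

Definition ccvg u l := forall e : R, 0 < e ->
  exists N0, forall N, (N0 <= N)%N -> modulus (u N - l) <= e.

Lemma ccvg_Re u l : ccvg u l -> (fun n => complex.Re (u n)) @ \oo --> complex.Re l.
Proof.
move=> ul; apply/cvgrPdist_le => e e0; have [N NP] := ul e e0; exists N => // n /NP.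
by rewrite distrC -cReN -cReD; apply: le_trans; exact: Re_le_modulus.
Qed.

Lemma ccvg_Im u l : ccvg u l -> (fun n => complex.Im (u n)) @ \oo --> complex.Im l.
Proof.
move=> ul; apply/cvgrPdist_le => e e0; have [N NP] := ul e e0; exists N => // n /NP.
by rewrite distrC -cImN -cImD; apply: le_trans; exact: Im_le_modulus.
Qed.

Lemma ccvgP u l :
  (fun n => complex.Re (u n)) @ \oo --> complex.Re l ->
  (fun n => complex.Im (u n)) @ \oo --> complex.Im l -> ccvg u l.
Proof.
move=> /cvgrPdist_le re /cvgrPdist_le im e e0.
have e2 : 0 < e / 2 by rewrite divr_gt0.
have [N1 _ N1P] := re _ e2; have [N2 _ N2P] := im _ e2.
exists (maxn N1 N2) => N; rewrite geq_max => /andP[/N1P /= n1 /N2P /= n2].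
apply: le_trans (modulus_le_ReIm _) _; rewrite cReD cReN cImD cImN [leRHS]splitr.
by rewrite lerD// distrC.
Qed.

Lemma ccvg_unique u l m : ccvg u l -> ccvg u m -> l = m.
Proof.
move=> ul um; have r1 := ccvg_Re ul; have r2 := ccvg_Re um.
have i1 := ccvg_Im ul; have i2 := ccvg_Im um.
apply/eqP; rewrite eq_complex; apply/andP; split; apply/eqP.
- by rewrite -(cvg_lim _ r1) -?(cvg_lim _ r2).
- by rewrite -(cvg_lim _ i1) -?(cvg_lim _ i2).
Qed.

Lemma eq_ccvg u v l : u =1 v -> ccvg u l -> ccvg v l.
Proof. by move=> /funext ->. Qed.

Lemma ccvgD u v l m : ccvg u l -> ccvg v m -> ccvg (fun n => u n + v n) (l + m).
Proof.
move=> ul vm e e0; have e2 : 0 < e / 2 by rewrite divr_gt0.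
have [N1 N1P] := ul _ e2; have [N2 N2P] := vm _ e2.
exists (maxn N1 N2) => N; rewrite geq_max => /andP[/N1P n1 /N2P n2].
have -> : u N + v N - (l + m) = (u N - l) + (v N - m) by ring.
by apply: le_trans (ler_modulusD _ _) _; rewrite [leRHS]splitr lerD.
Qed.

Lemma ccvgZ (c : R[i]) u l : ccvg u l -> ccvg (fun n => c * u n) (c * l).
Proof.
move=> ul e e0; have k0 : 0 < modulus c + 1 by rewrite ltr_wpDl.
have [N NP] := ul _ (divr_gt0 e0 k0); exists N => n /NP H.
rewrite -mulrBr modulusM; apply: le_trans (ler_wpM2l _ H) _ => //.
by rewrite mulrCA ler_piMr ?(ltW e0)// ler_pdivrMr// mul1r lerDl.
Qed.

Lemma ccvg_modulus_le u l (M : R) : ccvg u l -> (forall n, modulus (u n) <= M) ->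
  modulus l <= M.
Proof.
move=> ul uM; apply/ler_addgt0Pr => e e0; have [N NP] := ul e e0.
have -> : l = u N - (u N - l) by ring.
apply: le_trans (ler_modulusB _ _) _; apply: lerD => //; exact: NP.
Qed.

End ComplexLimits.

Section ComplexMeasurable.
Context {R : realType} {d} {T : measurableType d}.
Implicit Types (f g : T -> R[i]) (D : set T).

Definition cmeas D f := measurable_fun D (fun x => complex.Re (f x)) /\
  measurable_fun D (fun x => complex.Im (f x)).

Lemma cmeasD D f g : cmeas D f -> cmeas D g -> cmeas D (fun x => f x + g x).
Proof.
move=> [fr fi] [gr gi]; split.
- by under eq_fun do rewrite cReD; exact: measurable_funD.
- by under eq_fun do rewrite cImD; exact: measurable_funD.
Qed.

Lemma cmeasM D f g : cmeas D f -> cmeas D g -> cmeas D (fun x => f x * g x).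
Proof.
move=> [fr fi] [gr gi]; split.
- by under eq_fun do rewrite cReM; apply: measurable_funB; exact: measurable_funM.
- by under eq_fun do rewrite cImM; apply: measurable_funD; exact: measurable_funM.
Qed.

Lemma cmeas_cst D c : cmeas D (fun=> c).
Proof. by split; exact: measurable_cst. Qed.

Lemma cmeasX D f n : cmeas D f -> cmeas D (fun x => f x ^+ n).
Proof.
move=> mf; elim: n => [|n ih]; first exact: (cmeas_cst _ 1).
by have := cmeasM mf ih; congr cmeas; apply/funext => x; rewrite exprS.
Qed.

Lemma cmeas_sum D n (F : nat -> T -> R[i]) : (forall k, cmeas D (F k)) ->
  cmeas D (fun x => \sum_(k < n) F k x).
Proof.
move=> mF; elim: n => [|n ih].
  have := cmeas_cst D 0; congr cmeas; apply/funext => x; by rewrite big_ord0.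
have := cmeasD ih (mF n); congr cmeas; apply/funext => x.
by rewrite big_ord_recr.
Qed.

Lemma cmeas_real D (h : T -> R) : measurable_fun D h -> cmeas D (fun x => (h x)%:C).
Proof. by move=> mh; split => //=; exact: measurable_cst. Qed.

Lemma cmeas_conj D f : cmeas D f -> cmeas D (fun x => (f x)^*).
Proof.
move=> [fr fi]; split.
- by rewrite (_ : (fun _ => _) = (fun x => complex.Re (f x)))//; apply/funext => x; case: (f x).
- rewrite (_ : (fun _ => _) = (fun x => - complex.Im (f x))).
    exact: measurable_funN.
  by apply/funext => x; case: (f x).
Qed.

Lemma cmeas_ccvg D (F : nat -> T -> R[i]) f : measurable D ->
  (forall n, cmeas D (F n)) -> (forall x, D x -> ccvg (F^~ x) (f x)) -> cmeas D f.
Proof.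
move=> mD mF Ff; split; apply/measurable_EFinP.
- apply: (emeasurable_fun_cvg (fun n x => (complex.Re (F n x))%:E)).
    by move=> n; apply/measurable_EFinP; have [] := mF n.
  by move=> x Dx; apply: cvg_EFin; [exact: nearW|exact: ccvg_Re (Ff x Dx)].
- apply: (emeasurable_fun_cvg (fun n x => (complex.Im (F n x))%:E)).
    by move=> n; apply/measurable_EFinP; have [] := mF n.
  by move=> x Dx; apply: cvg_EFin; [exact: nearW|exact: ccvg_Im (Ff x Dx)].
Qed.

Lemma modulus_powR z : modulus z = (complex.Re z ^+ 2 + complex.Im z ^+ 2) `^ 2^-1 :> R.
Proof.
by case: z => x y; rewrite powR12_sqrt// addr_ge0// sqr_ge0.
Qed.

Lemma cmeas_modulus D f : measurable D -> cmeas D f ->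
  measurable_fun D (fun x => modulus (f x)).
Proof.
move=> mD [fr fi]; under eq_fun do rewrite modulus_powR.
exact: measurableT_comp (measurable_powR _)
  (measurable_funD (measurable_funX _ fr) (measurable_funX _ fi)).
Qed.

Context (mu : {measure set T -> \bar R}).

Lemma integrable_realZl D (k : R) (h : T -> R) : measurable D ->
  mu.-integrable D (EFin \o h) -> mu.-integrable D (EFin \o (fun x => k * h x)).
Proof. by move=> mD ih; have := integrableZl mD k ih; apply: eq_integrable. Qed.

Lemma integrable_realD D (h h' : T -> R) : measurable D -> mu.-integrable D (EFin \o h) ->
  mu.-integrable D (EFin \o h') -> mu.-integrable D (EFin \o (fun x => h x + h' x)).
Proof. by move=> mD ih ih'; have := integrableD mD ih ih'; apply: eq_integrable. Qed.

Lemma integrableC_le D f (h : T -> R) : measurable D -> cmeas D f ->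
  mu.-integrable D (EFin \o h) -> (forall x, D x -> modulus (f x) <= h x) ->
  integrableC mu D f.
Proof.
move=> mD [fr fi] ih fh; split.
- apply: le_integrable ih => //; first exact/measurable_EFinP.
  move=> x Dx /=; rewrite lee_fin; apply: le_trans (Re_le_modulus _) _.
  by apply: le_trans (fh x Dx) _; exact: ler_norm.
- apply: le_integrable ih => //; first exact/measurable_EFinP.
  move=> x Dx /=; rewrite lee_fin; apply: le_trans (Im_le_modulus _) _.
  by apply: le_trans (fh x Dx) _; exact: ler_norm.
Qed.

Lemma integralCZ D f (c : R[i]) : measurable D -> integrableC mu D f ->
  integralC mu D (fun x => c * f x) = c * integralC mu D f.
Proof.
move=> mD [ir ii]; rewrite /integralC; case: c => a b.
have iZ k h := @integrable_realZl D k h mD.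
apply/eqP; rewrite eq_complex /=; apply/andP; split; apply/eqP.
- under eq_Rintegral do rewrite cReM.
  by rewrite RintegralB ?RintegralZl//; exact: iZ.
- under eq_Rintegral do rewrite cImM.
  by rewrite RintegralD ?RintegralZl//; exact: iZ.
Qed.

Lemma integralCD D f g : measurable D -> integrableC mu D f -> integrableC mu D g ->
  integralC mu D (fun x => f x + g x) = integralC mu D f + integralC mu D g.
Proof.
move=> mD [fr fi] [gr gi]; apply/eqP; rewrite eq_complex /=; apply/andP; split; apply/eqP.
- by under eq_Rintegral do rewrite cReD; rewrite RintegralD.
- by under eq_Rintegral do rewrite cImD; rewrite RintegralD.
Qed.

Lemma integralC_ccvg D (F : nat -> T -> R[i]) f (h : T -> R) : measurable D ->
  (forall n, cmeas D (F n)) -> mu.-integrable D (EFin \o h) ->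
  (forall n x, D x -> modulus (F n x) <= h x) ->
  (forall x, D x -> ccvg (F^~ x) (f x)) ->
  integrableC mu D f /\
  ccvg (fun n => integralC mu D (F n)) (integralC mu D f).
Proof.
move=> mD mF ih Fh Ff; have mf := cmeas_ccvg mD mF Ff.
have fh x : D x -> modulus (f x) <= h x.
  by move=> Dx; apply: ccvg_modulus_le (Ff x Dx) _ => n; exact: Fh.
have iF n := integrableC_le mD (mF n) ih (Fh n).
have if_ := integrableC_le mD mf ih fh; split => //.
have [mfr mfi] := mf; have [ifr ifi] := if_.
apply: ccvgP => /=.
- have [|||||_ _ H] := @dominated_convergence _ T R mu D mD
    (fun n x => (complex.Re (F n x))%:E) (fun x => (complex.Re (f x))%:E) (EFin \o h) => //.
  + by move=> n; apply/measurable_EFinP; have [] := mF n.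
  + exact/measurable_EFinP.
  + apply: aeW => x Dx; apply: cvg_EFin; [exact: nearW|exact: ccvg_Re (Ff x Dx)].
  + apply: aeW => x n Dx; rewrite lee_fin; apply: le_trans (Re_le_modulus _) _.
    exact: Fh.
  + apply: fine_cvg; rewrite fineK//.
    exact: integrable_fin_num.
- have [|||||_ _ H] := @dominated_convergence _ T R mu D mD
    (fun n x => (complex.Im (F n x))%:E) (fun x => (complex.Im (f x))%:E) (EFin \o h) => //.
  + by move=> n; apply/measurable_EFinP; have [] := mF n.
  + exact/measurable_EFinP.
  + apply: aeW => x Dx; apply: cvg_EFin; [exact: nearW|exact: ccvg_Im (Ff x Dx)].
  + apply: aeW => x n Dx; rewrite lee_fin; apply: le_trans (Im_le_modulus _) _.
    exact: Fh.
  + apply: fine_cvg; rewrite fineK//.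
    exact: integrable_fin_num.
Qed.

Lemma modulus_integralC_le D f (h : T -> R) : measurable D -> cmeas D f ->
  mu.-integrable D (EFin \o h) -> (forall x, D x -> modulus (f x) <= h x) ->
  modulus (integralC mu D f) <= 2 * \int[mu]_(x in D) h x.
Proof.
move=> mD mf ih fh; have [ir ii] := integrableC_le mD mf ih fh.
apply: le_trans (modulus_le_ReIm _) _ => /=; rewrite mulr_natl mulr2n.
apply: lerD.
- apply: le_trans (le_normr_Rintegral _ _) _ => //.
  apply: le_Rintegral => //; first exact: integrable_norm.
  by move=> x Dx; apply: le_trans (Re_le_modulus _) _; exact: fh.
- apply: le_trans (le_normr_Rintegral _ _) _ => //.
  apply: le_Rintegral => //; first exact: integrable_norm.
  by move=> x Dx; apply: le_trans (Im_le_modulus _) _; exact: fh.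
Qed.

End ComplexMeasurable.

Notation leb2 := (@lebesgue_measure _ \x @lebesgue_measure _)%E.

(** * Translations, shears and rotations of the plane *)

Section PlaneMeasure.
Context {R : realType}.
Notation leb := (@lebesgue_measure R).
Notation plane := (measurableTypeR R * measurableTypeR R)%type.
Local Open Scope ereal_scope.

Lemma lebesgue_measure_translation (a : R) (A : set R) : measurable A ->
  pushforward leb ((fun x => x + a)%R : _ -> measurableTypeR R) A = leb A.
Proof.
have mt : measurable_fun setT ((fun x => x + a)%R : measurableTypeR R -> measurableTypeR R).
  by apply: measurable_funD => //; exact: measurable_cst.
move=> mA; apply/esym.
pose f : {mfun measurableTypeR R >-> measurableTypeR R} := HB.pack
  ((fun x => x + a)%R : measurableTypeR R -> measurableTypeR R)
  (isMeasurableFun.Build _ _ _ _ _ mt).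
apply: (@lebesgue_measure_unique R (pushforward leb f)) => //= _ [[u v]] _ <-.
rewrite /pushforward.
have -> : (fun x => x + a)%R @^-1` `]u, v] = `](u - a)%R, (v - a)%R]%classic.
  by apply/seteqP; split => x /=; rewrite !in_itv/= ltrBlDr lerBrDr.
rewrite !lebesgue_measure_itv/= !lte_fin ltrD2r; case: ifP => // _.
by rewrite -!EFinB; congr EFin; ring.
Qed.

Lemma ge0_integral_translation (a : R) (f : R -> \bar R) :
  measurable_fun setT f -> (forall x, 0 <= f x) ->
  \int[leb]_x f (x + a)%R = \int[leb]_x f x.
Proof.
move=> mf f0.
have mt : measurable_fun setT ((fun x => x + a)%R : measurableTypeR R -> measurableTypeR R).
  by apply: measurable_funD => //; exact: measurable_cst.
have := @ge0_integral_pushforward _ _ _ _ R _ mt leb setT f measurableT mf (fun x _ => f0 x).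
rewrite preimage_setT => <-.
by apply: eq_measure_integral => A mA _; exact: lebesgue_measure_translation.
Qed.

Lemma measurable_shear1 (h : R -> R) : measurable_fun setT h ->
  measurable_fun setT ((fun w => (w.1 + h w.2, w.2))%R : plane -> plane).
Proof.
move=> mh; apply: measurable_fun_pair => //.
by apply: measurable_funD => //; apply: measurableT_comp mh _.
Qed.

Lemma measurable_shear2 (h : R -> R) : measurable_fun setT h ->
  measurable_fun setT ((fun w => (w.1, w.2 + h w.1))%R : plane -> plane).
Proof.
move=> mh; apply: measurable_fun_pair => //.
by apply: measurable_funD => //; apply: measurableT_comp mh _.
Qed.

(** On each horizontal line a shear is a translation, so Tonelli's theorem reduces it to the
    invariance of Lebesgue measure on the line. *)
Lemma ge0_integral_shear1 (h : R -> R) (F : plane -> \bar R) :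
  measurable_fun setT h -> measurable_fun setT F -> (forall w, 0 <= F w) ->
  \int[leb2]_w F (w.1 + h w.2, w.2)%R = \int[leb2]_w F w.
Proof.
move=> mh mF F0.
rewrite (fubini_tonelli2 F mF F0) (fubini_tonelli2 (fun w : plane => F (w.1 + h w.2, w.2)%R)
  (measurableT_comp mF (measurable_shear1 mh)) (fun w => F0 _)).
apply: eq_integral => y _; rewrite /fubini_G /=.
apply: (@ge0_integral_translation (h y) (fun x => F (x, y))) => //.
exact: measurable_fun_pair1.
Qed.

Lemma ge0_integral_shear2 (h : R -> R) (F : plane -> \bar R) :
  measurable_fun setT h -> measurable_fun setT F -> (forall w, 0 <= F w) ->
  \int[leb2]_w F (w.1, w.2 + h w.1)%R = \int[leb2]_w F w.
Proof.
move=> mh mF F0.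
rewrite (fubini_tonelli1 F mF F0) (fubini_tonelli1 (fun w : plane => F (w.1, w.2 + h w.1)%R)
  (measurableT_comp mF (measurable_shear2 mh)) (fun w => F0 _)).
apply: eq_integral => x _; rewrite /fubini_F /=.
apply: (@ge0_integral_translation (h x) (fun y => F (x, y))) => //.
exact: measurable_fun_pair2.
Qed.

Lemma ge0_integral_plane_translation (a b : R) (F : plane -> \bar R) :
  measurable_fun setT F -> (forall w, 0 <= F w) ->
  \int[leb2]_w F (w.1 + a, w.2 + b)%R = \int[leb2]_w F w.
Proof.
move=> mF F0; rewrite -(@ge0_integral_shear1 (fun=> a) F)//.
rewrite -(@ge0_integral_shear2 (fun=> b) (fun w => F (w.1 + a, w.2)%R))//.
exact: (measurableT_comp mF (measurable_shear1 _)).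
Qed.

(* A rotation is a product of three shears. *)
Lemma ge0_integral_rotation (c s : R) (F : plane -> \bar R) :
  (c ^+ 2 + s ^+ 2 = 1 -> s != 0)%R -> (c ^+ 2 + s ^+ 2 = 1)%R ->
  measurable_fun setT F -> (forall w, 0 <= F w) ->
  \int[leb2]_w F (c * w.1 - s * w.2, s * w.1 + c * w.2)%R = \int[leb2]_w F w.
Proof.
move=> s0 cs mF F0; have {}s0 := s0 cs.
(* The tangent of half the rotation angle; it is finite because [s != 0]. *)
pose t := ((1 - c) / s)%R.
have ml (k : R) : measurable_fun setT (fun x : R => k * x)%R by exact: mulrl_measurable.
pose F1 := fun w : plane => F (w.1 + (- t) * w.2, w.2)%R.
have mF1 : measurable_fun setT F1 := measurableT_comp mF (measurable_shear1 (ml (- t)%R)).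
pose F2 := fun w : plane => F1 (w.1, w.2 + s * w.1)%R.
have mF2 : measurable_fun setT F2 := measurableT_comp mF1 (measurable_shear2 (ml s)).
rewrite -(ge0_integral_shear1 (ml (- t)%R) mF)// -/F1.
rewrite -(ge0_integral_shear2 (ml s) mF1) => [|w]; last exact: F0.
rewrite -(ge0_integral_shear1 (ml (- t)%R) mF2) => [|w]; last exact: F0.
apply: eq_integral => -[x y] _; rewrite /F2 /F1 /=; congr (F (_, _)).
- have H : ((1 - c) * (1 + c) = s ^+ 2)%R.
    have -> : ((1 - c) * (1 + c) = 1 - c ^+ 2)%R by ring.
    by rewrite -cs addrAC subrr add0r.
  rewrite /t.
  have -> : (c * x - s * y = c * x - s ^+ 2 / s * y)%R by field.
  by rewrite -H; field.
- by rewrite /t; field.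
Qed.

End PlaneMeasure.

Notation plane R := (measurableTypeR R * measurableTypeR R)%type.

Section PlaneIntegral.
Context {R : realType}.
Implicit Types (g : R[i] -> R[i]) (F : plane R -> R) (W : R[i] -> R) (u z : R[i]).

Definition cplx (w : plane R) : R[i] := Complex (w.1 : R) (w.2 : R).

Lemma cmeas_cplx : cmeas setT cplx.
Proof. by split; [exact: measurable_fst|exact: measurable_snd]. Qed.

Definition plane_int g : R[i] := integralC leb2 setT (fun w => g (cplx w)).

Lemma Rintegral_rotation (c s : R) F : s != 0 -> c ^+ 2 + s ^+ 2 = 1 ->
  measurable_fun setT F ->
  \int[leb2]_w F (c * w.1 - s * w.2, s * w.1 + c * w.2) = \int[leb2]_w F w.
Proof.
move=> s0 cs mF; congr fine; rewrite integralE [RHS]integralE.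
have mFE : measurable_fun setT (EFin \o F) by exact/measurable_EFinP.
congr (_ - _)%E.
- rewrite -[RHS](@ge0_integral_rotation _ c s)//; last first.
    exact: measurable_funepos.
  by apply: eq_integral => w _; rewrite !funeposE.
- rewrite -[RHS](@ge0_integral_rotation _ c s)//; last first.
    exact: measurable_funeneg.
  by apply: eq_integral => w _; rewrite !funenegE.
Qed.

Lemma plane_int_rotation u g : modulus u = 1 -> complex.Im u != 0 ->
  cmeas setT (fun w => g (cplx w)) ->
  plane_int (fun z => g (u * z)) = plane_int g.
Proof.
move=> u1 u0 [gr gi].
have cs : complex.Re u ^+ 2 + complex.Im u ^+ 2 = 1 by rewrite -sqr_modulus u1 expr1n.
apply/eqP; rewrite eq_complex /=; apply/andP; split; apply/eqP.
- rewrite -[RHS](Rintegral_rotation u0 cs gr).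
  apply: eq_Rintegral => w _; congr (complex.Re (g _)).
  by case: (u) => a b; apply/eqP; rewrite eq_complex /= eqxx addrC /=.
- rewrite -[RHS](Rintegral_rotation u0 cs gi).
  apply: eq_Rintegral => w _; congr (complex.Im (g _)).
  by case: (u) => a b; apply/eqP; rewrite eq_complex /= eqxx addrC /=.
Qed.

Lemma cexp_i (x : R) k : cexp (Complex 0 x) ^+ k = cexp (Complex 0 (k%:R * x)).
Proof.
rewrite -cexpMn; congr cexp; rewrite -[k%:R]/(k%:R : R[i]).
have -> : (k%:R : R[i]) = Complex k%:R 0 by rewrite complexr0 rmorph_nat.
by apply/eqP; rewrite eq_complex /=; apply/andP; split; apply/eqP; ring.
Qed.

(* Rotating by the angle [pi / (2 |m - n|)] multiplies the integral by [i] or [-i]. *)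
Lemma plane_int_orthogonal W m n : m != n ->
  (forall u z, modulus u = 1 -> W (u * z) = W z) ->
  measurable_fun setT (fun w => W (cplx w)) ->
  integrable leb2 setT (fun w => (modulus (cplx w) ^+ (m + n) * `|W (cplx w)|)%:E) ->
  plane_int (fun z => z ^+ m * (z^*) ^+ n * (W z)%:C) = 0.
Proof.
move=> mn Wrot mW iW.
pose g z := z ^+ m * (z^*) ^+ n * (W z)%:C.
have mg : cmeas setT (fun w => g (cplx w)).
  apply: cmeasM; last exact: cmeas_real.
  apply: cmeasM; apply: cmeasX; first exact: cmeas_cplx.
  by apply: cmeas_conj; exact: cmeas_cplx.
have ig : integrableC leb2 setT (fun w => g (cplx w)).
  apply: integrableC_le iW _ => // w _.
  have cz (z : R[i]) : modulus (z^*) = modulus z by case: z => x y /=; rewrite sqrrN.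
  by rewrite /g !modulusM !modulusX modulus_real cz exprD.
pose k := (maxn m n - minn m n)%N.
have k0 : (0 < k)%N by rewrite subn_gt0; move: mn; rewrite neq_ltn /minn /maxn; case: ltngtP.
pose x : R := pi / 2 / k%:R.
have kn0 : k%:R != 0 :> R by rewrite pnatr_eq0 -lt0n.
pose u := cexp (Complex 0 x).
have u1 : modulus u = 1 by rewrite modulus_cexp expR0.
have uk : u ^+ k = Complex 0 1.
  rewrite cexp_i /x mulrC divfK// /cexp /= expR0 cos_pihalf sin_pihalf.
  by rewrite mulr0 mulr1.
have u0 : complex.Im u != 0.
  rewrite /u /cexp /= expR0 mul1r gt_eqF// sin_gt0_pi// /x; apply/andP; split.
    by apply: divr_gt0; [apply: divr_gt0; [exact: pi_gt0|by []]|by rewrite ltr0n].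
  rewrite -mulrA gtr_pMr ?pi_gt0// -invfM invf_lt1; last by rewrite mulr_gt0// ltr0n.
  by rewrite -natrM ltr1n; case: (k) k0 => // k' _; rewrite mulnS.
have uuc : u * u^* = 1.
  have [p [q uE]] : exists p q, u = Complex p q by case: (u) => p q; exists p, q.
  move: u1; rewrite uE => u1.
  have := sqr_modulus (Complex p q); rewrite u1 expr1n /= => H.
  by apply/eqP; rewrite eq_complex /=; apply/andP; split; apply/eqP; [rewrite H; ring|ring].
pose K := u ^+ m * (u^*) ^+ n.
have K1 : K != 1.
  have E (v v' : R[i]) a b : v * v' = 1 -> (a <= b)%N -> v ^+ a * v' ^+ b = v' ^+ (b - a).
    by move=> vv ab; rewrite -{1}(subnK ab) exprD mulrCA -exprMn vv expr1n mulr1.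
  move: uk; rewrite /k; case: (leqP m n) => [mn'|/ltnW nm'] uk.
    have -> : K = (u^*) ^+ (n - m) by rewrite /K E.
    rewrite -(rmorphXn (@conjc R)) uk; apply/eqP => -[] /eqP.
    by rewrite eq_sym oner_eq0.
  have -> : K = u ^+ (m - n) by rewrite /K mulrC E// mulrC.
  by rewrite uk; apply/eqP => -[] /eqP; rewrite eq_sym oner_eq0.
have H : plane_int g = K * plane_int g.
  rewrite -{1}(plane_int_rotation u1 u0 mg) -integralCZ//.
  congr integralC; apply/funext => w; rewrite /g Wrot// rmorphM /= !exprMn /K.
  by ring.
have : (1 - K) * plane_int g = 0 by rewrite mulrBl mul1r -H subrr.
by move/eqP; rewrite mulf_eq0 subr_eq0 eq_sym (negPf K1) => /eqP.
Qed.

End PlaneIntegral.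

(** * Gaussian moments *)

Section GaussianIntegrals.
Context {R : realType}.
Implicit Types (b x : R).
Notation leb := (@lebesgue_measure R).

(** The integrand is a normal density of variance [1 / (2 b)] up to normalisation; [c] comes before
    [m] because the integral is the same for all centres. *)
Lemma gauss_line b : 0 < b -> exists2 c : R, 0 < c &
  forall m : R, measurable_fun setT (fun x : R => expR (- (b * (x - m) ^+ 2))) /\
  (\int[leb]_x (expR (- (b * (x - m) ^+ 2)))%:E = c%:E)%E.
Proof.
move=> b0; pose s : R := Num.sqrt (2 * b)^-1.
have b20 : 0 < 2 * b by rewrite mulr_gt0.
have s2 : s ^+ 2 = (2 * b)^-1 by rewrite sqr_sqrtr// invr_ge0 ltW.
have s0 : s != 0 by rewrite gt_eqF// sqrtr_gt0 invr_gt0.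
have E m : (fun x : R => expR (- (b * (x - m) ^+ 2))) = normal_fun m s.
  apply/funext => x; rewrite /normal_fun s2; congr expR; field.
  by rewrite gt_eqF.
have peak0 := normal_peak_gt0 s0.
exists (normal_peak s)^-1; first by rewrite invr_gt0.
move=> m; split; first by rewrite E; exact: measurable_normal_fun.
have P := integral_normal_pdf m s.
have I := integrable_normal_pdf m s.
transitivity (\int[leb]_x ((normal_peak s)^-1%:E * (normal_pdf m s x)%:E))%E.
  apply: eq_integral => x _; rewrite -EFinM normal_pdfE//; congr EFin.
  by rewrite mulKf ?gt_eqF// -E.
by rewrite integralZl// P mule1.
Qed.

Definition gauss2 b (w : plane R) : R := expR (- (b * modulus (cplx w) ^+ 2)).

Lemma measurable_modulus_cplx : measurable_fun setT (fun w : plane R => modulus (cplx w)).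
Proof. by apply: cmeas_modulus => //; exact: cmeas_cplx. Qed.

Lemma measurable_gauss2 b : measurable_fun setT (gauss2 b).
Proof.
apply: measurableT_comp; first exact: measurable_expR.
apply: measurable_funN; apply: measurable_funM; first exact: measurable_cst.
by apply: measurable_funX; exact: measurable_modulus_cplx.
Qed.

Lemma gauss2E b w : gauss2 b w = expR (- (b * w.1 ^+ 2)) * expR (- (b * w.2 ^+ 2)).
Proof. by rewrite /gauss2 sqr_modulus /= mulrDr opprD expRD. Qed.

Lemma integral_gauss2 b : 0 < b ->
  exists2 c : R, 0 < c & (\int[leb2]_w (gauss2 b w)%:E = c%:E)%E.
Proof.
move=> b0; have [c c0 cP] := gauss_line b0.
exists (c * c); first by rewrite mulr_gt0.
have {}cP : (\int[leb]_x (expR (- (b * x ^+ 2)))%:E = c%:E)%E.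
  by have [_ <-] := cP 0; apply: eq_integral => x _; rewrite subr0.
have me : measurable_fun setT (fun x : R => (expR (- (b * x ^+ 2)))%:E).
  apply/measurable_EFinP; apply: measurableT_comp; first exact: measurable_expR.
  apply: measurable_funN; apply: measurable_funM; first exact: measurable_cst.
  exact: exprn_measurable.
have mg : measurable_fun setT (fun w => (gauss2 b w)%:E).
  by apply/measurable_EFinP; exact: measurable_gauss2.
rewrite (fubini_tonelli1 _ mg (fun w => expR_ge0 _)).
transitivity (\int[leb]_x (c%:E * (expR (- (b * x ^+ 2)))%:E))%E; last first.
  by rewrite ge0_integralZl// ?cP// lee_fin; exact: ltW.
apply: eq_integral => x _; rewrite /fubini_F.
under eq_integral do rewrite gauss2E EFinM /=.
by rewrite ge0_integralZl ?lee_fin ?expR_ge0// cP muleC.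
Qed.

Lemma integrable_gauss2 b : 0 < b -> integrable leb2 setT (EFin \o gauss2 b).
Proof.
move=> b0; have [c _ cP] := integral_gauss2 b0.
apply/integrableP; split; first by apply/measurable_EFinP; exact: measurable_gauss2.
have -> : (\int[leb2]_w `|(EFin \o gauss2 b) w| = \int[leb2]_w (gauss2 b w)%:E)%E.
  by apply: eq_integral => w _ /=; rewrite ger0_norm// expR_ge0.
by rewrite cP ltry.
Qed.

Lemma pow_le_expR n b : 0 < b -> exists2 C : R, 0 <= C &
  forall x, 0 <= x -> x ^+ n <= C * expR (b * x).
Proof.
move=> b0; have [->|n0] := posnP n.
  exists 1 => // x x0; rewrite mul1r expr0 -expR0 ler_expR.
  by apply: mulr_ge0 => //; exact: ltW.
have nR0 : 0 < n%:R :> R by rewrite ltr0n.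
exists ((n%:R / b) ^+ n) => [|x x0]; first by rewrite exprn_ge0// divr_ge0// ltW.
have -> : b * x = n%:R * (b * x / n%:R) by field; rewrite gt_eqF.
rewrite expRM_natl -exprMn lerXn2r ?nnegrE//.
  by rewrite mulr_ge0 ?expR_ge0// divr_ge0// ltW.
have := expR_ge1Dx (b * x / n%:R); set E := expR _ => H.
have : b * x / n%:R <= E by apply: le_trans H; rewrite lerDr.
rewrite ler_pdivrMr// => H'.
by rewrite mulrAC ler_pdivlMr// mulrC (mulrC n%:R).
Qed.

Lemma integrable_moment n b : 0 < b ->
  integrable leb2 setT (fun w => (modulus (cplx w) ^+ n * gauss2 b w)%:E).
Proof.
move=> b0; have b20 : 0 < b / 2 by rewrite divr_gt0.
have [C C0 CP] := pow_le_expR n b20.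
have iC : integrable leb2 setT (fun w => ((C * expR (b / 2)) * gauss2 (b / 2) w)%:E).
  have := integrableZl measurableT (C * expR (b / 2)) (integrable_gauss2 b20).
  by apply: eq_integrable.
apply: le_integrable iC => //.
  apply/measurable_EFinP; apply: measurable_funM; last exact: measurable_gauss2.
  by apply: measurable_funX; exact: measurable_modulus_cplx.
move=> w _; rewrite !abse_EFin lee_fin; set t := modulus _.
have t0 : 0 <= t by exact: modulus_ge0.
rewrite !ger0_norm ?mulr_ge0 ?expR_ge0 ?exprn_ge0//.
(* In terms of [1 + t ^+ 2] the bound of [pow_le_expR] costs exactly half of the Gaussian
   exponent. *)
have tn : t ^+ n <= (1 + t ^+ 2) ^+ n.
  by rewrite lerXn2r ?nnegrE ?addr_ge0 ?sqr_ge0//; nra.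
apply: le_trans (ler_wpM2r (expR_ge0 _) tn) _.
apply: le_trans (ler_wpM2r (expR_ge0 _) (CP _ _)) _; first by rewrite addr_ge0 ?sqr_ge0.
rewrite /gauss2 -/t -!mulrA -!expRD; apply: ler_wpM2l => //.
by rewrite ler_expR; apply: eq_ler; field.
Qed.

(** The fundamental theorem of calculus on growing symmetric intervals: the last hypothesis makes
    the boundary terms of order [1 / n]. *)
Lemma integral_derivative_line (F H : R -> R) (K : R) :
  (forall x, is_derive x 1 F (H x)) -> continuous H ->
  leb.-integrable setT (EFin \o H) ->
  (forall x, `|F x| * (1 + `|x|) <= K) ->
  \int[leb]_x H x = 0.
Proof.
move=> dF cH iH FK.
have mH : measurable_fun setT H by exact: continuous_measurable_fun.
pose A (n : nat) : set R := `[- n.+1%:R, n.+1%:R]%classic.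
have FTC n : \int[leb]_(x in A n) H x = F n.+1%:R - F (- n.+1%:R).
  have ab : - n.+1%:R < n.+1%:R :> R by rewrite gtrN// ltr0n.
  have cF : continuous F.
    move=> x; apply: differentiable_continuous; apply/derivable1_diffP.
    by have [] := dF x.
  rewrite /Rintegral (@continuous_FTC2 _ H F _ _ ab)//.
  - exact: continuous_subspaceT.
  - split => [x _||]; first by have [] := dF x.
    + by apply: cvg_at_right_filter; exact: cF.
    + by apply: cvg_at_left_filter; exact: cF.
  - by move=> x _; rewrite derive1E; have [_ ->] := dF x.
have lim0 : (fun n => F n.+1%:R - F (- n.+1%:R)) @ \oo --> 0.
  apply/cvgrPdist_le => e e0.
  have K0 : 0 <= K by apply: le_trans (FK 0); rewrite mulr_ge0// addr_ge0.
  exists (Num.truncn (2 * K / e)).+1 => // n /= Nn.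
  rewrite sub0r normrN.
  have nK : 2 * K / e <= n%:R.
    by apply: le_trans (ltW (truncnS_gt _)) _; rewrite ler_nat.
  have B (y : R) : `|y| = n.+1%:R -> `|F y| <= e / 2.
    move=> yn; have := FK y; rewrite yn => H1.
    have n0 : 0 < 1 + n.+1%:R :> R by rewrite ltr_wpDr.
    rewrite -(ler_pM2r n0); apply: le_trans H1 _.
    move: nK; rewrite ler_pdivrMr// => nK.
    have : n%:R <= 1 + n.+1%:R :> R by rewrite -natr1; lra.
    by nra.
  apply: le_trans (ler_normB _ _) _; rewrite [leRHS]splitr lerD// B// ?normrN normr_nat//.
have [|||||_ _ C] := @dominated_convergence _ _ R leb setT measurableT
    (fun n x => (EFin \o (H \_ (A n))) x) (EFin \o H) (EFin \o (fun x => `|H x|)).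
- move=> n; apply/measurable_EFinP; apply/(measurable_restrictT _ _).1.
    exact: measurable_itv.
  exact: measurable_funS mH.
- exact/measurable_EFinP.
- apply: aeW => x _; apply: cvg_EFin; first exact: nearW.
  apply: cvg_near_cst; exists (Num.truncn `|x|) => // n /= xn.
  rewrite patchE mem_set// /A /= in_itv /= -ler_norml.
  by apply: le_trans (ltW (truncnS_gt _)) _; rewrite ler_nat.
- exact: integrable_norm.
- apply: aeW => x n _ /=; rewrite lee_fin patchE; case: ifP => // _.
  by rewrite normr0.
have : (\int[leb]_x H x)%:E = 0%E; last by move=> [].
have fin : (\int[leb]_x (EFin \o H) x)%E \is a fin_num by exact: integrable_fin_num.
rewrite /Rintegral fineK//.
apply: (cvg_unique _ C) => //.
have -> : (fun n => \int[leb]_x (EFin \o H \_ (A n)) x)%E =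
    EFin \o (fun n => F n.+1%:R - F (- n.+1%:R)).
  apply/funext => n /=; rewrite -FTC Rintegral_mkcond /Rintegral fineK//.
  apply: integrable_fin_num => //.
  have iA : leb.-integrable (A n) (EFin \o H).
    by apply: integrableS iH => //; exact: measurable_itv.
  have mA : measurable (A n) := measurable_itv _.
  have [H1 _] := @integrable_mkcond _ _ R leb (A n) (EFin \o H) mA.
  by move: (H1 iA); rewrite restrict_EFin.
by apply: cvg_EFin; [exact: nearW|exact: lim0].
Qed.

End GaussianIntegrals.

(** * The recurrence of the Gaussian moments *)

Section GaussianMoments.
Context {R : realType}.
Implicit Types (b c x : R).
Notation leb := (@lebesgue_measure R).

Definition gauss_moment b n : R := \int[leb2]_w (modulus (cplx w) ^+ n * gauss2 b w).

Lemma gauss_momentE b n : 0 < b ->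
  (\int[leb2]_w (modulus (cplx w) ^+ n * gauss2 b w)%:E)%E = (gauss_moment b n)%:E.
Proof. by move=> b0; rewrite fineK//; apply: integrable_fin_num => //; exact: integrable_moment. Qed.

Lemma gauss_moment0_gt0 b : 0 < b -> 0 < gauss_moment b 0.
Proof.
move=> b0; have [c c0 cP] := integral_gauss2 b0.
suff -> : gauss_moment b 0 = c by [].
apply: EFin_inj; rewrite -gauss_momentE// -cP.
by apply: eq_integral => w _; rewrite expr0 mul1r.
Qed.

(** The derivative of [x (x^2 + c)^n exp (- b x^2)]. With [c = y^2] it is, up to the factor
    [exp (- b y^2)], the [x]-derivative of [x |z|^(2n) exp (- b |z|^2)]: integration by parts takes
    the place of polar coordinates. *)
Definition line_moment_fun b c n x : R :=
  ((x ^+ 2 + c) ^+ n + 2 * n%:R * x ^+ 2 * (x ^+ 2 + c) ^+ n.-1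
    - 2 * b * x ^+ 2 * (x ^+ 2 + c) ^+ n) * expR (- (b * x ^+ 2)).

Lemma is_derive_line_moment b c n x :
  is_derive x 1 (fun x => x * (x ^+ 2 + c) ^+ n * expR (- (b * x ^+ 2)))
    (line_moment_fun b c n x).
Proof.
have d2 : is_derive x 1 (fun x : R => x ^+ 2) (2 * x).
  by apply: is_derive_eq; rewrite -?[_ *: _]/(_ * _); ring.
have d2c : is_derive x 1 (fun x : R => x ^+ 2 + c) (2 * x).
  by apply: is_derive_eq; rewrite -?[_ *: _]/(_ * _); ring.
have d3 : is_derive x 1 (fun x => (x ^+ 2 + c) ^+ n) (n%:R * (x ^+ 2 + c) ^+ n.-1 * (2 * x)).
  apply: (@is_derive1_comp _ (fun x => x ^+ n) (fun x => x ^+ 2 + c)).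
  elim: n => [|n ih]; first by rewrite mul0r; have := is_derive_cst (1 : R) (x ^+ 2 + c) 1.
  have -> : (fun x : R => x ^+ n.+1) = (fun x : R => x * x ^+ n) by apply/funext => y; rewrite exprS.
  apply: is_derive_eq; rewrite -?[_ *: _]/(_ * _) /=.
  case: n {ih} => [|n]; first by rewrite expr0; ring.
  rewrite -(natr1 n.+1) -[n.+1.-1]/n; set S := x ^+ 2 + c; rewrite (exprS S n).
  by move: (S ^+ n) (n.+1%:R : R) => u v; ring.
have d4 : is_derive x 1 (fun x => expR (- (b * x ^+ 2))) (expR (- (b * x ^+ 2)) * - (b * (2 * x))).
  apply: (@is_derive1_comp _ expR (fun x => - (b * x ^+ 2))).
apply: is_derive_eq; rewrite /line_moment_fun -?[_ *: _]/(_ * _).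
by move: (_ ^+ n) (_ ^+ n.-1) (expR _) => A B E; ring.
Qed.

Lemma continuous_line_moment b c n : continuous (line_moment_fun b c n).
Proof.
move=> x; have cX k : {for x, continuous (fun x : R => x ^+ k)} by exact: exprn_continuous.
have cp k : {for x, continuous (fun x : R => (x ^+ 2 + c) ^+ k)}.
  apply: (@continuous_comp _ _ _ (fun x : R => x ^+ 2 + c) (fun x => x ^+ k)).
    by apply: continuousD; [exact: cX|exact: cst_continuous].
  exact: exprn_continuous.
suff : {for x, continuous (fun x : R => ((x ^+ 2 + c) ^+ n + 2 * n%:R * x ^+ 2 * (x ^+ 2 + c) ^+ n.-1
    - 2 * b * x ^+ 2 * (x ^+ 2 + c) ^+ n) * expR (- (b * x ^+ 2)))} by [].
apply: continuousM; last first.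
  apply: (@continuous_comp _ _ _ (fun x : R => - (b * x ^+ 2)) expR); last exact: continuous_expR.
  by apply: continuousN; apply: continuousM; [exact: cst_continuous|exact: cX].
apply: continuousB; first apply: continuousD => //.
- by apply: continuousM => //; apply: continuousM => //; exact: cst_continuous.
- by apply: continuousM => //; apply: continuousM => //; exact: cst_continuous.
Qed.

Lemma line_moment_bound b c n x : 0 < b -> 0 <= c ->
  `|line_moment_fun b c n x| <=
  (1 + 2 * n%:R + 2 * b) * (1 + x ^+ 2 + c) ^+ n.+1 * expR (- (b * x ^+ 2)).
Proof.
move=> b0 c0; rewrite /line_moment_fun normrM (ger0_norm (expR_ge0 _)).
apply: ler_wpM2r; first exact: expR_ge0.
set u := 1 + x ^+ 2 + c.
have x20 : 0 <= x ^+ 2 by exact: sqr_ge0.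
have u1 : 1 <= u by rewrite /u -addrA lerDl addr_ge0.
have xu : x ^+ 2 <= u by rewrite /u; lra.
have su : x ^+ 2 + c <= u by rewrite /u; lra.
have s0 : 0 <= x ^+ 2 + c by rewrite addr_ge0.
have sk k m : (k <= m)%N -> (x ^+ 2 + c) ^+ k <= u ^+ m.
  move=> km; apply: (@le_trans _ _ (u ^+ k)); last exact: ler_weXn2l.
  by rewrite lerXn2r ?nnegrE// (le_trans _ u1).
have e0 k : 0 <= (x ^+ 2 + c) ^+ k by exact: exprn_ge0.
have U0 : 0 <= u ^+ n by rewrite exprn_ge0// (le_trans _ u1).
have T1 : (x ^+ 2 + c) ^+ n <= u ^+ n.+1 by exact: sk.
have T2 : n%:R * (x ^+ 2 * (x ^+ 2 + c) ^+ n.-1) <= n%:R * u ^+ n.+1.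
  case: n {T1} sk U0 => [|n] sk U0; first by rewrite !mul0r.
  apply: ler_wpM2l => //; rewrite (exprS u); apply: ler_pM => //.
  exact: sk.
have T3 : x ^+ 2 * (x ^+ 2 + c) ^+ n <= u ^+ n.+1.
  by rewrite (exprS u); apply: ler_pM => //; exact: sk.
have T2' : 0 <= n%:R * (x ^+ 2 * (x ^+ 2 + c) ^+ n.-1).
  by apply: mulr_ge0 => //; apply: mulr_ge0 => //; exact: e0.
have T3' : 0 <= x ^+ 2 * (x ^+ 2 + c) ^+ n by rewrite mulr_ge0.
have T4 : b * (x ^+ 2 * (x ^+ 2 + c) ^+ n) <= b * u ^+ n.+1 by rewrite ler_wpM2l// ltW.
have T4' : 0 <= b * (x ^+ 2 * (x ^+ 2 + c) ^+ n) by rewrite mulr_ge0// ltW.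
have := e0 n; move: T1 T2 T2' T4 T4'.
set A := (x ^+ 2 + c) ^+ n; set B := n%:R * _; set D := b * _; set E := u ^+ n.+1.
have -> : 2 * n%:R * x ^+ 2 * (x ^+ 2 + c) ^+ n.-1 = 2 * B by rewrite /B; ring.
have -> : 2 * b * x ^+ 2 * A = 2 * D by rewrite /D /A; ring.
by move=> h1 h2 h3 h4 h5 h6; rewrite ler_norml; lra.
Qed.

Lemma integrable_line_moment b c n : 0 < b -> 0 <= c ->
  leb.-integrable setT (fun x => (line_moment_fun b c n x)%:E).
Proof.
move=> b0 c0; have b20 : 0 < b / 2 by rewrite divr_gt0.
have mH : measurable_fun setT (line_moment_fun b c n).
  by apply: continuous_measurable_fun; exact: continuous_line_moment.
have [C C0 CP] := pow_le_expR n.+1 b20.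
have [k k0 kP] := gauss_line b20; have [mg ig] := kP 0.
pose K := (1 + 2 * n%:R + 2 * b) * (C * expR (b / 2 * (1 + c))).
have K0 : 0 <= K.
  by rewrite /K !mulr_ge0 ?expR_ge0// !addr_ge0// mulr_ge0// ltW.
have ig0 : leb.-integrable setT (fun x => (K * expR (- (b / 2 * (x - 0) ^+ 2)))%:E).
  have I : leb.-integrable setT (fun x : R => (expR (- (b / 2 * (x - 0) ^+ 2)))%:E).
    apply/integrableP; split; first exact/measurable_EFinP.
    under eq_integral do rewrite abse_EFin ger0_norm ?expR_ge0//.
    by rewrite ig ltry.
  by have := integrableZl measurableT K I; apply: eq_integrable.
apply: le_integrable ig0 => //; first exact/measurable_EFinP.
move=> x _; rewrite !abse_EFin lee_fin.
apply: le_trans (line_moment_bound n x b0 c0) _.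
rewrite subr0 (ger0_norm (mulr_ge0 K0 (expR_ge0 _))) /K -!mulrA.
apply: ler_wpM2l; first by rewrite !addr_ge0// mulr_ge0// ltW.
have x20 := sqr_ge0 x.
apply: le_trans (ler_wpM2r (expR_ge0 _) (CP _ _)) _; first lra.
rewrite -!mulrA -!expRD; apply: ler_wpM2l => //.
by rewrite ler_expR; apply: eq_ler; field.
Qed.

Lemma line_moment0 b c n : 0 < b -> 0 <= c ->
  (\int[leb]_x (line_moment_fun b c n x)%:E = 0)%E.
Proof.
move=> b0 c0; have iH := integrable_line_moment n b0 c0.
have [C C0 CP] := pow_le_expR n.+2 b0.
have := @integral_derivative_line _ _ _ (2 * (C * expR (b * (1 + c))))
  (fun x => @is_derive_line_moment b c n x) (@continuous_line_moment b c n) iH.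
move=> I0; rewrite -[LHS]fineK; last exact: integrable_fin_num.
congr EFin; apply: I0 => x.
set u := 1 + x ^+ 2 + c.
have x20 := sqr_ge0 x.
have u1 : 1 <= u by rewrite /u; lra.
have nx2 : `|x| ^+ 2 = x ^+ 2 by rewrite real_normK ?num_real.
have xu : `|x| <= u by rewrite /u -nx2; have := sqr_ge0 (`|x| - 1); have := normr_ge0 x; nra.
rewrite !normrM (ger0_norm (expR_ge0 _)) normrX (ger0_norm (addr_ge0 x20 c0)).
have su : (x ^+ 2 + c) ^+ n <= u ^+ n.
  have s0 : 0 <= x ^+ 2 + c by rewrite addr_ge0.
  have u0 : 0 <= u by exact: le_trans ler01 u1.
  by apply: lerXn2r; rewrite ?nnegrE// /u; lra.
have un := CP u (le_trans ler01 u1).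
apply: (@le_trans _ _ (u * u ^+ n * expR (- (b * x ^+ 2)) * (2 * u))).
  apply: ler_pM; rewrite ?mulr_ge0 ?expR_ge0 ?exprn_ge0 ?addr_ge0//; last lra.
  apply: ler_wpM2r; first exact: expR_ge0.
  by apply: ler_pM => //; rewrite exprn_ge0// addr_ge0.
have -> : u * u ^+ n * expR (- (b * x ^+ 2)) * (2 * u) =
  2 * (u ^+ n.+2 * expR (- (b * x ^+ 2))) by rewrite !exprS; ring.
apply: ler_wpM2l => //; apply: le_trans (ler_wpM2r (expR_ge0 _) un) _.
rewrite -!mulrA -!expRD; apply: ler_wpM2l => //.
by rewrite ler_expR /u; apply: eq_ler; ring.
Qed.

Definition plane_moment_fun b n x y : R :=
  line_moment_fun b (y ^+ 2) n x * expR (- (b * y ^+ 2)).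

Lemma plane_moment_funE b n x y : plane_moment_fun b n x y =
  ((modulus (Complex x y) ^+ n.*2) + 2 * n%:R * x ^+ 2 * modulus (Complex x y) ^+ (n.-1).*2
    - 2 * b * x ^+ 2 * modulus (Complex x y) ^+ n.*2) * gauss2 b (x, y).
Proof.
rewrite gauss2E mulrA /plane_moment_fun /line_moment_fun; congr (_ * _ * _).
by rewrite -!mul2n !exprM sqr_modulus.
Qed.

Lemma cmeas_coord : measurable_fun setT (fun w : plane R => (w.1 : R)) /\
  measurable_fun setT (fun w : plane R => (w.2 : R)).
Proof. by split; [exact: measurable_fst|exact: measurable_snd]. Qed.

Lemma integrable_coord_moment b n (g : plane R -> R) : 0 < b -> measurable_fun setT g ->
  (forall w, `|g w| <= modulus (cplx w)) ->
  integrable leb2 setT (fun w => (g w ^+ 2 * modulus (cplx w) ^+ n * gauss2 b w)%:E).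
Proof.
move=> b0 mg gw; apply: le_integrable (integrable_moment n.+2 b0) => //.
  apply/measurable_EFinP; apply: measurable_funM; last exact: measurable_gauss2.
  by apply: measurable_funM; apply: measurable_funX => //; exact: measurable_modulus_cplx.
move=> w _; rewrite !abse_EFin lee_fin normrM [leRHS]normrM; apply: ler_wpM2r => //.
rewrite normrM !normrX (ger0_norm (modulus_ge0 _)) -[n.+2]add2n exprD; apply: ler_wpM2r.
  by rewrite exprn_ge0.
by rewrite lerXn2r ?nnegrE.
Qed.

(** The divergence of the field [z |z|^(2n) exp (- b |z|^2)] has integral [0]. With [M_k] the moment
    of order [k], adding the two coordinate identities gives
    [2 M_(2n) + 2 n M_(2n) - 2 b M_(2n+2) = 0]. *)
Lemma gauss_momentS b n : 0 < b ->
  b * gauss_moment b n.+1.*2 = n.+1%:R * gauss_moment b n.*2.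
Proof.
move=> b0; have [m1 m2] := cmeas_coord.
have n1 (w : plane R) : `|w.1| <= modulus (cplx w) by exact: Re_le_modulus (cplx w).
have n2 (w : plane R) : `|w.2| <= modulus (cplx w) by exact: Im_le_modulus (cplx w).
pose X k := \int[leb2]_w ((w.1 : R) ^+ 2 * modulus (cplx w) ^+ k * gauss2 b w).
pose Y k := \int[leb2]_w ((w.2 : R) ^+ 2 * modulus (cplx w) ^+ k * gauss2 b w).
have XY k : X k + Y k = gauss_moment b k.+2.
  rewrite /X /Y -RintegralD//; last 2 first.
    exact: integrable_coord_moment m1 n1.
    exact: integrable_coord_moment m2 n2.
  apply: eq_Rintegral => w _; rewrite -!mulrDl; congr (_ * _).
  by rewrite -(add2n k) exprD sqr_modulus.
have iZ k u := @integrable_realZl R _ (plane R) leb2 setT k u measurableT.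
have iD u v := @integrable_realD R _ (plane R) leb2 setT u v measurableT.
have E (g : plane R -> R) : measurable_fun setT g ->
    (forall w, `|g w| <= modulus (cplx w)) ->
    (\int[leb2]_w (((modulus (cplx w) ^+ n.*2) + 2 * n%:R * g w ^+ 2 * modulus (cplx w) ^+ (n.-1).*2
      - 2 * b * g w ^+ 2 * modulus (cplx w) ^+ n.*2) * gauss2 b w)) =
    gauss_moment b n.*2 + 2 * n%:R * (\int[leb2]_w (g w ^+ 2 * modulus (cplx w) ^+ (n.-1).*2 * gauss2 b w))
      + (- (2 * b)) * (\int[leb2]_w (g w ^+ 2 * modulus (cplx w) ^+ n.*2 * gauss2 b w)) /\
    integrable leb2 setT (fun w => (((modulus (cplx w) ^+ n.*2) + 2 * n%:R * g w ^+ 2 * modulus (cplx w) ^+ (n.-1).*2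
      - 2 * b * g w ^+ 2 * modulus (cplx w) ^+ n.*2) * gauss2 b w)%:E).
  move=> mg gw; have i0 := integrable_moment n.*2 b0.
  have i1 := iZ (2 * n%:R) _ (integrable_coord_moment (n.-1).*2 b0 mg gw).
  have i2 := iZ (- (2 * b)) _ (integrable_coord_moment n.*2 b0 mg gw).
  have eqf (w : plane R) : ((modulus (cplx w) ^+ n.*2) + 2 * n%:R * g w ^+ 2 * modulus (cplx w) ^+ (n.-1).*2
      - 2 * b * g w ^+ 2 * modulus (cplx w) ^+ n.*2) * gauss2 b w =
      (modulus (cplx w) ^+ n.*2 * gauss2 b w
      + 2 * n%:R * (g w ^+ 2 * modulus (cplx w) ^+ (n.-1).*2 * gauss2 b w))
      + (- (2 * b)) * (g w ^+ 2 * modulus (cplx w) ^+ n.*2 * gauss2 b w) by ring.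
  split; last by have := iD _ _ (iD _ _ i0 i1) i2; apply: eq_integrable => // w _ /=; rewrite eqf.
  under eq_Rintegral do rewrite eqf.
  rewrite RintegralD//; last exact: iD.
  rewrite RintegralD// !RintegralZl//; [exact: integrable_coord_moment|exact: integrable_coord_moment].
have [EX IX] := E _ m1 n1; have [EY IY] := E _ m2 n2.
(* Integrating first in the variable of differentiation makes every inner integral [0]. *)
have X0 : gauss_moment b n.*2 + 2 * n%:R * X (n.-1).*2 + (- (2 * b)) * X n.*2 = 0.
  rewrite -EX; apply: EFin_inj; rewrite fineK; last exact: integrable_fin_num.
  rewrite -integral21_prod_meas1//; apply: integral0_eq => y _; rewrite /fubini_G.
  transitivity (\int[leb]_x ((expR (- (b * (y : R) ^+ 2)))%:E * (line_moment_fun b ((y : R) ^+ 2) n x)%:E))%E.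
    apply: eq_integral => x _; rewrite -EFinM; congr EFin.
    by rewrite [RHS]mulrC; symmetry; exact: plane_moment_funE.
  rewrite integralZl//; last by apply: integrable_line_moment => //; exact: sqr_ge0.
  by rewrite line_moment0 ?sqr_ge0// mule0.
have Y0 : gauss_moment b n.*2 + 2 * n%:R * Y (n.-1).*2 + (- (2 * b)) * Y n.*2 = 0.
  rewrite -EY; apply: EFin_inj; rewrite fineK; last exact: integrable_fin_num.
  rewrite -integral12_prod_meas1//; apply: integral0_eq => x _; rewrite /fubini_F.
  transitivity (\int[leb]_y ((expR (- (b * (x : R) ^+ 2)))%:E * (line_moment_fun b ((x : R) ^+ 2) n y)%:E))%E.
    apply: eq_integral => y _; rewrite -EFinM; congr EFin; rewrite [RHS]mulrC.
    have mE : modulus (Complex (y : R) (x : R)) = modulus (cplx (x, y)).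
      by rewrite /cplx /= addrC.
    have gE : gauss2 b (y, x) = gauss2 b (x, y).
      by rewrite /gauss2 -[cplx (y, x)]/(Complex (y : R) (x : R)) mE.
    by have := plane_moment_funE b n y x; rewrite /plane_moment_fun => ->; rewrite mE gE.
  rewrite integralZl//; last by apply: integrable_line_moment => //; exact: sqr_ge0.
  by rewrite line_moment0 ?sqr_ge0// mule0.
(* At [n = 0] the predecessor is truncated, but the factor [n] is [0] too. *)
have n2E : n%:R * (X (n.-1).*2 + Y (n.-1).*2) = n%:R * gauss_moment b n.*2.
  by case: (n) => [|n']; rewrite ?mul0r// XY.
have := XY n.*2; rewrite -[n.*2.+2]/(n.+1.*2) => nE.
rewrite -nE -natr1 mulrDl -n2E mul1r.
by move: X0 Y0; lra.
Qed.

End GaussianMoments.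

(** * Taylor coefficients as integrals over the plane *)

Section CoefficientIntegrals.
Context {R : realType}.
Implicit Types (f : R[i] -> R[i]) (z : R[i]) (W : R[i] -> R) (b : R).

Lemma geometric_sum_le (x : R) n : 0 <= x -> x < 1 -> \sum_(k < n) x ^+ k <= (1 - x)^-1.
Proof.
move=> x0 x1; have d0 : 0 < 1 - x by rewrite subr_gt0.
rewrite -[leRHS]div1r ler_pdivlMr//.
have -> : (\sum_(k < n) x ^+ k) * (1 - x) = 1 - x ^+ n.
  elim: n => [|n ih]; first by rewrite big_ord0 mul0r expr0 subrr.
  by rewrite big_ord_recr mulrDl ih exprS; ring.
by rewrite gerBl exprn_ge0.
Qed.

Lemma taylor_ccvg f z : (forall w, cdiffable f w) ->
  ccvg (fun N => \sum_(k < N) tcoef f k * z ^+ k) (f z).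
Proof.
move=> df e e0; have [M MP] := taylor z df.
exists (Num.bound (`|M| / e)).+1 => -[//|N] NP; rewrite modulusBC; apply: le_trans (MP _ _) _ => //.
rewrite ler_pdivrMr ?exprn_gt0//; apply: le_trans (ler_norm M) _.
rewrite mulrC -ler_pdivrMr//; apply: le_trans (ltW (archi_boundP _)) _.
  by rewrite divr_ge0// ltW.
rewrite -natrX ler_nat; apply: leq_trans (ltnW (ltn_expl N.+1 (isT : (1 < 2)%N))).
by apply: leq_trans NP.
Qed.

Lemma tcoef0 f : (forall w, cdiffable f w) -> tcoef f 0 = f 0.
Proof.
move=> df; apply/eqP; rewrite -subr_eq0 -modulus_eq0 eq_le modulus_ge0 andbT.
apply/ler_addgt0Pr => e e0; have [N NP] := taylor_ccvg 0 df e0; rewrite add0r.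
have := NP N.+1 (leqnSn N); rewrite big_ord_recl expr0 mulr1 big1 ?addr0// => i _.
by rewrite /= expr0n mulr0.
Qed.

Lemma modulus_conj z : modulus z^* = modulus z.
Proof. by case: z => x y /=; rewrite sqrrN. Qed.

Lemma mul_conj z : z * z^* = (modulus z ^+ 2)%:C.
Proof.
rewrite sqr_modulus; case: z => x y; apply/eqP; rewrite eq_complex /=.
by apply/andP; split; apply/eqP; ring.
Qed.

Lemma integralC_real d (T : measurableType d) (mu : {measure set T -> \bar R}) D (h : T -> R) :
  integralC mu D (fun w => (h w)%:C) = (\int[mu]_(w in D) h w)%:C.
Proof.
apply/eqP; rewrite eq_complex /=; apply/andP; split; apply/eqP => //.
by rewrite /Rintegral integral0.
Qed.

(** Integrating the Taylor series term by term against [conj z ^ n], the rotation invariance of [W]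
    kills every term but the [n]-th. The majorant [G] for dominated convergence is left to the
    caller, since it depends on the growth of [f] and the decay of [W]. *)
Lemma plane_int_coef f n W (G : plane R -> R) : (forall w, cdiffable f w) ->
  (forall u z, modulus u = 1 -> W (u * z) = W z) -> (forall z, 0 <= W z) ->
  measurable_fun setT (fun w => W (cplx w)) ->
  (forall k, integrable leb2 setT (fun w => (modulus (cplx w) ^+ k * W (cplx w))%:E)) ->
  integrable leb2 setT (EFin \o G) ->
  (forall N w, (\sum_(k < N) modulus (tcoef f k) * modulus (cplx w) ^+ k) *
    (modulus (cplx w) ^+ n * W (cplx w)) <= G w) ->
  plane_int (fun z => f z * z^* ^+ n * (W z)%:C) =
    tcoef f n * (\int[leb2]_w (modulus (cplx w) ^+ n.*2 * W (cplx w)))%:C.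
Proof.
move=> df Wrot W0 mW iW iG GP.
pose t k z := z ^+ k * z^* ^+ n * (W z)%:C.
pose F N (w : plane R) := \sum_(k < N) tcoef f k * t k (cplx w).
have mt k : cmeas setT (fun w => t k (cplx w)).
  apply: cmeasM; last exact: cmeas_real.
  apply: cmeasM; apply: cmeasX; first exact: cmeas_cplx.
  by apply: cmeas_conj; exact: cmeas_cplx.
have mct k : cmeas setT (fun w => tcoef f k * t k (cplx w)).
  by apply: cmeasM => //; exact: cmeas_cst.
have mF N : cmeas setT (F N).
  by apply: (@cmeas_sum _ _ _ _ N (fun k w => tcoef f k * t k (cplx w))).
have tE k z : modulus (t k z) = modulus z ^+ (k + n) * W z.
  by rewrite /t !modulusM !modulusX modulus_real modulus_conj exprD ger0_norm.
have FG N w : modulus (F N w) <= G w.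
  apply: le_trans (GP N w); apply: le_trans (ler_modulus_sum _ _ _) _.
  rewrite mulr_suml; apply: ler_sum => k _; rewrite modulusM tE exprD !mulrA.
  exact: eq_ler.
have it k : integrableC leb2 setT (fun w => t k (cplx w)).
  by apply: integrableC_le (iW (k + n)%N) _ => // w _; rewrite tE.
have iF N : integrableC leb2 setT (F N) by apply: integrableC_le iG _.
have It k : k != n -> integralC leb2 setT (fun w => t k (cplx w)) = 0.
  move=> kn; apply: (plane_int_orthogonal kn Wrot mW).
  by apply: eq_integrable (iW (k + n)%N) => // w _; rewrite ger0_norm.
set I := (\int[leb2]_w _)%:C.
have In : integralC leb2 setT (fun w => t n (cplx w)) = I.
  rewrite /I -integralC_real; congr integralC; apply/funext => w.
  by rewrite /t -exprMn mul_conj -rmorphXn -exprM mul2n -rmorphM.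
have IF N : integralC leb2 setT (F N) = if (n < N)%N then tcoef f n * I else 0.
  elim: N => [|N ih].
    have -> : F 0 = (fun=> 0%:C) by apply/funext => w; rewrite /F big_ord0.
    by rewrite integralC_real /Rintegral integral0.
  have -> : F N.+1 = (fun w => F N w + tcoef f N * t N (cplx w)).
    by apply/funext => w; rewrite /F big_ord_recr.
  rewrite integralCD// ?integralCZ//; last first.
    apply: (@integrableC_le _ _ _ _ _ _ (fun w => modulus (tcoef f N) * (modulus (cplx w) ^+ (N + n) * W (cplx w)))) => //.
      by have := integrableZl measurableT (modulus (tcoef f N)) (iW (N + n)%N); apply: eq_integrable.
    by move=> w _; rewrite modulusM tE.
  rewrite ih; have [nN|Nn|nN] := ltngtP n N.
  - by rewrite ltnS (ltnW nN) It ?mulr0 ?addr0// gtn_eqF.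
  - by rewrite ltnS leqNgt Nn /= It ?mulr0 ?addr0// ltn_eqF.
  - by rewrite ltnS -nN leqnn In add0r.
have Ff w : ccvg (F^~ w) (f (cplx w) * (cplx w)^* ^+ n * (W (cplx w))%:C).
  have := ccvgZ ((cplx w)^* ^+ n * (W (cplx w))%:C) (taylor_ccvg (cplx w) df).
  have -> : (cplx w)^* ^+ n * (W (cplx w))%:C * f (cplx w) =
    f (cplx w) * (cplx w)^* ^+ n * (W (cplx w))%:C by ring.
  apply: eq_ccvg => N; rewrite /F mulr_sumr; apply: eq_bigr => k _.
  by rewrite /t; ring.
have [_ cF] := integralC_ccvg measurableT mF iG (fun N w _ => FG N w) (fun w _ => Ff w).
apply: (ccvg_unique cF) => e e0; exists n.+1 => N nN.
by rewrite IF nN subrr modulus0 ltW.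
Qed.

Lemma gauss_moment_ge0 b n : 0 <= gauss_moment b n.
Proof.
by apply: Rintegral_ge0 => // w _; apply: mulr_ge0; [exact: exprn_ge0|exact: expR_ge0].
Qed.

Lemma gauss_moment_fact b n : 0 < b ->
  gauss_moment b n.*2 * b ^+ n = n`!%:R * gauss_moment b 0.
Proof.
move=> b0; elim: n => [|n ih]; first by rewrite expr0 mulr1 fact0 mul1r.
by rewrite exprS mulrCA mulrA gauss_momentS// factS natrM -[LHS]mulrA ih mulrA.
Qed.

Lemma gauss_moment_gt0 b n : 0 < b -> 0 < gauss_moment b n.*2.
Proof.
move=> b0; rewrite -(pmulr_lgt0 _ (exprn_gt0 n b0)) gauss_moment_fact//.
by rewrite mulr_gt0 ?gauss_moment0_gt0// ltr0n fact_gt0.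
Qed.

Lemma fact_double n : (n`! ^ 2 * 4 ^ n <= (n.*2.+1)`!)%N.
Proof.
elim: n => // n ih; rewrite doubleS (factS n.*2.+2) (factS n.*2.+1) (factS n) expnMn (expnS 4).
rewrite mulnACA [leqRHS]mulnA; apply: leq_mul ih; rewrite (_ : (_ * 4)%N = (n.+1.*2 * n.+1.*2)%N).
  by rewrite leq_mul2r doubleS leqnSn orbT.
by rewrite -!mul2n mulnACA mulnC.
Qed.

(* For odd [n], Cauchy-Schwarz between the two neighbouring even moments. *)
Lemma gauss_moment_half_le b n : 0 < b ->
  gauss_moment (b / 2) n ^+ 2 * gauss_moment b 0 <=
  gauss_moment (b / 2) 0 ^+ 2 * (n.+1%:R * gauss_moment b n.*2).
Proof.
move=> b0; have b20 : 0 < b / 2 by rewrite divr_gt0.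
set G' := gauss_moment (b / 2) 0; set G := gauss_moment b 0.
have G0 : 0 < G by exact: gauss_moment0_gt0.
have even m : gauss_moment (b / 2) m.*2 ^+ 2 * b ^+ m.*2 <= G' ^+ 2 * (m.*2.+1)`!%:R.
  have := gauss_moment_fact m b20; rewrite -/G' expr_div_n => E.
  have {}E : gauss_moment (b / 2) m.*2 * b ^+ m = 2 ^+ m * (m`!%:R * G').
    by rewrite -E; field.
  rewrite (_ : b ^+ m.*2 = b ^+ m ^+ 2); last by rewrite -exprM muln2.
  rewrite -exprMn E.
  rewrite [leLHS](_ : _ = G' ^+ 2 * (m`! ^ 2 * 4 ^ m)%:R); last first.
    by rewrite natrM !natrX -[4%:R]/((2 * 2)%:R) natrM !exprMn; ring.
  by rewrite ler_wpM2l ?exprn_ge0 ?gauss_moment_ge0// ler_nat fact_double.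
have bn k : 0 < b ^+ k by rewrite exprn_gt0.
rewrite -(ler_pM2r (bn n)).
have -> : G' ^+ 2 * (n.+1%:R * gauss_moment b n.*2) * b ^+ n = G' ^+ 2 * (n.+1)`!%:R * G.
  by rewrite factS natrM -!(mulrA _ _ (b ^+ n)) gauss_moment_fact// !mulrA.
have nE : n = (odd n + n./2.*2)%N by rewrite odd_double_half.
move: nE; set m := n./2; case: (odd n) => [|]; rewrite ?add1n ?add0n => ->; last first.
  by rewrite mulrAC ler_wpM2r ?even// ltW.
set A := gauss_moment (b / 2) m.*2; set B := gauss_moment (b / 2) m.*2.+1.
have AS : b * gauss_moment (b / 2) m.+1.*2 = m.+1.*2%:R * A.
  by have := gauss_momentS m b20; rewrite -/A -muln2 natrM => E; rewrite -[LHS]/(_) ; lra.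
(* By the recurrence [AS], [c ^+ 2] is the quotient of the even moments on both sides of the order
   [2 m + 1]. This is the weight for which the inequality [amgm], once integrated, is
   Cauchy-Schwarz. *)
pose c := Num.sqrt (m.+1.*2%:R / b) : R.
have c2 : c ^+ 2 = m.+1.*2%:R / b by rewrite sqr_sqrtr// divr_ge0// ltW.
have c0 : 0 < c by rewrite sqrtr_gt0 divr_gt0// ltr0n.
have amgm (u : R) : 0 <= u ->
    u ^+ m.*2.+1 <= c / 2 * u ^+ m.*2 + (2 * c)^-1 * u ^+ m.+1.*2.
  move=> u0; rewrite doubleS !(exprS u m.*2.+1) (exprS u m.*2) !mulrA -mulrDl.
  rewrite ler_wpM2r ?exprn_ge0// -subr_ge0 (_ : _ - _ = (c - u) ^+ 2 / (2 * c)).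
    by rewrite divr_ge0 ?sqr_ge0// mulr_ge0// ltW.
  by field; rewrite gt_eqF.
have BA : B <= c * A.
  have i1 := integrable_moment m.*2 b20; have i2 := integrable_moment m.+1.*2 b20.
  have i3 := integrable_moment m.*2.+1 b20.
  have iZ k u := @integrable_realZl R _ (plane R) leb2 setT k u measurableT.
  have j1 := iZ (c / 2) _ i1; have j2 := iZ ((2 * c)^-1) _ i2.
  apply: (@le_trans _ _ (c / 2 * A + (2 * c)^-1 * gauss_moment (b / 2) m.+1.*2)).
    rewrite /A /gauss_moment -!RintegralZl// -RintegralD//.
    apply: le_Rintegral => //.
      by have := integrableD measurableT j1 j2; apply: eq_integrable.
    move=> w _; have := ler_wpM2r (expR_ge0 _ : 0 <= gauss2 (b / 2) w) (amgm _ (modulus_ge0 (cplx w))).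
    by rewrite mulrDl -!(mulrA _ _ (gauss2 _ _)).
  have -> : gauss_moment (b / 2) m.+1.*2 = c ^+ 2 * A.
    by rewrite c2 mulrAC -AS mulrAC mulfV ?mul1r// gt_eqF.
  by apply: eq_ler; field; rewrite gt_eqF.
have A0 : 0 <= A by exact: gauss_moment_ge0.
have B0 : 0 <= B by exact: gauss_moment_ge0.
have B2 : B ^+ 2 <= c ^+ 2 * A ^+ 2.
  by rewrite -exprMn lerXn2r ?nnegrE// mulr_ge0// ltW.
rewrite mulrAC; apply: (ler_wpM2r (ltW G0)).
apply: (@le_trans _ _ (c ^+ 2 * A ^+ 2 * b ^+ m.*2.+1)).
  exact: ler_wpM2r (ltW (bn _)) _ _ B2.
rewrite c2 (exprS b).
have -> : m.+1.*2%:R / b * A ^+ 2 * (b * b ^+ m.*2) = m.+1.*2%:R * (A ^+ 2 * b ^+ m.*2).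
  by field; rewrite gt_eqF.
rewrite (factS m.*2.+1) natrM [leRHS]mulrCA; apply: ler_wpM2l => //; exact: even.
Qed.

End CoefficientIntegrals.

(** * Fock spaces *)

Section FockSpaces.
Context {R : realType}.
Variable alpha : R.
Hypothesis alpha_gt0 : 0 < alpha.
Implicit Types (f g : R[i] -> R[i]) (z : R[i]) (N r : R).

Local Notation "'g[ f ]" := (gauss_modulus alpha f) (at level 0, format "''g[' f ]").

Lemma entire_cdiffable f : entire f -> forall z, cdiffable f z.
Proof. by move/entireP. Qed.

Lemma cmeas_entire f : (forall z, cdiffable f z) -> cmeas setT (fun w => f (cplx w)).
Proof.
move=> df; pose F (N : nat) (w : plane R) := \sum_(k < N) tcoef f k * cplx w ^+ k.
have mF (N : nat) : cmeas setT (F N).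
  apply: (@cmeas_sum _ _ _ _ N (fun k w => tcoef f k * cplx w ^+ k)) => k.
  apply: cmeasM; first exact: cmeas_cst.
  by apply: cmeasX; exact: cmeas_cplx.
by apply: (cmeas_ccvg measurableT mF) => w _; exact: taylor_ccvg.
Qed.

Lemma gauss_modulus_ge0 f z : 0 <= 'g[f] z.
Proof. by rewrite mulr_ge0 ?expR_ge0. Qed.

Lemma gauss_modulusE f (w : plane R) : 'g[f] (cplx w) = modulus (f (cplx w)) * gauss2 (alpha / 2) w.
Proof. by []. Qed.

Lemma measurable_gauss_modulus f : (forall z, cdiffable f z) ->
  measurable_fun setT (fun w => 'g[f] (cplx w)).
Proof.
move=> df; apply: measurable_funM; last exact: measurable_gauss2.
by apply: cmeas_modulus => //; exact: cmeas_entire.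
Qed.

Definition Fock_cst r : R := alpha * r / (2 * pi).

Lemma Fock_cst_gt0 r : 0 < r -> 0 < Fock_cst r.
Proof. by move=> r0; rewrite divr_gt0 ?mulr_gt0 ?pi_gt0. Qed.

Lemma gauss_integral_ge0 r f : (0 <= \int[leb2]_w ('g[f] (cplx w) `^ r)%:E)%E.
Proof. by apply: integral_ge0 => w _; rewrite lee_fin powR_ge0. Qed.

Lemma Fock_norm_finP r N f : 0 < r -> 0 <= N ->
  (Fock_norm alpha r%:E f <= N%:E)%E <->
  ((Fock_cst r)%:E * \int[leb2]_w ('g[f] (cplx w) `^ r)%:E <= (N `^ r)%:E)%E.
Proof.
move=> r0 N0;
have -> : Fock_norm alpha r%:E f =
  (((Fock_cst r)%:E * \int[leb2]_w ('g[f] (cplx w) `^ r)%:E) `^ r^-1)%E by [].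
have : (0 <= (Fock_cst r)%:E * \int[leb2]_w ('g[f] (cplx w) `^ r)%:E)%E.
  by rewrite mule_ge0 ?gauss_integral_ge0// lee_fin ltW// Fock_cst_gt0.
set X := (_ * _)%E => X0.
have r0' : 0 <= r by exact: ltW.
have ri0 : 0 <= r^-1 by rewrite invr_ge0.
have rK : r^-1 * r = 1 by rewrite mulVf// gt_eqF.
have Kr : r * r^-1 = 1 by rewrite mulfV// gt_eqF.
split=> H.
- have := @gt0_ler_poweR _ r r0' (X `^ r^-1)%E N%:E _ _ H.
  rewrite -poweRrM rK poweRe1// !in_itv/= !leey !andbT => -> //.
  exact: poweR_ge0.
- have := @gt0_ler_poweR _ r^-1 ri0 X (N `^ r)%:E _ _ H.
  rewrite -poweR_EFin -poweRrM Kr poweRe1 ?lee_fin//; apply.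
  + by rewrite in_itv/= leey andbT.
  + by rewrite in_itv/= leey andbT lee_fin powR_ge0.
Qed.

Lemma gauss_integral_le r N f : 0 < r -> 0 <= N -> (Fock_norm alpha r%:E f <= N%:E)%E ->
  (\int[leb2]_w ('g[f] (cplx w) `^ r)%:E <= (N `^ r / Fock_cst r)%:E)%E.
Proof.
move=> r0 N0 /(Fock_norm_finP f r0 N0) H.
have k0 := Fock_cst_gt0 r0.
rewrite EFinM lee_pdivlMr// muleC//.
Qed.

Lemma integrable_gauss_modulus r N f : (forall z, cdiffable f z) -> 0 < r -> 0 <= N ->
  (Fock_norm alpha r%:E f <= N%:E)%E ->
  integrable leb2 setT (fun w => ('g[f] (cplx w) `^ r)%:E) /\
  \int[leb2]_w ('g[f] (cplx w) `^ r) <= N `^ r / Fock_cst r.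
Proof.
move=> df r0 N0 H; have I := gauss_integral_le r0 N0 H.
have i : integrable leb2 setT (fun w => ('g[f] (cplx w) `^ r)%:E).
  apply/integrableP; split.
    apply/measurable_EFinP.
    exact: measurableT_comp (measurable_powR _) (measurable_gauss_modulus df).
  under eq_integral do rewrite abse_EFin ger0_norm ?powR_ge0//.
  by apply: le_lt_trans I _; rewrite ltry.
split => //; rewrite -lee_fin fineK//; exact: integrable_fin_num.
Qed.

Lemma integrable_nneg (h : plane R -> R) : measurable_fun setT h -> (forall w, 0 <= h w) ->
  (\int[leb2]_w (h w)%:E < +oo)%E -> integrable leb2 setT (EFin \o h).
Proof.
move=> mh h0 ih; apply/integrableP; split; first exact/measurable_EFinP.
have -> : (\int[leb2]_x `|(EFin \o h) x| = \int[leb2]_w (h w)%:E)%E.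
  by apply: eq_integral => w _; rewrite abse_EFin (ger0_norm (h0 w)).
exact: ih.
Qed.

Lemma integral_gauss_shift r f z : (forall z, cdiffable f z) ->
  measurable_fun setT (fun w => 'g[f] (z + cplx w) `^ r) /\
  (\int[leb2]_w ('g[f] (z + cplx w) `^ r)%:E = \int[leb2]_w ('g[f] (cplx w) `^ r)%:E)%E.
Proof.
move=> df; split.
  apply: (measurableT_comp (measurable_powR r)).
  have dS : forall u, cdiffable (fun u => f (z + u)) u.
    move=> u; apply: cdiffable_comp; first exact: df.
    by apply: cdiffableD; [exact: cdiffable_cst|exact: cdiffable_id].
  apply: measurable_funM; first by apply: cmeas_modulus => //; exact: cmeas_entire dS.
  apply: measurableT_comp; first exact: measurable_expR.
  apply: measurable_funN; apply: measurable_funM; first exact: measurable_cst.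
  apply: measurable_funX; apply: cmeas_modulus => //.
  by apply: cmeasD; [exact: cmeas_cst|exact: cmeas_cplx].
have mE : measurable_fun setT (fun w => ('g[f] (cplx w) `^ r)%:E).
  apply/measurable_EFinP.
  exact: measurableT_comp (measurable_powR _) (measurable_gauss_modulus df).
have T := @ge0_integral_plane_translation _ (complex.Re z) (complex.Im z) _ mE
  (fun w => powR_ge0 ('g[f] (cplx w)) r).
apply: eq_trans T; apply: eq_integral => w _; congr ('g[f] _ `^ r)%:E.
by case: (z) => a b; apply/eqP; rewrite eq_complex /= !(addrC _ (w.1 : R)) !(addrC _ (w.2 : R)) !eqxx.
Qed.

Definition disc z : R := \1_[set z : R[i] | modulus z <= 1] z.

Lemma disc_ge0 z : 0 <= disc z.
Proof. by rewrite /disc indicE; case: (_ \in _). Qed.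

Lemma discP z (x y : R) : 0 <= y -> (modulus z <= 1 -> x <= y) -> x * disc z <= y.
Proof.
move=> y0 xy; rewrite /disc indicE; case: (boolP (z \in _)) => [|_]; last by rewrite mulr0.
by rewrite inE => /= /xy; rewrite mulr1.
Qed.

Lemma measurable_disc : measurable_fun setT (fun w : plane R => disc (cplx w)).
Proof.
have mA : measurable [set w : plane R | modulus (cplx w) <= 1].
  have := @measurable_modulus_cplx R measurableT _ (measurable_itv `]-oo, 1%R]).
  by rewrite setTI; congr measurable; apply/seteqP; split => w /=; rewrite in_itv.
by have := @measurable_indic _ _ R setT _ mA; congr measurable_fun.
Qed.

Lemma integrable_disc_moment k :
  integrable leb2 setT (fun w : plane R => (modulus (cplx w) ^+ k * disc (cplx w))%:E).
Proof.
(* On the unit disc [1 <= e * exp (- |z|^2)], so a Gaussian is a majorant. *)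
have i0 := integrableZl measurableT (expR 1) (integrable_moment 0 (@ltr01 R)).
apply: le_integrable i0 => //.
  apply/measurable_EFinP; apply: measurable_funM; last exact: measurable_disc.
  by apply: measurable_funX; exact: measurable_modulus_cplx.
move=> w _; rewrite -EFinM !abse_EFin lee_fin expr0 mul1r.
rewrite (ger0_norm (mulr_ge0 (exprn_ge0 _ (modulus_ge0 _)) (disc_ge0 _))).
apply: le_trans (ler_norm _); apply: discP; first by rewrite mulr_ge0 ?expR_ge0.
move=> w1; rewrite -expRD; apply: (@le_trans _ _ 1); first exact: exprn_ile1.
by rewrite -[leLHS]expR0 ler_expR mul1r subr_ge0 exprn_ile1.
Qed.

Lemma disc_area_gt0 : 0 < \int[leb2]_w disc (cplx (w : plane R)).
Proof.
have := integrable_disc_moment 0; under eq_fun do rewrite expr0 mul1r.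
move=> i; rewrite -lte_fin fineK; last exact: integrable_fin_num.
pose Q := `[0, 2^-1]%classic : set R.
have mQ : measurable (Q `*` Q) by apply: measurableX; exact: measurable_itv.
have : (0 < leb2 (Q `*` Q))%E.
  rewrite product_measure1E//; try exact: measurable_itv.
  have LQ : (0 < @lebesgue_measure R Q)%E.
    by rewrite lebesgue_measure_itv /= lte_fin invr_gt0 ltr0n/= -EFinB lte_fin subr0.
  exact: (mule_gt0 LQ LQ).
move/lt_le_trans; apply; rewrite -[X in leb2 X]setIT -integral_indic//.
apply: ge0_le_integral => //.
- by apply/measurable_EFinP; exact: measurable_indic.
- by apply/measurable_EFinP; exact: measurable_disc.
move=> w _; rewrite lee_fin indicE; case: (boolP (w \in _)) => [|_]; last exact: disc_ge0.
rewrite inE => -[]; rewrite /Q /= !in_itv /= => /andP[a0 a1] /andP[c0 c1].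
have m2 : modulus (cplx w) ^+ 2 <= 1 by rewrite sqr_modulus /=; nra.
have m1 : modulus (cplx w) <= 1 by rewrite -(@expr_le1 _ 2).
by rewrite /disc indicE mem_set.
Qed.

(** The Weyl translate of [f]: the cross term of [|z + u|^2] is absorbed by an exponential that is
    entire in [u], so that the mean value property applies to the weighted function. *)
Lemma modulus_shift_le f (z u : R[i]) :
  modulus (f (z + u) * cexp (- (alpha%:C * u * z^* ))) * expR (- (alpha / 2 * modulus z ^+ 2)) =
  'g[f] (z + u) * expR (alpha / 2 * modulus u ^+ 2).
Proof.
rewrite modulusM modulus_cexp /gauss_modulus -!mulrA -!expRD; congr (_ * expR _).
by rewrite !sqr_modulus; case: z => a b; case: u => c d /=; field.
Qed.

Lemma cdiffable_shift f z : (forall w, cdiffable f w) ->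
  forall u, cdiffable (fun u => f (z + u) * cexp (- (alpha%:C * u * z^* ))) u.
Proof.
move=> df u; apply: cdiffableM.
  apply: cdiffable_comp; first exact: df.
  by apply: cdiffableD; [exact: cdiffable_cst|exact: cdiffable_id].
apply: cdiffable_comp; first exact: cdiffable_cexp.
apply: (@cdiffable_comp _ (fun w => - w) (fun w => alpha%:C * w * z^* )).
  have -> : (fun w : R[i] => - w) = (fun w => (-1) * w) by apply/funext => w; rewrite mulN1r.
  by apply: cdiffableM; [exact: cdiffable_cst|exact: cdiffable_id].
apply: cdiffableM; last exact: cdiffable_cst.
by apply: cdiffableM; [exact: cdiffable_cst|exact: cdiffable_id].
Qed.

Lemma mean_value_disc f : (forall w, cdiffable f w) ->
  plane_int (fun z => f z * (disc z)%:C) = f 0 * (\int[leb2]_w disc (cplx (w : plane R)))%:C.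
Proof.
move=> df; have cf w : ccont f w := cdiffable_cont (df w).
(* A bound on the disc of radius [2] makes the Taylor terms on the unit disc at most [2 M / 2^k]. *)
have [M fM] := ccont_bounded_disc 2 cf.
have M0 : 0 <= M by apply: le_trans (fM 0 _) => //; rewrite modulus0.
have iG : integrable leb2 setT (fun w : plane R => (4 * M * disc (cplx w))%:E).
  have := integrableZl measurableT (4 * M) (integrable_disc_moment 0).
  by apply: eq_integrable => // w _; rewrite expr0 mul1r.
have := @plane_int_coef _ f 0 disc (fun w => 4 * M * disc (cplx w)) df.
rewrite tcoef0// (_ : (fun z => _) = (fun z => f z * (disc z)%:C)); last first.
  by apply/funext => z; rewrite expr0 mulr1.
move=> -> //; first congr (_ * _%:C).
- by apply: eq_Rintegral => w _; rewrite expr0 mul1r.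
- move=> u z u1; rewrite /disc !indicE; congr ((_ : bool)%:R).
  by apply/idP/idP; rewrite !inE /= modulusM u1 mul1r.
- exact: measurable_disc.
- exact: integrable_disc_moment.
move=> N w; rewrite expr0 mul1r; apply: discP.
  by rewrite mulr_ge0 ?disc_ge0// mulr_ge0.
move=> w1; rewrite /disc indicE mem_set// mulr1.
apply: (@le_trans _ _ (\sum_(k < N) 2 * M * (2^-1) ^+ k)).
  apply: ler_sum => k _; have K : modulus (tcoef f k) * 2 ^+ k <= 2 * M.
    by apply: tcoef_le => // z z2; apply: fM; rewrite z2.
  rewrite exprVn ler_pdivlMr ?exprn_gt0//; apply: le_trans K.
  by rewrite mulrAC ler_piMr ?mulr_ge0 ?exprn_ge0// exprn_ile1.
rewrite -mulr_sumr; apply: le_trans (ler_wpM2l _ (geometric_sum_le N _ _)) _; try lra.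
by apply: eq_ler; field.
Qed.

Lemma le_1_powR (x r : R) : 0 <= x -> 1 <= r -> x <= 1 + x `^ r.
Proof.
move=> x0 r1; have [x1|x1] := leP x 1; first by have := powR_ge0 x r; lra.
have := ler_powR (ltW x1) r1; rewrite powRr1//; lra.
Qed.

(** Point evaluations are bounded: the Weyl translate is averaged over the unit disc around [z], on
    which the factor [expR (alpha / 2 * modulus u ^+ 2)] is harmless. *)
Lemma gauss_modulus_le r : 1 <= r -> exists2 C : R, 0 < C & forall f N, entire f ->
  0 < N -> (Fock_norm alpha r%:E f <= N%:E)%E -> forall z, 'g[f] z <= C * N.
Proof.
move=> r1; have r0 : 0 < r by exact: lt_le_trans r1.
set A := \int[leb2]_w disc (cplx (w : plane R)).
have A0 : 0 < A := disc_area_gt0.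
have k0 := Fock_cst_gt0 r0.
pose C := 2 * expR (alpha / 2) * (A + (Fock_cst r)^-1) / A.
exists C.
  by rewrite /C divr_gt0// mulr_gt0 ?addr_gt0 ?invr_gt0// mulr_gt0 ?expR_gt0.
move=> f N /entire_cdiffable df N0 fN z.
have [ig Ig] := integrable_gauss_modulus df r0 (ltW N0) fN.
pose h u := f (z + u) * cexp (- (alpha%:C * u * z^* )).
have dh : forall u, cdiffable h u by exact: cdiffable_shift.
have [mG IG] := integral_gauss_shift r z df.
have [G GE] : exists G, G = (fun w => 'g[f] (z + cplx w) `^ r) by eexists; reflexivity.
have GE' w : 'g[f] (z + cplx w) `^ r = G w by rewrite GE.
have G0 w : 0 <= G w by rewrite -GE' powR_ge0.
move: mG; rewrite -GE => mG.
have {}IG : (\int[leb2]_w (G w)%:E = \int[leb2]_w ('g[f] (cplx w) `^ r)%:E)%E.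
  by rewrite -IG; apply: eq_integral => w _; rewrite GE'.
have iG : integrable leb2 setT (EFin \o G).
  apply: integrable_nneg => //; rewrite IG.
  by apply: le_lt_trans (gauss_integral_le r0 (ltW N0) fN) _; rewrite ltry.
pose K := expR (alpha / 2 * modulus z ^+ 2) * expR (alpha / 2) * N.
have K0 : 0 <= K by rewrite /K !mulr_ge0 ?expR_ge0// ltW.
(* After division by [N], the inequality [x <= 1 + x^r] of [le_1_powR] does the work of Hoelder's
   inequality on the disc. *)
pose H w := K * (disc (cplx w) + N `^ (- r) * G w).
have iD : integrable leb2 setT (EFin \o (fun w : plane R => disc (cplx w))).
  by have := integrable_disc_moment 0; apply: eq_integrable => // w _; rewrite expr0 mul1r.
have iNG : integrable leb2 setT (EFin \o (fun w => N `^ (- r) * G w)).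
  by have := integrableZl measurableT (N `^ (- r)) iG; apply: eq_integrable.
have iDG : integrable leb2 setT (EFin \o (fun w => disc (cplx w) + N `^ (- r) * G w)).
  by have := integrableD measurableT iD iNG; apply: eq_integrable.
have iH : integrable leb2 setT (EFin \o H).
  by have := integrableZl measurableT K iDG; apply: eq_integrable.
have hH w : setT w -> modulus (h (cplx w) * (disc (cplx w))%:C) <= H w.
  move=> _; rewrite modulusM modulus_real (ger0_norm (disc_ge0 _)).
  set u := cplx w.
  have hE := modulus_shift_le f z u.
  have {}hE : modulus (h u) = 'g[f] (z + u) * expR (alpha / 2 * modulus u ^+ 2) *
      expR (alpha / 2 * modulus z ^+ 2).
    by rewrite -hE -[RHS]mulrA -expRD addNr expR0 mulr1.
  have NG0 : 0 <= N `^ (- r) * G w by rewrite mulr_ge0 ?powR_ge0.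
  apply: discP; first by rewrite mulr_ge0// addr_ge0 ?disc_ge0.
  move=> u1; rewrite /H /disc indicE mem_set// hE /K.
  have u2 : expR (alpha / 2 * modulus u ^+ 2) <= expR (alpha / 2).
    by rewrite ler_expR ler_piMr ?exprn_ile1// divr_ge0 ?ltW.
  have g2 : 'g[f] (z + u) <= N * (1 + N `^ (- r) * G w).
    have := le_1_powR (divr_ge0 (gauss_modulus_ge0 f (z + u)) (ltW N0)) r1.
    rewrite ler_pdivrMr// mulrC powRM ?gauss_modulus_ge0 ?invr_ge0 ?(ltW N0)//.
    by rewrite GE' -powR_inv1 ?(ltW N0)// -powRrM mulN1r [_ * N `^ _]mulrC.
  have := ler_pM (gauss_modulus_ge0 f (z + u)) (expR_ge0 _) g2 u2.
  move/(ler_wpM2r (expR_ge0 (alpha / 2 * modulus z ^+ 2))) => /le_trans; apply.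
  rewrite -[true%:R]/(1 : R); move: (N `^ _) (expR _) (expR _) (G w) => a b c d.
  by apply: eq_ler; ring.
have mh : cmeas setT (fun w => h (cplx w) * (disc (cplx w))%:C).
  by apply: cmeasM; [exact: cmeas_entire|apply: cmeas_real; exact: measurable_disc].
have := modulus_integralC_le measurableT mh iH hH.
rewrite -[integralC _ _ _]/(plane_int (fun z => h z * (disc z)%:C)) mean_value_disc//.
rewrite modulusM modulus_real -/A (ger0_norm (ltW A0)).
have -> : modulus (h 0) = modulus (f z).
  by rewrite /h addr0 mulr0 mul0r oppr0 cexp0 mulr1.
have -> : \int[leb2]_w H w = K * (A + N `^ (- r) * \int[leb2]_w G w).
  by rewrite /H RintegralZl// RintegralD// RintegralZl.
have -> : \int[leb2]_w G w = \int[leb2]_w ('g[f] (cplx w) `^ r) by congr fine.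
have : N `^ (- r) * \int[leb2]_w ('g[f] (cplx w) `^ r) <= (Fock_cst r)^-1.
  apply: le_trans (ler_wpM2l (powR_ge0 _ _) Ig) _.
  by rewrite mulrA powRN mulVf ?mul1r// gt_eqF// powR_gt0.
move=> I1 I2; rewrite /C mulrAC ler_pdivlMr// mulrAC.
have : modulus (f z) * A <= 2 * (K * (A + (Fock_cst r)^-1)).
  by apply: le_trans I2 _; rewrite ler_pM2l// ler_wpM2l// lerD2l.
move/(ler_wpM2r (expR_ge0 (- (alpha / 2 * modulus z ^+ 2)))) => /le_trans; apply.
have E1 : expR (alpha / 2 * modulus z ^+ 2) * expR (- (alpha / 2 * modulus z ^+ 2)) = 1.
  by rewrite -expRD subrr expR0.
rewrite /K; apply: eq_ler.
transitivity (2 * expR (alpha / 2) * (A + (Fock_cst r)^-1) * N *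
  (expR (alpha / 2 * modulus z ^+ 2) * expR (- (alpha / 2 * modulus z ^+ 2)))); first ring.
by rewrite E1 mulr1.
Qed.

End FockSpaces.

(** * Size of the Taylor coefficients in Fock spaces *)

Section FockCoefficients.
Context {R : realType}.
Variable alpha : R.
Hypothesis alpha_gt0 : 0 < alpha.
Implicit Types (f g : R[i] -> R[i]) (z : R[i]) (N r : R).

Local Notation "'g[ f ]" := (gauss_modulus alpha f) (at level 0, format "''g[' f ]").
Local Notation V n := (gauss_moment alpha n.*2).
Local Notation T n := (gauss_moment (alpha / 2) n).

Lemma Fock_norm_infP f N : (Fock_norm alpha +oo f <= N%:E)%E <-> forall z, 'g[f] z <= N.
Proof.
split=> [H z|H].
  rewrite -lee_fin; apply: le_trans H; apply: ereal_sup_ubound; by exists z.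
by apply: ge_ereal_sup => _ [z _ <-]; rewrite lee_fin.
Qed.

Lemma Fock_gauss_le (q : \bar R) : (1 <= q)%E -> exists2 C : R, 0 < C & forall f N,
  entire f -> 0 < N -> (Fock_norm alpha q f <= N%:E)%E -> forall z, 'g[f] z <= C * N.
Proof.
case: q => [r| |//]; first by rewrite lee_fin; exact: gauss_modulus_le.
by move=> _; exists 1 => // f N ef N0 /Fock_norm_infP H z; rewrite mul1r.
Qed.

(** Cauchy's estimate on the circle of radius [r = sqrt (1 + |z|^2)]: the larger radius costs only
    the factor [expR (alpha / 2)], while the geometric series of ratio [|z| / r] sums to at most
    [2 r^2]. The result is still integrable against [exp (- alpha |z|^2)]. *)
Lemma tcoef_gauss_sum_le f (K : R) m z : (forall z, cdiffable f z) -> 0 <= K ->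
  (forall z, 'g[f] z <= K) -> \sum_(k < m) modulus (tcoef f k) * modulus z ^+ k <=
  4 * K * expR (alpha / 2) * (1 + modulus z ^+ 2) * expR (alpha / 2 * modulus z ^+ 2).
Proof.
move=> df K0 fK; set s := modulus z; have s0 : 0 <= s by exact: modulus_ge0.
pose r := Num.sqrt (1 + s ^+ 2); have s20 : 0 <= s ^+ 2 by exact: sqr_ge0.
have r2 : r ^+ 2 = 1 + s ^+ 2 by rewrite sqr_sqrtr// addr_ge0.
have r0 : 0 < r by rewrite sqrtr_gt0 ltr_pwDl.
have sr : s < r by rewrite -(@ltr_pXn2r _ 2) ?nnegrE ?(ltW r0)// r2 ltrDr.
set E := expR (alpha / 2 * r ^+ 2).
have E0 : 0 <= E by exact: expR_ge0.
have cb k : modulus (tcoef f k) * r ^+ k <= 2 * (K * E).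
  apply: tcoef_le => // w wr; have := fK w; rewrite /gauss_modulus wr => H.
  rewrite -[leLHS]mulr1 -(expR0 R) -(subrr (alpha / 2 * r ^+ 2)) expRD mulrCA mulrC.
  by apply: ler_wpM2r.
apply: (@le_trans _ _ (\sum_(k < m) 2 * (K * E) * (s / r) ^+ k)).
  apply: ler_sum => k _; rewrite expr_div_n [leRHS]mulrA ler_pdivlMr ?exprn_gt0// mulrAC.
  by apply: ler_wpM2r; rewrite ?exprn_ge0.
have q1 : s / r < 1 by rewrite ltr_pdivrMr// mul1r.
have KE : 0 <= 2 * (K * E) by rewrite !mulr_ge0.
rewrite -mulr_sumr; apply: le_trans (ler_wpM2l KE (geometric_sum_le _ _ q1)) _.
  by rewrite divr_ge0// ltW.
have G : (1 - s / r)^-1 <= 2 * (1 + s ^+ 2).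
  rewrite -[leLHS]div1r ler_pdivrMr ?subr_gt0// -r2.
  have -> : 2 * r ^+ 2 * (1 - s / r) = 2 * (r ^+ 2 - r * s) by field; rewrite gt_eqF.
  have : (r - s) ^+ 2 >= 0 by exact: sqr_ge0.
  by rewrite sqrrB; lra.
apply: le_trans (ler_wpM2l KE G) _; rewrite /E r2 mulrDr mulr1 expRD.
by apply: eq_ler; ring.
Qed.

(** [plane_int_coef] for the Gaussian weight. The bound [K] only justifies exchanging sum and
    integral; the estimate comes from [H], kept free so that finite and infinite exponents can each
    bring their own. *)
Lemma tcoef_moment_le f (K : R) n (H : plane R -> R) : (forall z, cdiffable f z) -> 0 <= K ->
  (forall z, 'g[f] z <= K) -> integrable leb2 setT (EFin \o H) ->
  (forall w, 'g[f] (cplx w) * (modulus (cplx w) ^+ n * gauss2 (alpha / 2) w) <= H w) ->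
  modulus (tcoef f n) * V n <= 2 * \int[leb2]_w H w.
Proof.
move=> df K0 fK iH fH; have a20 : 0 < alpha / 2 by rewrite divr_gt0.
pose W z := expR (- (alpha * modulus z ^+ 2)).
have WE (w : plane R) : W (cplx w) = gauss2 (alpha / 2) w * gauss2 (alpha / 2) w.
  by rewrite /gauss2 -expRD /W; congr expR; field.
pose c := 4 * K * expR (alpha / 2).
pose G (w : plane R) := c * (modulus (cplx w) ^+ n * gauss2 (alpha / 2) w +
  modulus (cplx w) ^+ n.+2 * gauss2 (alpha / 2) w).
have iG : integrable leb2 setT (EFin \o G).
  have := integrableZl measurableT c
    (integrableD measurableT (integrable_moment n a20) (integrable_moment n.+2 a20)).
  by apply: eq_integrable.
have mf := cmeas_entire df.
have mW : measurable_fun setT (fun w => W (cplx w)) by exact: measurable_gauss2.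
have := @plane_int_coef _ f n W G df.
move=> -/(_ _ _ mW _ iG) coef.
have {}coef : plane_int (fun z => f z * z^* ^+ n * (W z)%:C) = tcoef f n * (V n)%:C.
  apply: coef.
  - by move=> u z u1; rewrite /W modulusM u1 mul1r.
  - by move=> z; exact: expR_ge0.
  - by move=> k; exact: integrable_moment.
  move=> N w; have := tcoef_gauss_sum_le N (cplx w) df K0 fK; rewrite WE.
  set u := modulus (cplx w); set S := \sum_(_ < _) _ => SP.
  have E1 : expR (alpha / 2 * u ^+ 2) * gauss2 (alpha / 2) w = 1.
    by rewrite -expRD subrr expR0.
  have U0 : 0 <= u ^+ n * (gauss2 (alpha / 2) w * gauss2 (alpha / 2) w).
    have g0 : 0 <= gauss2 (alpha / 2) w by exact: expR_ge0.
    by apply: mulr_ge0; [apply: exprn_ge0; exact: modulus_ge0|exact: mulr_ge0].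
  apply: le_trans (ler_wpM2r U0 SP) _; apply: eq_ler.
  rewrite /G -/u -(add2n n) exprD /c.
  transitivity (4 * K * expR (alpha / 2) * (1 + u ^+ 2) *
    u ^+ n * gauss2 (alpha / 2) w * (expR (alpha / 2 * u ^+ 2) * gauss2 (alpha / 2) w)).
    by move: (expR _) (expR _) (gauss2 _ _) (u ^+ n) => a b d e; ring.
  by rewrite E1; move: (expR _) (gauss2 _ _) (u ^+ n) (u ^+ 2) => a b d e; ring.
have mF : cmeas setT (fun w => f (cplx w) * (cplx w)^* ^+ n * (W (cplx w))%:C).
  apply: cmeasM; last exact: cmeas_real.
  apply: cmeasM => //; apply: cmeasX; apply: cmeas_conj; exact: cmeas_cplx.
have := modulus_integralC_le measurableT mF iH.
rewrite -[integralC _ _ _]/(plane_int (fun z => f z * z^* ^+ n * (W z)%:C)) coef.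
rewrite modulusM modulus_real (ger0_norm (gauss_moment_ge0 _ _)); apply.
move=> w _; rewrite !modulusM modulusX modulus_conj modulus_real ger0_norm ?expR_ge0//.
apply: le_trans (fH w); rewrite gauss_modulusE WE; apply: eq_ler.
by move: (modulus _) (gauss2 _ _) (_ ^+ n) => a b d; ring.
Qed.

(** From [x^p <= x + x^2]: an [L^p] norm of a monomial is controlled by its [L^1] and [L^2] norms,
    at a scale [l] to be chosen. *)
Lemma powR_interpolate (p l t : R) : 1 <= p -> p <= 2 -> 0 < l -> 0 <= t ->
  t `^ p <= l `^ p * (t / l + (t / l) ^+ 2).
Proof.
move=> p1 p2 l0 t0; set x := t / l.
have x0 : 0 <= x by rewrite divr_ge0// ltW.
have -> : t = l * x by rewrite /x mulrC divfK// gt_eqF.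
rewrite powRM ?(ltW l0)//; apply: ler_wpM2l; first exact: powR_ge0.
have [x1|x1] := leP x 1.
  have [->|xn0] := eqVneq x 0; first by rewrite powR0 ?expr0n ?addr0// gt_eqF// (lt_le_trans _ p1).
  have xp : 0 < x by rewrite lt_neqAle eq_sym xn0.
  apply: (@le_trans _ _ x); last by rewrite lerDl exprn_ge0.
  by rewrite -[leRHS](@powRr1 _ x)// ger_powR// xp.
have := ler_powR (ltW x1) p2.
by rewrite powR_mulrn ?(ltW (lt_trans ltr01 x1))// => /le_trans; apply; rewrite lerDr.
Qed.

(** The power of [n + 1] is the ratio of the weighted [L^p] and [L^2] norms of [z^n]: [T n] and
    [V n] are its [L^1] norm and squared [L^2] norm, and [TP] compares them. *)
Lemma tcoef_Fock_le (p : R) (q : \bar R) : 1 <= p -> p <= 2 -> (p%:E^-1 + q^-1 = 1)%E ->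
  (1 <= q)%E -> exists2 C : R, 0 < C & forall f N n, entire f -> 0 < N ->
  (Fock_norm alpha q f <= N%:E)%E ->
  modulus (tcoef f n) * Num.sqrt (V n) <= C * n.+1%:R `^ (p^-1 - 2^-1) * N.
Proof.
move=> p1 p2 pq q1; have p0 : 0 < p by exact: lt_le_trans p1.
have a20 : 0 < alpha / 2 by rewrite divr_gt0.
have [D D0 DP] := Fock_gauss_le q1.
pose C1 := T 0 / Num.sqrt (V 0).
have V00 : 0 < V 0 by exact: gauss_moment_gt0.
have C10 : 0 <= C1 by rewrite divr_ge0 ?sqrtr_ge0 ?gauss_moment_ge0.
have VR n : Num.sqrt (V n) ^+ 2 = V n by rewrite sqr_sqrtr// gauss_moment_ge0.
have TP n : T n <= C1 * (Num.sqrt (V n) * Num.sqrt n.+1%:R).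
  rewrite -(@ler_pXn2r _ 2) ?nnegrE ?gauss_moment_ge0//; last first.
    by rewrite mulr_ge0// mulr_ge0 ?sqrtr_ge0.
  rewrite !exprMn exprVn !VR sqr_sqrtr// mulrAC ler_pdivlMr//.
  by have := gauss_moment_half_le n alpha_gt0; rewrite [V n * _]mulrC.
have n0 n : (0 : R) < n.+1%:R by rewrite ltr0n.
have sn0 n : 0 < Num.sqrt (V n) by rewrite sqrtr_gt0 gauss_moment_gt0.
have half n : n.+1%:R `^ (2^-1 : R) = Num.sqrt n.+1%:R :> R by rewrite powR12_sqrt.
suff [C C0 CP] : exists2 C : R, 0 < C & forall f N n, entire f -> 0 < N ->
    (Fock_norm alpha q f <= N%:E)%E ->
    modulus (tcoef f n) * V n <= C * N * (Num.sqrt (V n) * n.+1%:R `^ (p^-1 - 2^-1)).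
  exists C => // f N n ef N0 fN; have := CP f N n ef N0 fN.
  rewrite -{1}(VR n) expr2 mulrA => H.
  rewrite -(ler_pM2r (sn0 n)); apply: le_trans H _; apply: eq_ler; ring.
case: q pq q1 DP => [r| |//]; last first.
  rewrite invey adde0 => pE q1 DP.
  have {}p1 : p = 1.
    have : (p^-1)%:E = 1%E :> \bar R by rewrite -pE inver gt_eqF.
    by move=> -[] /(congr1 GRing.inv); rewrite invrK invr1.
  exists (2 * C1 + 1); first lra.
  move=> f N n ef N0 fN; have df := entire_cdiffable ef.
  have fN' := (Fock_norm_infP f N).1 fN.
  have iH : integrable leb2 setT (EFin \o (fun w => N * (modulus (cplx w) ^+ n * gauss2 (alpha / 2) w))).
    by have := integrableZl measurableT N (integrable_moment n a20); apply: eq_integrable.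
  have := @tcoef_moment_le f N n _ df (ltW N0) fN' iH.
  move=> H; apply: le_trans (H _) _.
    by move=> w; apply: ler_wpM2r => //; rewrite mulr_ge0 ?expR_ge0 ?exprn_ge0.
  rewrite RintegralZl//; last exact: integrable_moment.
  rewrite p1 invr1 (_ : 1 - 2^-1 = 2^-1 :> R); last by field.
  rewrite half -/(gauss_moment _ _).
  have := ler_wpM2l (ltW N0) (TP n); set X := Num.sqrt _ * _ => Y.
  have X0 : 0 <= X by rewrite mulr_ge0 ?sqrtr_ge0.
  have : 0 <= N * X by rewrite mulr_ge0// ltW.
  by move: Y; rewrite -/(gauss_moment _ _) /gauss_moment; set Z := Rintegral _ _ _; nra.
rewrite lee_fin => pq r1 DP; have r0 : 0 < r by exact: lt_le_trans r1.
have {}pq : p^-1 + r^-1 = 1.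
  by apply: EFin_inj; move: pq; rewrite !inver !gt_eqF.
have k0 := Fock_cst_gt0 alpha_gt0 r0.
exists (2 * ((Fock_cst alpha r)^-1 + C1 + 1)).
  by rewrite mulr_gt0// ltr_wpDl// addr_ge0// invr_ge0 ltW.
move=> f N n ef N0 fN; have df := entire_cdiffable ef.
have [ig Ig] := integrable_gauss_modulus alpha_gt0 df r0 (ltW N0) fN.
(* With this scale [T n / l] and [V n / l^2] are both at most a constant times [n + 1], and [th]
   bounds the [L^p] norm of the monomial up to a constant. *)
pose l := Num.sqrt (V n) / Num.sqrt n.+1%:R.
have sq0 : 0 < Num.sqrt n.+1%:R :> R by rewrite sqrtr_gt0.
have l0 : 0 < l by rewrite divr_gt0.
pose th := l * n.+1%:R `^ p^-1.
have th0 : 0 < th by rewrite mulr_gt0// powR_gt0.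
have thE : Num.sqrt (V n) * n.+1%:R `^ (p^-1 - 2^-1) = th.
  rewrite /th /l powRD; last by apply/implyP => _; rewrite gt_eqF.
  by rewrite powRN half; ring.
have thp : th `^ p = l `^ p * n.+1%:R.
  by rewrite /th powRM ?powR_ge0 ?(ltW l0)// -powRrM mulVf ?gt_eqF// powRr1.
pose t (w : plane R) := modulus (cplx w) ^+ n * gauss2 (alpha / 2) w.
have t0 w : 0 <= t w by rewrite mulr_ge0 ?expR_ge0 ?exprn_ge0.
pose h1 (w : plane R) := 'g[f] (cplx w) `^ r.
pose h2 (w : plane R) := modulus (cplx w) ^+ n.*2 * gauss2 alpha w.
have h2E w : h2 w = t w ^+ 2.
  rewrite /h2 /t exprMn -exprM muln2; congr (_ * _).
  by rewrite expr2 /gauss2 -expRD; congr expR; field.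
pose H w := N * th * (N `^ (- r) * h1 w + n.+1%:R^-1 * (l^-1 * t w + l ^- 2 * h2 w)).
have it : integrable leb2 setT (EFin \o t) by exact: integrable_moment.
have ih2 : integrable leb2 setT (EFin \o h2) by exact: integrable_moment.
have iZ k u := @integrable_realZl R _ (plane R) leb2 setT k u measurableT.
have iD u v := @integrable_realD R _ (plane R) leb2 setT u v measurableT.
have i1 := iZ (N `^ (- r)) _ ig; have i2 := iD _ _ (iZ l^-1 _ it) (iZ (l ^- 2) _ ih2).
have i3 := iD _ _ i1 (iZ n.+1%:R^-1 _ i2).
have iH : integrable leb2 setT (EFin \o H) by exact: iZ.
have K0 : 0 <= D * N by rewrite mulr_ge0 ?ltW.
have HP w : 'g[f] (cplx w) * (modulus (cplx w) ^+ n * gauss2 (alpha / 2) w) <= H w.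
  rewrite -/(t w); set a := 'g[f] (cplx w); have a0 : 0 <= a by exact: gauss_modulus_ge0.
  have qp : r^-1 + p^-1 = 1 by rewrite addrC.
  (* Young's inequality for factors divided by the sizes of their norms: integrated, it is Hoelder's
     inequality. *)
  have := conjugate_powR (divr_ge0 a0 (ltW N0)) (divr_ge0 (t0 w) (ltW th0)) r0 p0 qp.
  have -> : a / N * (t w / th) = a * t w / (N * th) by rewrite mulrACA -invfM.
  rewrite ler_pdivrMr ?mulr_gt0// => /le_trans; apply; rewrite [leLHS]mulrC.
  apply: ler_wpM2l; first by rewrite mulr_ge0 ?ltW.
  have vV (x y : R) : 0 <= x -> 1 <= y -> x / y <= x.
    by move=> x0 y1; rewrite ler_piMr// invf_le1// (lt_le_trans _ y1).
  apply: lerD.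
    apply: le_trans (vV _ _ (powR_ge0 _ _) r1) _; rewrite powRM ?invr_ge0 ?(ltW N0)//.
    by rewrite -(powR_inv1 (ltW N0)) -powRrM mulN1r mulrC.
  apply: le_trans (vV _ _ (powR_ge0 _ _) p1) _; rewrite powRM ?invr_ge0 ?(ltW th0)//.
  rewrite -(powR_inv1 (ltW th0)) -powRrM mulN1r powRN thp ler_pdivrMr ?mulr_gt0 ?powR_gt0//.
  apply: le_trans (powR_interpolate p1 p2 l0 (t0 w)) _; apply: eq_ler.
  by rewrite h2E; field; rewrite !gt_eqF.
have := tcoef_moment_le df K0 (DP f N ef N0 fN) iH HP.
move=> /le_trans; apply; rewrite thE.
have -> : \int[leb2]_w H w = N * th * (N `^ (- r) * (\int[leb2]_w h1 w) +
    n.+1%:R^-1 * (l^-1 * T n + l ^- 2 * V n)).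
  rewrite /H RintegralZl//; congr (_ * _); rewrite RintegralD//; last exact: iZ.
  rewrite !RintegralZl//; congr (_ + _ * _); rewrite RintegralD//; try exact: iZ.
  by rewrite !RintegralZl.
have j1 : N `^ (- r) * (\int[leb2]_w h1 w) <= (Fock_cst alpha r)^-1.
  apply: le_trans (ler_wpM2l (powR_ge0 _ _) Ig) _.
  by rewrite mulrA powRN mulVf ?mul1r// gt_eqF// powR_gt0.
have ln : l * n.+1%:R = Num.sqrt (V n) * Num.sqrt n.+1%:R.
  by rewrite /l -{2}[n.+1%:R](@sqr_sqrtr R) ?ltW//; field; rewrite gt_eqF.
have l2 : V n = l ^+ 2 * n.+1%:R.
  by rewrite /l expr_div_n VR sqr_sqrtr ?ltW// divfK// gt_eqF.
have j2 : n.+1%:R^-1 * (l^-1 * T n + l ^- 2 * V n) <= C1 + 1.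
  rewrite mulrC ler_pdivrMr//; have := TP n; rewrite -ln => H1.
  have -> : l ^- 2 * V n = n.+1%:R by rewrite l2; field; rewrite gt_eqF.
  rewrite mulrDl mul1r lerD2r mulrC ler_pdivrMr//; apply: le_trans H1 _.
  by apply: eq_ler; ring.
have NT : 0 <= N * th by rewrite mulr_ge0 ?ltW.
have := ler_wpM2l NT (lerD j1 j2).
by move: (_^-1) (_ * _ + _) => a b; nra.
Qed.

End FockCoefficients.

(** * Power series with square-summable weighted coefficients *)

Section PowerSeries.
Context {R : realType}.
Implicit Types (f : R[i] -> R[i]) (z h : R[i]) (c d : nat -> R[i]).

Lemma geometric_ccvg d (M : R) : (forall n, modulus (d n) <= M / 2 ^+ n) ->
  exists l, ccvg (fun N => \sum_(k < N) d k) l.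
Proof.
move=> dM; have M0 : 0 <= M by have := dM 0; rewrite expr0 divr1; apply: le_trans.
have cg : cvgn (series (geometric M (2^-1 : R))).
  by apply: is_cvg_geometric_series; rewrite ger0_norm ?invr_ge0// invf_lt1// ltr1n.
have cv (u : R ^nat) : (forall n, `|u n| <= M / 2 ^+ n) -> cvgn (series u).
  move=> uM; apply: normed_cvg; apply: series_le_cvg cg => n; first exact: normr_ge0.
    by apply: mulr_ge0 => //; apply: exprn_ge0; rewrite invr_ge0.
  by have := uM n; rewrite -exprVn.
have cr := cv (fun n => complex.Re (d n)) (fun n => le_trans (Re_le_modulus _) (dM n)).
have ci := cv (fun n => complex.Im (d n)) (fun n => le_trans (Im_le_modulus _) (dM n)).
exists (Complex (limn (series (fun n => complex.Re (d n)))) (limn (series (fun n => complex.Im (d n))))).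
apply: ccvgP => /=.
- have -> : (fun n => complex.Re (\sum_(k < n) d k)) = series (fun n => complex.Re (d n)).
    by apply/funext => n; rewrite cRe_sum /series /= big_mkord.
  exact: cr.
- have -> : (fun n => complex.Im (\sum_(k < n) d k)) = series (fun n => complex.Im (d n)).
    by apply/funext => n; rewrite cIm_sum /series /= big_mkord.
  exact: ci.
Qed.

(** The base [4 (|z| + 1)] is generous so that its powers absorb the factor [n] of the derivative
    and the induction closes. *)
Lemma pow_increment_le z h n : modulus h <= 1 ->
  modulus ((z + h) ^+ n - z ^+ n - n%:R * z ^+ n.-1 * h) <=
  modulus h ^+ 2 * (4 * (modulus z + 1)) ^+ n.
Proof.
move=> h1; set B := modulus z + 1; have z0 := modulus_ge0 z; have h0 := modulus_ge0 h.
have B1 : 1 <= B by rewrite /B lerDr.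
have B0 : 0 <= B by exact: le_trans B1.
elim: n => [|n ih].
  by rewrite !expr0 mul0r mul0r subrr subr0 modulus0 mulr1 exprn_ge0.
have -> : (z + h) ^+ n.+1 - z ^+ n.+1 - n.+1%:R * z ^+ n.+1.-1 * h =
   (z + h) * ((z + h) ^+ n - z ^+ n - n%:R * z ^+ n.-1 * h) + n%:R * z ^+ n.-1 * h ^+ 2.
  case: n {ih} => [|n]; first by rewrite !expr0 expr1 !mul0r; ring.
  rewrite -[n.+2.-1]/n.+1 -[n.+1.-1]/n -(natr1 n.+1) !(exprS _ n.+1) !(exprS _ n).
  by move: (z ^+ n) ((z + h) ^+ n) (n.+1%:R : R[i]) => a b e; ring.
apply: le_trans (ler_modulusD _ _) _;
rewrite (modulusM (z + h)) (modulusM (_ * _) (h ^+ 2)) (modulusM n%:R) !modulusX.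
have A0 : 0 <= modulus h ^+ 2 * (4 * B) ^+ n by rewrite mulr_ge0 ?exprn_ge0 ?mulr_ge0.
have H1 : modulus (z + h) <= B by apply: le_trans (ler_modulusD _ _) _; rewrite lerD2l.
have H2 : modulus (n%:R : R[i]) * modulus z ^+ n.-1 <= (4 * B) ^+ n.
  rewrite (_ : modulus (n%:R : R[i]) = n%:R); last first.
    by rewrite -(rmorph_nat (real_complex R)) modulus_real ger0_norm.
  rewrite exprMn; apply: ler_pM; rewrite ?exprn_ge0//.
    by rewrite -natrX ler_nat ltnW// ltn_expl.
  apply: (@le_trans _ _ (B ^+ n.-1)); first by rewrite lerXn2r ?nnegrE// /B lerDl.
  by rewrite ler_weXn2l// leq_pred.
apply: (@le_trans _ _ (B * (modulus h ^+ 2 * (4 * B) ^+ n) + (4 * B) ^+ n * modulus h ^+ 2)).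
  by apply: lerD; [exact: ler_pM|apply: ler_wpM2r => //; exact: exprn_ge0].
rewrite (exprS (4 * B)); set P := (4 * B) ^+ n; set Q := modulus h ^+ 2.
have -> : B * (Q * P) + P * Q = (B + 1) * (Q * P) by ring.
have -> : Q * (4 * B * P) = (4 * B) * (Q * P) by ring.
by apply: ler_wpM2r => //; lra.
Qed.

(** Termwise differentiation: by [pow_increment_le] the remainder is at most [|h|^2] times the sum
    of [|c_k| A^k], and the hypothesis at radius [2 A] makes that sum geometric. *)
Lemma cdiffable_power_series c f :
  (forall r : R, 0 <= r -> exists M : R, forall n, modulus (c n) * r ^+ n <= M) ->
  (forall z, ccvg (fun N => \sum_(k < N) c k * z ^+ k) (f z)) ->
  forall z, cdiffable f z.
Proof.
move=> cM cf z; pose B := modulus z + 1; pose A := 4 * B.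
have B1 : 1 <= B by rewrite /B lerDr.
have B0 : 0 <= B by exact: le_trans B1.
have A0 : 0 <= A by rewrite mulr_ge0.
have [M MP] := cM (2 * A) (mulr_ge0 (ler0n R 2) A0).
have M0 : 0 <= M by have := MP 0; rewrite expr0 mulr1; apply: le_trans.
have cA n : modulus (c n) * A ^+ n <= M / 2 ^+ n.
  by rewrite ler_pdivlMr ?exprn_gt0// -mulrA -exprMn mulrC [A * 2]mulrC mulrC.
have [l lP] : exists l, ccvg (fun N => \sum_(k < N) c k * (k%:R * z ^+ k.-1)) l.
  apply: (@geometric_ccvg (fun k => c k * (k%:R * z ^+ k.-1)) M) => n.
  apply: le_trans (cA n); rewrite modulusM; apply: ler_wpM2l => //.
  rewrite modulusM modulusX (_ : modulus (n%:R : R[i]) = n%:R); last first.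
    by rewrite -(rmorph_nat (real_complex R)) modulus_real ger0_norm.
  rewrite /A exprMn; apply: ler_pM; rewrite ?exprn_ge0//.
    by rewrite -natrX ler_nat ltnW// ltn_expl.
  apply: (@le_trans _ _ (B ^+ n.-1)); first by rewrite lerXn2r ?nnegrE// /B lerDl.
  by rewrite ler_weXn2l// leq_pred.
exists l => e e0; pose K := 2 * M + 1; have K0 : 0 < K by rewrite ltr_wpDl// mulr_ge0.
exists (Num.min 1 (e / K)); first by rewrite lt_min ltr01 divr_gt0.
move=> h; rewrite le_min => /andP[h1 he].
apply: (@le_trans _ _ (modulus h ^+ 2 * (2 * M))); last first.
  rewrite expr2 -mulrA [leRHS]mulrC; apply: ler_wpM2l => //.
  by move: he; rewrite ler_pdivlMr//; apply: le_trans; apply: ler_wpM2l; rewrite // /K lerDl.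
pose E k := (z + h) ^+ k - z ^+ k - k%:R * z ^+ k.-1 * h.
apply: (@ccvg_modulus_le _ (fun N => \sum_(k < N) c k * E k)).
  have := ccvgD (ccvgD (cf (z + h)) (ccvgZ (-1) (cf z))) (ccvgZ (- h) lP).
  rewrite (_ : _ + _ + _ = f (z + h) - f z - l * h); last by ring.
  apply: eq_ccvg => N; rewrite !mulr_sumr -!big_split; apply: eq_bigr => k _.
  by rewrite /E /=; ring.
move=> N; apply: le_trans (ler_modulus_sum _ _ _) _.
apply: (@le_trans _ _ (\sum_(k < N) modulus h ^+ 2 * M * 2^-1 ^+ k)).
  apply: ler_sum => k _; rewrite modulusM -mulrA exprVn.
  apply: le_trans (ler_wpM2l (modulus_ge0 _) (pow_increment_le z k h1)) _.
  by rewrite mulrCA; apply: ler_wpM2l (cA k); exact: exprn_ge0.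
rewrite -mulr_sumr; have MM : 0 <= modulus h ^+ 2 * M by rewrite mulr_ge0 ?exprn_ge0.
apply: le_trans (ler_wpM2l MM (geometric_sum_le N _ _)) _; try lra.
by apply: eq_ler; field.
Qed.

Lemma expR_sum_le (x : R) N : 0 <= x -> \sum_(k < N) x ^+ k / k`!%:R <= expR x.
Proof.
move=> x0; have -> : \sum_(k < N) x ^+ k / k`!%:R = series (exp_coeff x) N.
  rewrite /series /= big_mkord exp_coeffE.
  by apply: eq_bigr => k _; rewrite mulrC.
apply: nondecreasing_cvgn_le; last exact: is_cvg_series_exp_coeff.
apply: nondecreasing_series => n _ _; exact: exp_coeff_ge0.
Qed.

Variable alpha : R.
Hypothesis alpha_gt0 : 0 < alpha.
Local Notation "'g[ f ]" := (gauss_modulus alpha f) (at level 0, format "''g[' f ]").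
Local Notation V n := (gauss_moment alpha n.*2).
Local Notation P c N z := (\sum_(k < N) c k * z ^+ k).

Let W z := expR (- (alpha * modulus z ^+ 2)).

Let V_gt0 n : 0 < V n. Proof. exact: gauss_moment_gt0. Qed.

(** A partial sum of the reproducing kernel on the diagonal: [V k = k! V 0 / alpha^k]. *)
Lemma moment_exp_le (s : R) N : 0 <= s ->
  \sum_(k < N) s ^+ k.*2 / V k <= expR (alpha * s ^+ 2) / V 0.
Proof.
move=> s0; have a0 : 0 <= alpha * s ^+ 2 by rewrite mulr_ge0 ?sqr_ge0// ltW.
apply: le_trans (ler_wpM2r _ (expR_sum_le N a0)); last by rewrite invr_ge0 ltW.
rewrite mulr_suml; apply: ler_sum => k _; apply: eq_ler.
have := gauss_moment_fact k alpha_gt0 => E.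
have ak : alpha ^+ k != 0 by rewrite expf_neq0// gt_eqF.
have -> : V k = k`!%:R * V 0 / alpha ^+ k by rewrite -E mulfK.
rewrite exprMn -exprM mul2n; field.
by rewrite ak !gt_eqF// ltr0n fact_gt0.
Qed.

(** Cauchy-Schwarz against [moment_exp_le], written as an arithmetic-geometric mean inequality whose
    weight [t = S / B] bounds both sums by [S * B]. *)
Lemma coef_sum_le c (B : R) N (s : R) : 0 < B -> 0 <= s ->
  \sum_(k < N) modulus (c k) ^+ 2 * V k <= B ^+ 2 ->
  \sum_(k < N) modulus (c k) * s ^+ k <= B * expR (alpha / 2 * s ^+ 2) / Num.sqrt (V 0).
Proof.
move=> B0 s0 cB; set S := expR (alpha / 2 * s ^+ 2) / Num.sqrt (V 0).
have S0 : 0 < S by rewrite divr_gt0 ?expR_gt0// sqrtr_gt0.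
have S2 : S ^+ 2 = expR (alpha * s ^+ 2) / V 0.
  by rewrite expr_div_n (sqr_sqrtr (ltW (V_gt0 0))) expr2 -expRD; congr (expR _ / _); field.
pose t := S / B; have t0 : 0 < t by rewrite divr_gt0.
apply: (@le_trans _ _ (\sum_(k < N) 2^-1 * (t * (modulus (c k) ^+ 2 * V k) + t^-1 * (s ^+ k.*2 / V k)))).
  apply: ler_sum => k _; pose v := Num.sqrt (V k).
  have v0 : 0 < v by rewrite sqrtr_gt0.
  have -> : V k = v ^+ 2 by rewrite sqr_sqrtr// ltW.
  rewrite -mul2n mulnC exprM; set a := modulus (c k); set b := s ^+ k.
  rewrite -subr_ge0 (_ : _ - _ = (t * a * v - b / v) ^+ 2 / (2 * t)).
    by rewrite divr_ge0 ?sqr_ge0// mulr_ge0// ltW.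
  by field; rewrite !gt_eqF.
rewrite -mulr_sumr big_split /= -!mulr_sumr.
have := moment_exp_le N s0; rewrite -S2 => H.
have H1 : t * \sum_(k < N) modulus (c k) ^+ 2 * V k <= S * B.
  by apply: le_trans (ler_wpM2l (ltW t0) cB) _; apply: eq_ler; rewrite /t; field; rewrite gt_eqF.
have H2 : t^-1 * \sum_(k < N) s ^+ k.*2 / V k <= S * B.
  apply: le_trans (ler_wpM2l _ H) _; first by rewrite invr_ge0 ltW.
  by apply: eq_ler; rewrite /t; field; rewrite !gt_eqF.
by rewrite -mulrA -/S; move: (t * _) (t^-1 * _) H1 H2 => x y; lra.
Qed.

Lemma cmeas_poly c N : cmeas setT (fun w : plane R => P c N (cplx w)).
Proof.
apply: (@cmeas_sum _ _ _ _ N (fun k w => c k * cplx w ^+ k)) => k.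
by apply: cmeasM; [exact: cmeas_cst|apply: cmeasX; exact: cmeas_cplx].
Qed.

Lemma modulus_poly_le c N z : modulus (P c N z) <= \sum_(k < N) modulus (c k) * modulus z ^+ k.
Proof.
apply: le_trans (ler_modulus_sum _ _ _) _; apply: ler_sum => k _.
by rewrite modulusM modulusX.
Qed.

Let mW : measurable_fun setT (fun w : plane R => W (cplx w)).
Proof. exact: measurable_gauss2. Qed.

Lemma poly_orthogonal c N n : (N <= n)%N ->
  integrableC leb2 setT (fun w => P c N (cplx w) * (cplx w)^* ^+ n * (W (cplx w))%:C) /\
  plane_int (fun z => P c N z * z^* ^+ n * (W z)%:C) = 0.
Proof.
elim: N => [_|N ih Nn].
  have E : (fun w : plane R => P c 0 (cplx w) * (cplx w)^* ^+ n * (W (cplx w))%:C) = (fun=> 0%:C).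
    by apply/funext => w; rewrite big_ord0 !mul0r.
  rewrite /plane_int E integralC_real; split; last by rewrite /Rintegral integral0.
  by split; exact: integrable0.
have [i1 I1] := ih (ltnW Nn).
pose t z := z ^+ N * z^* ^+ n * (W z)%:C.
have mt : cmeas setT (fun w => t (cplx w)).
  apply: cmeasM; last exact: cmeas_real.
  apply: cmeasM; apply: cmeasX; first exact: cmeas_cplx.
  by apply: cmeas_conj; exact: cmeas_cplx.
have tE z : modulus (t z) = modulus z ^+ (N + n) * W z.
  by rewrite /t !modulusM !modulusX modulus_real modulus_conj exprD ger0_norm ?expR_ge0.
have im := integrable_moment (N + n) alpha_gt0.
have it : integrableC leb2 setT (fun w => t (cplx w)).
  by apply: integrableC_le im _ => // w _; rewrite tE.
have It : plane_int t = 0.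
  apply: plane_int_orthogonal => //; first by rewrite ltn_eqF.
    by move=> u z u1; rewrite /W modulusM u1 mul1r.
  by apply: eq_integrable im => // w _; rewrite ger0_norm ?expR_ge0.
have ict : integrableC leb2 setT (fun w => c N * t (cplx w)).
  apply: (@integrableC_le _ _ _ _ _ _ (fun w => modulus (c N) * (modulus (cplx w) ^+ (N + n) * W (cplx w)))) => //.
  - by apply: cmeasM => //; exact: cmeas_cst.
  - by have := integrableZl measurableT (modulus (c N)) im; apply: eq_integrable.
  - by move=> w _; rewrite modulusM tE.
have E : (fun w : plane R => P c N.+1 (cplx w) * (cplx w)^* ^+ n * (W (cplx w))%:C) =
    (fun w => P c N (cplx w) * (cplx w)^* ^+ n * (W (cplx w))%:C + c N * t (cplx w)).
  by apply/funext => w; rewrite big_ord_recr /= /t; ring.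
rewrite /plane_int E; split.
  case: i1 ict => [r1 s1] [r2 s2]; split.
  - by have := integrableD measurableT r1 r2; apply: eq_integrable => // w _; rewrite cReD.
  - by have := integrableD measurableT s1 s2; apply: eq_integrable => // w _; rewrite cImD.
rewrite integralCD// integralCZ//.
by move: I1 It; rewrite /plane_int => -> ->; rewrite mulr0 addr0.
Qed.

(** When a monomial is added, the cross term of the squared modulus integrates to [0] by
    [poly_orthogonal]. *)
Lemma poly_parseval c N :
  integrable leb2 setT (fun w => (modulus (P c N (cplx w)) ^+ 2 * W (cplx w))%:E) /\
  \int[leb2]_w (modulus (P c N (cplx w)) ^+ 2 * W (cplx w)) =
  \sum_(k < N) modulus (c k) ^+ 2 * V k.
Proof.
elim: N => [|N [iN IN]].
  have E : (fun w : plane R => modulus (P c 0 (cplx w)) ^+ 2 * W (cplx w)) = (fun=> 0).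
    by apply/funext => w; rewrite big_ord0 modulus0 expr0n mul0r.
  split; first by under eq_fun do rewrite big_ord0 modulus0 expr0n mul0r; exact: integrable0.
  by rewrite E big_ord0 /Rintegral integral0.
have [iP IP] := poly_orthogonal c (leqnn N).
pose Q w := P c N (cplx w) * (cplx w)^* ^+ N * (W (cplx w))%:C.
have iQ : integrable leb2 setT (fun w => (complex.Re ((c N)^* * Q w))%:E).
  case: iP => r1 s1.
  have := integrableB measurableT (integrableZl measurableT (complex.Re (c N)^* ) r1)
    (integrableZl measurableT (complex.Im (c N)^* ) s1).
  by apply: eq_integrable => // w _; rewrite [in RHS]cReM.
have IQ : \int[leb2]_w complex.Re ((c N)^* * Q w) = 0.
  have := integralCZ (c N)^* measurableT iP.
  rewrite -[integralC _ _ (fun w => P c N _ * _ * _)]/(plane_int (fun z => P c N z * z^* ^+ N * (W z)%:C)).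
  by rewrite IP mulr0 => /(congr1 (@complex.Re R)).
have im := integrable_moment N.*2 alpha_gt0.
have iZ k u := @integrable_realZl R _ (plane R) leb2 setT k u measurableT.
have iD u v := @integrable_realD R _ (plane R) leb2 setT u v measurableT.
have key (a b u : R[i]) (x : R) : modulus (a + u * b) ^+ 2 * x =
    (modulus a ^+ 2 * x + 2 * complex.Re (u^* * (a * b^* * x%:C))) + modulus u ^+ 2 * (modulus b ^+ 2 * x).
  by rewrite !sqr_modulus; case: a b u => [a1 a2] [b1 b2] [c1 c2] /=; ring.
have i2Q := iZ 2 _ iQ; have icm := iZ (modulus (c N) ^+ 2) _ im.
have E : (fun w : plane R => modulus (P c N.+1 (cplx w)) ^+ 2 * W (cplx w)) =
   (fun w => (modulus (P c N (cplx w)) ^+ 2 * W (cplx w) + 2 * complex.Re ((c N)^* * Q w)) +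
     modulus (c N) ^+ 2 * (modulus (cplx w) ^+ N.*2 * W (cplx w))).
  apply/funext => w.
  rewrite (_ : modulus (cplx w) ^+ N.*2 = modulus (cplx w ^+ N) ^+ 2); last first.
    by rewrite modulusX -exprM muln2.
  rewrite /Q (_ : (cplx w)^* ^+ N = (cplx w ^+ N)^* ); last by rewrite rmorphXn.
  by rewrite big_ord_recr; exact: key.
have i3 := iD _ _ iN i2Q; split.
  by have := iD _ _ i3 icm; rewrite -[X in integrable _ _ (EFin \o X)]E.
rewrite E.
rewrite RintegralD// RintegralD// [X in _ + X + _]RintegralZl// IQ mulr0 addr0 IN RintegralZl//.
by rewrite big_ord_recr.
Qed.

(** Fatou's lemma passes from polynomials to the limit; as only an upper bound is wanted, no
    majorant enters. *)
Lemma power_series_parseval c f (B : R) :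
  (forall N, \sum_(k < N) modulus (c k) ^+ 2 * V k <= B) ->
  (forall z, ccvg (fun N => P c N z) (f z)) ->
  (\int[leb2]_w ('g[f] (cplx w) ^+ 2)%:E <= B%:E)%E.
Proof.
move=> cB cf; pose F N (w : plane R) := (modulus (P c N (cplx w)) ^+ 2 * W (cplx w))%:E.
have Fcvg w : (F^~ w @ \oo --> ('g[f] (cplx w) ^+ 2)%:E)%classic.
  apply: cvg_EFin; first exact: nearW.
  have -> : 'g[f] (cplx w) ^+ 2 =
      (complex.Re (f (cplx w)) ^+ 2 + complex.Im (f (cplx w)) ^+ 2) * W (cplx w).
    rewrite -sqr_modulus /gauss_modulus exprMn; congr (_ * _).
    by rewrite expr2 -expRD /W; congr expR; field.
  rewrite (_ : _ \o _ = (fun N => (complex.Re (P c N (cplx w)) ^+ 2 +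
      complex.Im (P c N (cplx w)) ^+ 2) * W (cplx w))); last first.
    by apply/funext => N; rewrite /F /= -sqr_modulus.
  have re := ccvg_Re (cf (cplx w)); have im := ccvg_Im (cf (cplx w)).
  apply: cvgM; last exact: cvg_cst.
  by apply: cvgD; rewrite expr2; [exact: (cvgM re re)|exact: (cvgM im im)].
have mF N : measurable_fun setT (F N).
  apply/measurable_EFinP; apply: measurable_funM => //; apply: measurable_funX.
  by apply: cmeas_modulus => //; exact: cmeas_poly.
have F0 N w : setT w -> (0 <= F N w)%E.
  by move=> _; rewrite lee_fin mulr_ge0 ?exprn_ge0 ?expR_ge0.
have := @fatou _ _ _ leb2 setT measurableT F mF F0.
under eq_integral do rewrite (cvg_limn_einf_sup (Fcvg _)).1.
move=> /le_trans; apply; rewrite limn_einf_lim; apply: lime_le; first exact: is_cvg_einfs.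
apply: nearW => N; apply: (@le_trans _ _ (\int[leb2]_w F N w)%E).
  by apply: ereal_inf_lbound; exists N => /=.
have [iN IN] := poly_parseval c N.
rewrite -[leLHS]fineK; last exact: integrable_fin_num.
by rewrite lee_fin [leLHS]IN.
Qed.

End PowerSeries.

Section EntireSeries.
Context {R : realType}.
Variable alpha : R.
Hypothesis alpha_gt0 : 0 < alpha.
Local Notation "'g[ f ]" := (gauss_modulus alpha f) (at level 0, format "''g[' f ]").
Local Notation V n := (gauss_moment alpha n.*2).

Lemma power_series_entire (c : nat -> R[i]) (f : R[i] -> R[i]) (B : R) : 0 < B ->
  (forall N, \sum_(k < N) modulus (c k) ^+ 2 * V k <= B ^+ 2) ->
  (forall z, ccvg (fun N => \sum_(k < N) c k * z ^+ k) (f z)) -> entire f.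
Proof.
move=> B0 cB cf; apply/entireP; apply: (cdiffable_power_series _ cf) => r r0.
exists (B * expR (alpha / 2 * r ^+ 2) / Num.sqrt (V 0)) => n.
apply: le_trans (coef_sum_le alpha_gt0 B0 r0 (cB n.+1)).
rewrite big_ord_recr /= lerDr; apply: sumr_ge0 => k _.
by rewrite mulr_ge0 ?exprn_ge0.
Qed.

Lemma power_series_gauss_le (c : nat -> R[i]) (f : R[i] -> R[i]) (B : R) z : 0 < B ->
  (forall N, \sum_(k < N) modulus (c k) ^+ 2 * V k <= B ^+ 2) ->
  (forall z, ccvg (fun N => \sum_(k < N) c k * z ^+ k) (f z)) ->
  'g[f] z <= B / Num.sqrt (V 0).
Proof.
move=> B0 cB cf; rewrite /gauss_modulus.
have H : modulus (f z) <= B * expR (alpha / 2 * modulus z ^+ 2) / Num.sqrt (V 0).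
  apply: (ccvg_modulus_le (cf z)) => N; apply: le_trans (modulus_poly_le _ _ _) _.
  exact: coef_sum_le (cB N).
apply: le_trans (ler_wpM2r (expR_ge0 _) H) _; apply: eq_ler.
rewrite mulrAC -(mulrA B) -expRD (_ : _ + _ = 0) ?expR0 ?mulr1//; ring.
Qed.

Lemma Fock_power_series_le (q : \bar R) : (2%:E <= q)%E -> exists2 C : R, 0 < C &
  forall (c : nat -> R[i]) (f : R[i] -> R[i]) (B : R), 0 < B ->
  (forall N, \sum_(k < N) modulus (c k) ^+ 2 * V k <= B ^+ 2) ->
  (forall z, ccvg (fun N => \sum_(k < N) c k * z ^+ k) (f z)) ->
  (Fock_norm alpha q f <= (C * B)%:E)%E.
Proof.
have v0 : 0 < Num.sqrt (V 0) by rewrite sqrtr_gt0 gauss_moment_gt0.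
case: q => [r| |//]; last first.
  move=> _; exists (Num.sqrt (V 0))^-1; first by rewrite invr_gt0.
  move=> c f B B0 cB cf; apply/Fock_norm_infP => z; rewrite mulrC.
  exact: power_series_gauss_le cB cf.
rewrite lee_fin => r2; have r0 : 0 < r by exact: lt_le_trans r2.
set k := Fock_cst alpha r; have k0 : 0 < k by exact: Fock_cst_gt0.
pose s := (Num.sqrt (V 0))^-1; have s0 : 0 < s by rewrite invr_gt0.
pose K := k * s `^ (r - 2); have K0 : 0 < K by rewrite mulr_gt0 ?powR_gt0.
exists (K `^ r^-1); first exact: powR_gt0.
move=> c f B B0 cB cf; have CB : 0 <= K `^ r^-1 * B by rewrite mulr_ge0 ?powR_ge0 ?ltW.
apply/(Fock_norm_finP alpha_gt0 f r0 CB).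
have ef := power_series_entire B0 cB cf.
have mg := @measurable_gauss_modulus R alpha f (entire_cdiffable ef).
have P := power_series_parseval alpha_gt0 cB cf.
(* Split [x^r = x^(r-2) x^2] and bound the first factor by its supremum, which requires
   [r - 2 >= 0]. *)
have H : (\int[leb2]_w ('g[f] (cplx w) `^ r)%:E <=
    ((B * s) `^ (r - 2))%:E * \int[leb2]_w ('g[f] (cplx w) ^+ 2)%:E)%E.
  have m2 : measurable_fun setT (fun w : plane R => ('g[f] (cplx w) ^+ 2)%:E).
    by apply/measurable_EFinP; exact: measurable_funX.
  rewrite -ge0_integralZl//; last 2 first.
  - by move=> w _; rewrite lee_fin sqr_ge0.
  - by rewrite lee_fin powR_ge0.
  apply: ge0_le_integral => //.
  - by move=> w _; rewrite lee_fin powR_ge0.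
  - by apply/measurable_EFinP; exact: measurableT_comp (measurable_powR r) mg.
  - exact: measurable_funeM.
  move=> w _; rewrite -EFinM lee_fin; set x := 'g[f] _.
  have x0 : 0 <= x by exact: gauss_modulus_ge0.
  have xB : x <= B * s by exact: power_series_gauss_le cB cf.
  have [->|xn0] := eqVneq x 0; first by rewrite powR0 ?mulr_ge0 ?powR_ge0 ?sqr_ge0// gt_eqF.
  rewrite [leLHS](_ : _ = x `^ (r - 2) * x ^+ 2); last first.
    by rewrite -powR_mulrn// -powRD ?subrK// xn0 implybT.
  apply: ler_wpM2r; first exact: sqr_ge0.
  by apply: ge0_ler_powR; rewrite ?nnegrE ?subr_ge0// ?mulr_ge0 ?ltW.
apply: le_trans (lee_wpmul2l _ H) _; first by rewrite lee_fin ltW.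
apply: le_trans (lee_wpmul2l _ (lee_wpmul2l _ P)) _; rewrite ?lee_fin ?powR_ge0 ?(ltW k0)//.
have e1 : (K `^ r^-1 * B) `^ r = K * B `^ r.
  by rewrite powRM ?powR_ge0 ?(ltW B0)// -powRrM mulVf ?gt_eqF// powRr1// ltW.
have e2 : (B * s) `^ (r - 2) = B `^ (r - 2) * s `^ (r - 2) by rewrite powRM ?ltW.
have e3 : B `^ r = B `^ (r - 2) * B ^+ 2.
  rewrite -[in RHS](powR_mulrn 2 (ltW B0)) -powRD ?subrK//.
  by apply/implyP => _; rewrite gt_eqF.
by rewrite e1 e2 e3 /K -/k; apply: eq_ler; ring.
Qed.

End EntireSeries.

Lemma nneseries_ltyP {R : realType} (u : nat -> \bar R) : (forall n, (0 <= u n)%E) ->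
  (\sum_(0 <= n <oo) u n < +oo)%E <->
  exists S : R, forall N, (\sum_(k < N) u k <= S%:E)%E.
Proof.
move=> u0; split=> [H|[S HS]].
  have fS : (\sum_(0 <= n <oo) u n)%E \is a fin_num.
    by rewrite ge0_fin_numE//; exact: nneseries_ge0.
  exists (fine (\sum_(0 <= n <oo) u n)%E) => N; rewrite fineK//.
  by have := nneseries_lim_ge N (fun n _ _ => u0 n) (P := xpredT) (m := 0%N); rewrite big_mkord.
apply: (@le_lt_trans _ _ S%:E); last exact: ltry.
apply: lime_le; first by apply: is_cvg_nneseries => n _ _.
by apply: nearW => N; rewrite big_mkord.
Qed.

(** * Moments of the measure and the coefficients of the image *)

Section HausdorffMoments.
Context {R : realType}.
Variable mu : {measure set (measurableTypeR R) -> \bar R}.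
Local Notation D := (`]0%R, +oo[%classic : set (measurableTypeR R)).
Local Notation D1 := (`[1%R, +oo[%classic : set (measurableTypeR R)).

Lemma measurable_inv_itv n : measurable_fun D (fun t : measurableTypeR R => ((t : R) ^+ n)^-1).
Proof.
apply: (eq_measurable_fun (fun t : measurableTypeR R => ((t : R) `^ (-1)) ^+ n)).
  move=> t; rewrite inE /= in_itv /= andbT => t0.
  by rewrite powR_inv1 ?exprVn// ltW.
by apply: measurable_funX; apply: measurable_funS (measurable_powR (-1)).
Qed.

Lemma moment_ge0 n : (0 <= moment mu n)%E.
Proof.
apply: integral_ge0 => t; rewrite /= in_itv /= andbT => t0.
by rewrite lee_fin invr_ge0 exprn_ge0// ltW.
Qed.

(** On []0, a]] with [a < 1] the integrand of the [n]-th moment is at least [a^(-n-1)], which is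
    unbounded in [n]. The intervals [A k] exhaust []0, 1[]. *)
Lemma moment_bounded_null (S : R) : (forall n, (moment mu n <= S%:E)%E) ->
  mu (`]0%R, 1%R[%classic) = 0%E.
Proof.
move=> mS.
pose A k : set (measurableTypeR R) := `]0, 1 - k.+2%:R^-1]%classic.
have a0 k : 0 < 1 - k.+2%:R^-1 :> R by rewrite subr_gt0 invf_lt1 ?ltr1n ?ltr0n.
have a1 k : 1 - k.+2%:R^-1 < 1 :> R by rewrite gtrBl invr_gt0 ltr0n.
have mA k : measurable (A k) by exact: measurable_itv.
have AD k : A k `<=` D by move=> t /=; rewrite !in_itv /= andbT => /andP[].
have A0 k : mu (A k) = 0%E.
  set a := 1 - k.+2%:R^-1 : R.
  have Aa n : ((a ^- n.+1)%:E * mu (A k) <= S%:E)%E.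
    apply: le_trans (mS n); rewrite -integral_cst//.
    apply: (@le_trans _ _ (\int[mu]_(t in A k) ((t ^+ n.+1)^-1)%:E)%E).
      apply: ge0_le_integral => //.
      - by move=> t _; rewrite lee_fin invr_ge0 exprn_ge0// ltW// a0.
      - by apply/measurable_EFinP; apply: measurable_funS (measurable_inv_itv n.+1).
      move=> t; rewrite /A /= in_itv /= => /andP[t0 ta]; rewrite lee_fin lef_pV2 ?posrE ?exprn_gt0 ?a0//.
      by apply: lerXn2r; rewrite ?nnegrE ?(ltW t0) ?(ltW (a0 k)).
    apply: ge0_subset_integral => //.
    - by apply/measurable_EFinP; exact: measurable_inv_itv.
    - by move=> t /=; rewrite in_itv /= andbT => t0; rewrite lee_fin invr_ge0 exprn_ge0// ltW.
  have S0 : 0 <= S by rewrite -lee_fin; apply: le_trans (mS 0%N); exact: moment_ge0.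
  (* An infinite mass is excluded first, by the moment of order [0]. *)
  have [x xE] : exists x : R, mu (A k) = x%:E.
    exists (fine (mu (A k))); rewrite fineK// ge0_fin_numE ?measure_ge0//.
    rewrite ltNge leye_eq; apply/negP => /eqP E; have := Aa 0%N.
    by rewrite E mulry gtr0_sg ?mul1e ?invr_gt0 ?exprn_gt0 ?a0// leye_eq.
  have x0 : 0 <= x by rewrite -lee_fin -xE measure_ge0.
  rewrite xE; congr (_%:E); apply/eqP; rewrite eq_le x0 andbT.
  have xS n : x * n%:R <= S * (a / (1 - a)).
    have := Aa n; rewrite xE -EFinM lee_fin => H.
    have b0 : 0 < a^-1 - 1 by rewrite subr_gt0 invf_gt1 ?a0 ?a1.
    (* Bernoulli's inequality for [a^-1]. *)
    have B : 1 + (a^-1 - 1) *+ n.+1 <= (1 + (a^-1 - 1)) ^+ n.+1.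
      elim: (n.+1) => [|m ih]; first by rewrite mulr0n addr0 expr0.
      rewrite exprS mulrS; have := ler_wpM2l (addr_ge0 ler01 (ltW b0)) ih.
      apply: le_trans; rewrite mulrDl mul1r mulrDr mulr1.
      have := mulr_ge0 (ltW b0) (mulrn_wge0 m (ltW b0)); lra.
    move: B; rewrite [1 + (a^-1 - 1)]addrC subrK exprVn -(mulr_natr (a^-1 - 1) n.+1) => B.
    have ab : (a^-1 - 1)^-1 = a / (1 - a).
      have := a0 k; have := a1 k; rewrite -/a => h1 h2; field.
      by rewrite !gt_eqF// subr_gt0.
    rewrite -ab -ler_pdivrMr ?invr_gt0// invrK.
    apply: le_trans H; rewrite [leLHS](_ : _ = (a^-1 - 1) * n%:R * x); last by ring.
    apply: ler_wpM2r => //.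
    apply: le_trans B; rewrite -(natr1 n) mulrDr mulr1; lra.
  rewrite leNgt; apply/negP => xp.
  have d0 : 0 <= a / (1 - a)
    by apply: divr_ge0; [exact: ltW (a0 k)|rewrite subr_ge0; exact: ltW (a1 k)].
  have := archi_boundP (divr_ge0 (mulr_ge0 S0 d0) x0).
  by rewrite ltr_pdivrMr// [_%:R * x]mulrC ltNge xS.
have : mu.-negligible (\bigcup_k A k).
  by apply: negligible_bigcup => k; apply: (@negligibleP _ _ _ mu (A k) (mA k)).2; exact: A0.
have -> : \bigcup_k A k = `]0%R, 1%R[%classic.
  apply/seteqP; split=> t /=.
    move=> [k _]; rewrite /A /= !in_itv /= => /andP[-> /le_lt_trans ->]//.
  rewrite in_itv /= => /andP[t0 t1]; have t10 : 0 < 1 - t by rewrite subr_gt0.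
  exists (Num.bound (1 - t)^-1) => //; rewrite /A /= in_itv /= t0 /=.
  have i0 : 0 <= (1 - t)^-1 by rewrite invr_ge0 ltW.
  have : (1 - t)^-1 <= (Num.bound (1 - t)^-1).+2%:R.
    by apply: le_trans (ltW (archi_boundP i0)) _; rewrite ler_nat; apply: leq_trans (leqnSn _).
  move=> h; rewrite lerBrDl -lerBrDr -[leRHS]invrK lef_pV2 ?posrE ?invr_gt0 ?ltr0n//.
have mI : measurable (`]0%R, 1%R[%classic : set (measurableTypeR R)) by exact: measurable_itv.
by apply: (@negligibleP _ _ _ mu _ mI).1.
Qed.

End HausdorffMoments.

Section HausdorffCoefficients.
Context {R : realType}.
Variable mu : {measure set (measurableTypeR R) -> \bar R}.
Local Notation D := (`]0%R, +oo[%classic : set (measurableTypeR R)).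
Local Notation D1 := (`[1%R, +oo[%classic : set (measurableTypeR R)).
Variable S : R.
Hypothesis momentS : forall n, (moment mu n <= S%:E)%E.

Let mD : measurable D. Proof. exact: measurable_itv. Qed.
Let mD1 : measurable D1. Proof. exact: measurable_itv. Qed.
Let mI : measurable (`]0%R, 1%R[%classic : set (measurableTypeR R)).
Proof. exact: measurable_itv. Qed.

Let DE : D `\` `]0%R, 1%R[%classic = D1.
Proof.
apply/seteqP; split=> t /=; rewrite !in_itv /= !andbT.
  by move=> [t0 /negP]; rewrite t0 /= -leNgt.
move=> t1; have t0 : 0 < t by exact: lt_le_trans t1.
by split=> //; apply/negP; rewrite t0 /= -leNgt.
Qed.

Lemma moment_fin n : moment mu n = (fine (moment mu n))%:E.
Proof.
rewrite fineK// ge0_fin_numE ?moment_ge0//.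
by apply: le_lt_trans (momentS n) _; exact: ltry.
Qed.

Lemma integrable_inv n : mu.-integrable D (fun t => (((t : R) ^+ n.+1)^-1)%:E).
Proof.
apply/integrableP; split; first by apply/measurable_EFinP; exact: measurable_inv_itv.
have -> : (\int[mu]_(t in D) `|((t ^+ n.+1)^-1)%:E| = moment mu n)%E.
  apply: eq_integral => t; rewrite inE /= in_itv /= andbT => t0.
  by rewrite ger0_norm// invr_ge0 exprn_ge0// ltW.
by rewrite moment_fin ltry.
Qed.

Lemma Rintegral_restrict (h : measurableTypeR R -> R) : mu.-integrable D (EFin \o h) ->
  \int[mu]_(t in D) h t = \int[mu]_(t in D1) h t.
Proof.
move=> ih; congr fine; rewrite -DE; apply: negligible_integral => //.
exact: moment_bounded_null momentS.
Qed.

Lemma integrableC_restrict (g : measurableTypeR R -> R[i]) : cmeas D g ->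
  integrableC mu D1 g -> integrableC mu D g /\ integralC mu D g = integralC mu D1 g.
Proof.
have N0 := moment_bounded_null momentS.
move=> [mr mi] [ir ii].
have jr : mu.-integrable D (EFin \o (fun t => complex.Re (g t))).
  by apply/(negligible_integrable mI mD _ N0); rewrite ?DE//; exact/measurable_EFinP.
have ji : mu.-integrable D (EFin \o (fun t => complex.Im (g t))).
  by apply/(negligible_integrable mI mD _ N0); rewrite ?DE//; exact/measurable_EFinP.
by split=> //; rewrite /integralC !Rintegral_restrict.
Qed.

Lemma tcoef_abs_sum (f : R[i] -> R[i]) z : (forall w, cdiffable f w) ->
  exists M : R, forall N, \sum_(k < N) modulus (tcoef f k) * modulus z ^+ k <= M.
Proof.
move=> df; have cf w : ccont f w := cdiffable_cont (df w).
pose r := 2 * (modulus z + 1); have z0 := modulus_ge0 z.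
have r0 : 0 < r by rewrite mulr_gt0// ltr_wpDl.
have [M fM] := ccont_bounded_disc r cf.
have M0 : 0 <= M by apply: le_trans (fM 0 _) => //; rewrite modulus0 ltW.
exists (4 * M) => N; apply: (@le_trans _ _ (\sum_(k < N) 2 * M * (2^-1) ^+ k)).
  apply: ler_sum => k _; have K : modulus (tcoef f k) * r ^+ k <= 2 * M.
    by apply: tcoef_le => // w wr; apply: fM; rewrite wr.
  rewrite exprVn ler_pdivlMr ?exprn_gt0//; apply: le_trans K.
  rewrite -mulrA -exprMn; apply: ler_wpM2l => //.
  apply: lerXn2r; rewrite ?nnegrE; [exact: mulr_ge0|exact: ltW|].
  by rewrite /r mulrC; apply: ler_wpM2l => //; rewrite lerDl.
rewrite -mulr_sumr; apply: le_trans (ler_wpM2l _ (geometric_sum_le N _ _)) _; try lra.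
by apply: eq_ler; field.
Qed.

(** On [[1, +oo[] every partial sum is dominated by [M / t], with [M] from the absolute convergence
    of the Taylor series at [z]. Convergence is proved there and then carried over to the half line
    across the null set []0, 1[]. *)
Lemma hausdorff_series (f : R[i] -> R[i]) z : (forall w, cdiffable f w) ->
  integrableC mu D (hausdorff_integrand f z) /\
  ccvg (fun N => \sum_(k < N) (fine (moment mu k))%:C * tcoef f k * z ^+ k) (hausdorff mu f z).
Proof.
move=> df; have [M MP] := tcoef_abs_sum z df.
have M0 : 0 <= M by apply: le_trans (MP 0%N); rewrite big_ord0.
pose e k (t : measurableTypeR R) := tcoef f k * z ^+ k * (((t : R) ^+ k.+1)^-1)%:C.
pose F N t := \sum_(k < N) e k t.
have me k : cmeas D (e k).
  by apply: cmeasM; [exact: cmeas_cst|apply: cmeas_real; exact: measurable_inv_itv].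
have mF N : cmeas D (F N) by apply: cmeas_sum.
have D1D : D1 `<=` D by rewrite -DE => t [].
have cmS (g : measurableTypeR R -> R[i]) : cmeas D g -> cmeas D1 g.
  by move=> [gr gi]; split; exact: measurable_funS D1D _.
have eE k t : D t -> e k t = (((t : R)%:C)^-1) * (tcoef f k * (z / (t : R)%:C) ^+ k).
  rewrite /= in_itv /= andbT => t0; rewrite /e expr_div_n exprS.
  rewrite -[((t * t ^+ k)^-1)%:C]/(real_complex R (t * t ^+ k)^-1) fmorphV rmorphM rmorphXn.
  by rewrite /= invfM; ring.
have Ff t : D t -> ccvg (F^~ t) (hausdorff_integrand f z t).
  move=> Dt; rewrite /hausdorff_integrand mulrC.
  have := ccvgZ ((t : R)%:C)^-1 (taylor_ccvg (z / (t : R)%:C) df).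
  by apply: eq_ccvg => N; rewrite mulr_sumr; apply: eq_bigr => k _; rewrite eE.
have mf : cmeas D (hausdorff_integrand f z) by exact: cmeas_ccvg mD mF Ff.
have inv1 n : mu.-integrable D1 (EFin \o (fun t : measurableTypeR R => ((t : R) ^+ n.+1)^-1)).
  by apply: integrableS (integrable_inv n).
have iM : mu.-integrable D1 (EFin \o (fun t : measurableTypeR R => M * ((t : R) ^+ 1)^-1)).
  by have := integrableZl mD1 M (inv1 0%N); apply: eq_integrable.
have ebound k t : D1 t -> modulus (e k t) <= modulus (tcoef f k) * modulus z ^+ k * ((t : R) ^+ 1)^-1.
  rewrite /= in_itv /= andbT => t1; have t0 : 0 < t by exact: lt_le_trans t1.
  rewrite /e (modulusM (tcoef f k * _)) (modulusM (tcoef f k)) modulusX modulus_real ger0_norm; last by rewrite invr_ge0 exprn_ge0// ltW.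
  apply: ler_wpM2l; first by rewrite mulr_ge0 ?exprn_ge0.
  by rewrite lef_pV2 ?posrE ?exprn_gt0// ler_weXn2l.
have FM N t : D1 t -> modulus (F N t) <= M * ((t : R) ^+ 1)^-1.
  move=> Dt; apply: le_trans (ler_modulus_sum _ _ _) _.
  apply: (@le_trans _ _ (\sum_(k < N) modulus (tcoef f k) * modulus z ^+ k * ((t : R) ^+ 1)^-1)).
    by apply: ler_sum => k _; exact: ebound.
  rewrite -mulr_suml; apply: ler_wpM2r (MP N).
  by move: Dt; rewrite /= in_itv /= andbT expr1 invr_ge0 => /(le_trans ler01).
have [i1 c1] := integralC_ccvg mD1 (fun N => cmS _ (mF N)) iM FM (fun t Dt => Ff t (D1D t Dt)).
have [i2 E] := integrableC_restrict mf i1.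
split=> //; rewrite /hausdorff E; apply: eq_ccvg c1 => N.
have ie k : integrableC mu D1 (fun t => (((t : R) ^+ k.+1)^-1)%:C).
  apply: (@integrableC_le _ _ _ _ _ _ (fun t : measurableTypeR R => ((t : R) ^+ k.+1)^-1)) => //.
    by apply: cmS; apply: cmeas_real; exact: measurable_inv_itv.
  move=> t Dt; rewrite modulus_real ger0_norm//.
  by move: Dt; rewrite /= in_itv /= andbT invr_ge0 => t1; rewrite exprn_ge0// (le_trans ler01).
have iF n : integrableC mu D1 (F n) by exact: integrableC_le (cmS _ (mF n)) iM (FM n).
elim: N => [|N ih].
  have -> : F 0%N = (fun=> 0%:C) by apply/funext => t; rewrite /F big_ord0.
  by rewrite integralC_real /Rintegral integral0 big_ord0.
have -> : F N.+1 = (fun t => F N t + e N t) by apply/funext => t; rewrite /F big_ord_recr.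
rewrite integralCD//; last first.
  apply: (integrableC_le mD1 (cmS _ (me N)) _ (ebound N)).
  by have := integrableZl mD1 (modulus (tcoef f N) * modulus z ^+ N) (inv1 0%N); apply: eq_integrable.
rewrite ih big_ord_recr; congr (_ + _); rewrite integralCZ// integralC_real.
rewrite -Rintegral_restrict; last exact: integrable_inv.
by rewrite -[\int[mu]_(_ in D) _]/(fine (moment mu N)); ring.
Qed.

End HausdorffCoefficients.

(** * Uniform boundedness *)

Section UniformBoundedness.
Context {R : realType} {V : lmodType R[i]}.
Variables (X : set V) (NX : V -> \bar R) (phi : nat -> V -> R[i]) (x : nat -> V) (p C : R).
Hypothesis p_ge1 : 1 <= p.
Hypothesis X0 : X 0.
Hypothesis X_lin : forall (a : R[i]) u v, X u -> X v -> X (a *: u + v).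
Hypothesis NX_fin : forall u, X u -> exists2 N : R, 0 <= N & NX u = N%:E.
Hypothesis phi_lin : forall n (a : R[i]) u v, X u -> X v ->
  phi n (a *: u + v) = a * phi n u + phi n v.
Hypothesis C_gt0 : 0 < C.
Hypothesis phi_le : forall n u, X u -> ((modulus (phi n u))%:E <= C%:E * NX u)%E.
Hypothesis Xx : forall k, X (x k).
Hypothesis weak : forall psi, bounded_functional X NX psi ->
  (\sum_(0 <= n <oo) (modulus (psi (x n)) `^ p)%:E < +oo)%E.

Lemma X_sum (c : nat -> R[i]) N : X (\sum_(k < N) c k *: x k).
Proof.
elim: N => [|N ih]; first by rewrite big_ord0.
by rewrite big_ord_recr /= addrC; exact: X_lin.
Qed.

Lemma linear_sum (psi : V -> R[i]) (c : nat -> R[i]) N :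
  (forall (a : R[i]) u v, X u -> X v -> psi (a *: u + v) = a * psi u + psi v) ->
  psi (\sum_(k < N) c k *: x k) = \sum_(k < N) c k * psi (x k).
Proof.
move=> lpsi; have psi0 : psi 0 = 0.
  by have := lpsi 1 0 0 X0 X0; rewrite scaler0 addr0 mul1r => /eqP; rewrite -subr_eq0 opprD addrA subrr sub0r oppr_eq0 => /eqP.
elim: N => [|N ih]; first by rewrite !big_ord0.
by rewrite !big_ord_recr /= addrC lpsi ?ih 1?addrC//; exact: X_sum.
Qed.

(** The coefficients run through the unit ball of the space conjugate to [l^p]: for [p > 1] and [p']
    conjugate to [p], [s^((p-1) p') = s^p]; for [p = 1] they are merely bounded by [1], as [s^0 = 1]
    even at [s = 0]. The exponent [p - 1] treats both cases at once. *)
Definition test_vector (y : V) := exists N (s : nat -> R) (e : nat -> R[i]),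
  [/\ forall k, 0 <= s k, forall k, modulus (e k) <= 1, \sum_(k < N) s k `^ p <= 1 &
      y = \sum_(k < N) ((s k `^ (p - 1))%:C * e k) *: x k].

(** A crude Young inequality: replace the smaller of [a] and [b] by the larger. *)
Lemma powR_pred_mul_le (a b : R) : 0 <= a -> 0 <= b -> a `^ (p - 1) * b <= a `^ p + b `^ p.
Proof.
move=> a0 b0; have p0 : 0 < p by exact: lt_le_trans p_ge1.
have pp (u : R) : 0 <= u -> u `^ (p - 1) * u = u `^ p.
  move=> u0; have [->|un0] := eqVneq u 0; first by rewrite mulr0 powR0// gt_eqF.
  by rewrite -{2}(powRr1 u0) -powRD ?subrK// un0 implybT.
have [ab|/ltW ba] := leP a b.
  apply: (@le_trans _ _ (b `^ p)); last by rewrite lerDr powR_ge0.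
  rewrite -(pp b b0); apply: ler_wpM2r => //.
  by apply: ge0_ler_powR; rewrite ?nnegrE// subr_ge0.
apply: (@le_trans _ _ (a `^ p)); last by rewrite lerDl powR_ge0.
by rewrite -(pp a a0); apply: ler_wpM2l => //; exact: powR_ge0.
Qed.

Lemma test_vector_weak psi : bounded_functional X NX psi ->
  exists D : R, forall y, test_vector y -> modulus (psi y) <= D.
Proof.
move=> bpsi; have [lpsi _] := bpsi; have := weak bpsi.
move/(nneseries_ltyP (fun n => _ : (0 <= (modulus (psi (x n)) `^ p)%:E)%E)).
move=> /(_ (fun n => powR_ge0 _ _)) [S SP]; exists (1 + S).
move=> _ [N [s [e [s0 e1 s1 ->]]]].
rewrite (@linear_sum psi (fun k => (s k `^ (p - 1))%:C * e k) N lpsi).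
apply: le_trans (ler_modulus_sum _ _ _) _.
apply: (@le_trans _ _ (\sum_(k < N) (s k `^ p + modulus (psi (x k)) `^ p))).
  apply: ler_sum => k _; apply: le_trans (powR_pred_mul_le (s0 k) (modulus_ge0 _)).
  rewrite !modulusM modulus_real ger0_norm ?powR_ge0//; apply: ler_wpM2r => //.
  by rewrite ler_piMr ?powR_ge0.
rewrite big_split /=; apply: lerD => //.
by rewrite -lee_fin -sumEFin; exact: SP.
Qed.

(** The extremal case of Hoelder's inequality: [s] is proportional to the moduli of the values and
    [e] cancels their phases. *)
Lemma test_vector_norming n N (A : R) : 0 < A ->
  A <= \sum_(k < N) modulus (phi n (x k)) `^ p ->
  exists2 y, test_vector y & A `^ p^-1 <= modulus (phi n y).
Proof.
move=> A0 AS; set T := \sum_(k < N) _ in AS; have T0 : 0 < T by exact: lt_le_trans AS.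
have p0 : 0 < p by exact: lt_le_trans p_ge1.
pose v k := phi n (x k); pose s k := modulus (v k) / T `^ p^-1.
have Tp : 0 < T `^ p^-1 by exact: powR_gt0.
have s0 k : 0 <= s k by rewrite divr_ge0 ?powR_ge0.
have sp k : s k `^ p = modulus (v k) `^ p / T.
  rewrite powRM ?invr_ge0 ?(ltW Tp)//; congr (_ * _).
  rewrite -(powR_inv1 (ltW Tp)) -powRrM mulN1r powRN -powRrM mulVf ?gt_eqF//.
  by rewrite powRr1// ltW.
(* Where [v k = 0] the quotient is [0], which is as good as any phase. *)
pose e k := (v k)^* / (modulus (v k))%:C.
have ev k : e k * v k = (modulus (v k))%:C.
  rewrite /e; have [v0|vn0] := eqVneq (modulus (v k)) 0.
    have /eqP -> : v k == 0 by rewrite -modulus_eq0 v0.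
    by rewrite mulr0 modulus0.
  rewrite mulrAC [_^* * _]mulrC mul_conj expr2 rmorphM /= mulfK//.
  by apply: contra vn0 => /eqP[->].
have e1 k : modulus (e k) <= 1.
  rewrite /e modulusM modulusV modulus_conj modulus_real ger0_norm//.
  have [->|vn0] := eqVneq (modulus (v k)) 0; first by rewrite mul0r.
  by rewrite mulfV.
exists (\sum_(k < N) ((s k `^ (p - 1))%:C * e k) *: x k).
  exists N, s, e; split => //.
  under eq_bigr do rewrite sp; rewrite -mulr_suml -/T mulfV// gt_eqF//.
rewrite (@linear_sum (phi n) (fun k => (s k `^ (p - 1))%:C * e k) N (phi_lin n)).
have -> : \sum_(k < N) (s k `^ (p - 1))%:C * e k * phi n (x k) = (T `^ p^-1)%:C.
  have -> : T `^ p^-1 = \sum_(k < N) s k `^ (p - 1) * modulus (v k).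
    have E k : s k `^ (p - 1) * modulus (v k) = T `^ p^-1 * s k `^ p.
      have -> : modulus (v k) = T `^ p^-1 * s k by rewrite mulrC /s divfK// gt_eqF.
      rewrite mulrCA; congr (_ * _).
      have [->|un0] := eqVneq (s k) 0; first by rewrite mulr0 powR0// gt_eqF.
      by rewrite -{2}(powRr1 (s0 k)) -powRD ?subrK// un0 implybT.
    under eq_bigr do rewrite E sp; rewrite -mulr_sumr -mulr_suml -/T mulfV ?mulr1// gt_eqF//.
  rewrite (rmorph_sum (real_complex R)); apply: eq_bigr => k _.
  by rewrite -mulrA ev -rmorphM.
rewrite modulus_real ger0_norm ?powR_ge0//; apply: ge0_ler_powR AS; rewrite ?nnegrE ?invr_ge0//; exact: ltW.
Qed.

(* Sokal's form of the gliding hump: if [y j] nearly maximises the [phi n], with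
   maximum at least [8 ^ j], then signs can be chosen so that
   [\sum_j +- 4 ^- j * phi (n j)] is unbounded on the [y j]. *)
Lemma gliding_hump (y : nat -> V) (n : nat -> nat) : (forall j, X (y j)) ->
  (forall j m, modulus (phi m (y j)) <= 4 / 3 * modulus (phi (n j) (y j))) ->
  (forall j, 8 ^+ j <= modulus (phi (n j) (y j))) ->
  exists2 psi, bounded_functional X NX psi & forall j, 5 / 9 * 2 ^+ j <= modulus (psi (y j)).
Proof.
move=> Xy near big; pose c j : R[i] := ((4 : R) ^- j)%:C.
have mc j : modulus (c j) = 4 ^- j by rewrite modulus_real ger0_norm// invr_ge0 exprn_ge0.
(* Since [2 b = (a + b) + (b - a)], one of the two signs gives a modulus at least that of [b]. *)
pose sg (a b : R[i]) : R[i] := if modulus b <= modulus (a + b) then 1 else -1.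
have sg1 a b : modulus (sg a b) = 1 by rewrite /sg; case: ifP => _; rewrite ?modulusN modulus1.
have sgP a b : modulus b <= modulus (a + sg a b * b).
  rewrite /sg; case: ifP => [|/negbT]; first by rewrite mul1r.
  rewrite -ltNge mulN1r => H; have := ler_modulusD (a + b) (b - a).
  rewrite (_ : a + b + (b - a) = 2%:C * b); last by rewrite rmorph_nat; ring.
  by rewrite modulusM modulus_real ger0_norm// [modulus (b - a)]modulusBC; lra.
pose fix ps J : V -> R[i] := if J is J'.+1 then
  fun v => ps J' v + sg (ps J' (y J')) (c J' * phi (n J') (y J')) * (c J' * phi (n J') v)
  else fun=> 0.
pose d j v := sg (ps j (y j)) (c j * phi (n j) (y j)) * (c j * phi (n j) v).
have psS J v : ps J.+1 v = ps J v + d J v by [].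
have psE J v : ps J v = \sum_(j < J) d j v.
  by elim: J => [|J ih]; rewrite ?big_ord0// big_ord_recr psS ih.
have md j v : modulus (d j v) = 4 ^- j * modulus (phi (n j) v) by rewrite !modulusM sg1 mul1r mc.
have dle v (N : R) : X v -> NX v = N%:E -> forall j, modulus (d j v) <= C * N / 2 ^+ j.
  move=> Xv NE j; have := phi_le (n j) Xv; rewrite NE -EFinM lee_fin => H.
  have CN : 0 <= C * N by apply: le_trans H.
  rewrite md mulrC; apply: ler_pM => //.
  by rewrite lef_pV2 ?posrE ?exprn_gt0//; apply: lerXn2r; rewrite ?nnegrE//; lra.
pose psi v := xget 0 [set l | ccvg (ps^~ v) l].
have psiP v : X v -> ccvg (ps^~ v) (psi v).
  move=> Xv; have [N N0 NE] := NX_fin Xv.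
  have [l lP] := geometric_ccvg (dle v N Xv NE).
  have : [set l | ccvg (ps^~ v) l] (psi v); last by [].
  by apply: (@xgetPex _ 0); exists l => /=; apply: eq_ccvg lP => J; rewrite psE.
exists psi.
  split.
    move=> a u v Xu Xv; apply: (ccvg_unique (psiP _ (X_lin a Xu Xv))).
    have := ccvgD (ccvgZ a (psiP _ Xu)) (psiP _ Xv); apply: eq_ccvg => J.
    rewrite !psE mulr_sumr -big_split; apply: eq_bigr => j _.
    by rewrite /d phi_lin//=; ring.
  exists (C * 2) => v Xv; have [N N0 NE] := NX_fin Xv.
  rewrite NE -EFinM lee_fin; apply: (ccvg_modulus_le (psiP v Xv)) => J.
  rewrite psE; apply: le_trans (ler_modulus_sum _ _ _) _.
  have CN : 0 <= C * N by rewrite mulr_ge0// ltW.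
  apply: (@le_trans _ _ (\sum_(j < J) C * N * 2^-1 ^+ j)).
    by apply: ler_sum => j _; rewrite exprVn; exact: dle.
  rewrite -mulr_sumr; apply: le_trans (ler_wpM2l CN (geometric_sum_le J _ _)) _; try lra.
  by apply: eq_ler; field.
move=> J; set b := modulus (phi (n J) (y J)).
have b0 : 0 <= b by exact: modulus_ge0.
have q0 : 0 <= 4 ^- J * b :> R by rewrite mulr_ge0// invr_ge0 exprn_ge0.
(* The terms after [J] contribute at most [4 / 3] times a geometric series of sum [4 ^- J / 3], that
   is [4 / 9] of [4 ^- J * b]. The head keeps all of [4 ^- J * b], so [5 / 9] of it survives. *)
have tail m : modulus (ps (J.+1 + m)%N (y J) - ps J.+1 (y J)) <= 4 / 9 * (1 - 4 ^- m) * (4 ^- J * b).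
  elim: m => [|m ih]; first by rewrite addn0 subrr modulus0 expr0 invr1 subrr mulr0 mul0r.
  rewrite addnS psS (_ : _ + _ - _ = ps (J.+1 + m)%N (y J) - ps J.+1 (y J) + d (J.+1 + m)%N (y J)); last by ring.
  apply: le_trans (ler_modulusD _ _) _; rewrite md.
  have H := near J (n (J.+1 + m)%N); rewrite -/b in H.
  have q : 0 <= 4 ^- (J.+1 + m) :> R by rewrite invr_ge0 exprn_ge0.
  apply: le_trans (lerD ih (ler_wpM2l q H)) _; apply: eq_ler.
  rewrite addSn exprS exprD (exprS _ m); field.
  by rewrite !expf_neq0.
have head : 4 ^- J * b <= modulus (ps J.+1 (y J)).
  have := sgP (ps J (y J)) (c J * phi (n J) (y J)).
  by rewrite modulusM mc.
have low : 5 / 9 * 2 ^+ J <= 5 / 9 * (4 ^- J * b).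
  rewrite ler_pM2l//.
  rewrite mulrC ler_pdivlMr ?exprn_gt0// -exprMn; apply: le_trans (big J).
  by rewrite -[8](_ : 2 * 4 = 8 :> R)//; ring.
apply: le_trans low _.
have psiJ := psiP (y J) (Xy J).
apply/ler_addgt0Pr => e e0; have [N NP] := psiJ e e0.
have := NP (J.+1 + N)%N (leq_addl _ _); rewrite modulusBC => H.
have t := tail N; have := ler_modulusD (psi (y J)) (ps (J.+1 + N)%N (y J) - psi (y J)).
have := ler_modulusD (ps (J.+1 + N)%N (y J)) (ps J.+1 (y J) - ps (J.+1 + N)%N (y J)).
rewrite (addrC (psi _)) subrK (addrC (ps (J.+1 + N)%N _)) subrK.
rewrite (modulusBC _ (psi _)) (modulusBC (ps J.+1 _)) => h1 h2.
have g : (1 - 4 ^- N) * (4 ^- J * b) <= 4 ^- J * b.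
  by rewrite ler_piMl// gerBl invr_ge0 exprn_ge0.
by move: t head g h1 h2 H; rewrite -mulrA; set A := 4 ^- J * b; set B := (1 - _) * A; lra.
Qed.

(** If the sums were unbounded, norming test vectors would feed [gliding_hump], and the functional
    it returns would be unbounded on test vectors, against [test_vector_weak]. *)
Lemma uniform_weak_bound : exists K : R, forall n N,
  \sum_(k < N) modulus (phi n (x k)) `^ p <= K.
Proof.
have p0 : 0 < p by exact: lt_le_trans p_ge1.
apply: contrapT => unb.
have pick j : exists yn : V * nat, [/\ test_vector yn.1, X yn.1,
    forall m, modulus (phi m yn.1) <= 4 / 3 * modulus (phi yn.2 yn.1) &
    8 ^+ j <= modulus (phi yn.2 yn.1)].
  (* The factor [2] pays for replacing the supremum over [m] by a value above [3 / 4] of it, which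
     still exceeds [8 ^+ j]; [4 / 3] is the inverse of [3 / 4]. *)
  have [n [N H]] : exists n N, ~ (\sum_(k < N) modulus (phi n (x k)) `^ p <= (2 * 8 ^+ j) `^ p).
    apply: contrapT => H; apply: unb; exists ((2 * 8 ^+ j) `^ p) => n N.
    by apply: contrapT => H'; apply: H; exists n, N.
  have e0 : 0 < 2 * 8 ^+ j :> R by rewrite mulr_gt0// exprn_gt0.
  have A0 : 0 < (2 * 8 ^+ j : R) `^ p by exact: powR_gt0.
  move/negP : H; rewrite -ltNge => /ltW /(test_vector_norming A0) [y ty].
  rewrite -powRrM mulfV ?gt_eqF// powRr1 ?(ltW e0)// => yn.
  have Xy : X y by case: ty => [N' [s [e [_ _ _ ->]]]]; exact: (X_sum (fun k => (s k `^ (p - 1))%:C * e k)).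
  have [M M0 ME] := NX_fin Xy.
  pose Y := [set modulus (phi m y) | m in [set: nat]].
  have hY : has_sup Y.
    split; first by exists (modulus (phi 0 y)), 0%N.
    exists (C * M) => _ [m _ <-]; have := phi_le m Xy; by rewrite ME -EFinM lee_fin.
  have sY m : modulus (phi m y) <= sup Y by apply: sup_upper_bound => //; exists m.
  have s0 : 2 * 8 ^+ j <= sup Y by apply: le_trans yn (sY n).
  have sp : 0 < sup Y by exact: lt_le_trans s0.
  have q0 : 0 < sup Y / 4 by rewrite divr_gt0.
  have [_ [m _ <-] mP] := sup_adherent q0 hY.
  exists (y, m); split => //= [k|].
    apply: le_trans (sY k) _; lra.
  have : 0 < 8 ^+ j :> R by exact: exprn_gt0.
  lra.
have [yn ynP] := choice pick.
have [psi bpsi H] := @gliding_hump (fun j => (yn j).1) (fun j => (yn j).2)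
  (fun j => let: And4 _ h _ _ := ynP j in h) (fun j => let: And4 _ _ h _ := ynP j in h)
  (fun j => let: And4 _ _ _ h := ynP j in h).
have [E EP] := test_vector_weak bpsi.
have E0 : 0 <= E by apply: le_trans (EP _ (let: And4 h _ _ _ := ynP 0%N in h)).
have := archi_boundP (mulr_ge0 (ler0n R 2) E0); set m := Num.bound _ => mP.
have h1 := H m; have h2 := EP _ (let: And4 h _ _ _ := ynP m in h).
have h3 : m%:R <= 2 ^+ m :> R by rewrite -natrX ler_nat ltnW// ltn_expl.
have h4 := le_trans h1 h2; lra.
Qed.

End UniformBoundedness.

(** * Sufficiency *)

Section FockLinear.
Context {R : realType}.
Variable alpha : R.
Hypothesis alpha_gt0 : 0 < alpha.
Implicit Types (f u v : R[i] -> R[i]) (z a : R[i]) (N r : R).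
Local Notation "'g[ f ]" := (gauss_modulus alpha f) (at level 0, format "''g[' f ]").

Lemma entire_lin a u v : entire u -> entire v -> entire (a *: u + v).
Proof.
move=> /entire_cdiffable du /entire_cdiffable dv; apply/entireP => z.
have : cdiffable (fun z => a * u z + v z) z by
  apply: cdiffableD => //; apply: cdiffableM => //; exact: cdiffable_cst.
by move=> [l lP]; exists l.
Qed.

Lemma gauss_modulus_lin a u v z :
  'g[a *: u + v] z <= modulus a * 'g[u] z + 'g[v] z.
Proof.
rewrite /gauss_modulus mulrA -mulrDl; apply: ler_wpM2r; first exact: expR_ge0.
by rewrite -modulusM; exact: ler_modulusD.
Qed.

Lemma powR_add_le (x y r : R) : 0 <= x -> 0 <= y -> 0 <= r ->
  (x + y) `^ r <= 2 `^ r * (x `^ r + y `^ r).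
Proof.
move=> x0 y0 r0.
suff H (a b : R) : 0 <= a -> a <= b -> (a + b) `^ r <= 2 `^ r * (a `^ r + b `^ r).
  have [xy|/ltW yx] := leP x y; first exact: H.
  by rewrite addrC [X in 2 `^ r * X]addrC; exact: H.
move=> a0 ab; have b0 := le_trans a0 ab.
apply: (@le_trans _ _ ((2 * b) `^ r)).
  by apply: ge0_ler_powR; rewrite ?nnegrE ?addr_ge0 ?mulr_ge0//; lra.
by rewrite powRM// ler_wpM2l ?powR_ge0// lerDr powR_ge0.
Qed.

Lemma Fock_norm_ge0 (q : \bar R) f : (0 <= Fock_norm alpha q f)%E.
Proof.
case: q => [r| |//]; first exact: poweR_ge0.
apply: (@le_trans _ _ ('g[f] 0)%:E); first by rewrite lee_fin gauss_modulus_ge0.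
by apply: ereal_sup_ubound; exists 0.
Qed.

Lemma Fock_norm_fin (q : \bar R) f : Fock alpha q f ->
  exists2 N : R, 0 <= N & Fock_norm alpha q f = N%:E.
Proof.
move=> [_ H]; have H0 := Fock_norm_ge0 q f.
exists (fine (Fock_norm alpha q f)); first exact: fine_ge0.
by rewrite fineK// ge0_fin_numE.
Qed.

Lemma Fock_norm_le_integral r f (I : R) : 0 < r ->
  (\int[leb2]_w ('g[f] (cplx w) `^ r)%:E <= I%:E)%E ->
  (Fock_norm alpha r%:E f <= ((Fock_cst alpha r * I) `^ r^-1)%:E)%E.
Proof.
move=> r0 H; have k0 := Fock_cst_gt0 alpha_gt0 r0.
have I0 : 0 <= I by rewrite -lee_fin; apply: le_trans H; exact: gauss_integral_ge0.
apply/Fock_norm_finP => //; first exact: powR_ge0.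
rewrite -powRrM mulVf ?gt_eqF// powRr1 ?EFinM; last by rewrite mulr_ge0// ltW.
by apply: lee_wpmul2l => //; rewrite lee_fin ltW.
Qed.

Lemma Fock_lin (q : \bar R) a u v : (1 <= q)%E ->
  Fock alpha q u -> Fock alpha q v -> Fock alpha q (a *: u + v).
Proof.
move=> q1 Fu Fv; have [N N0 NE] := Fock_norm_fin Fu; have [M M0 ME] := Fock_norm_fin Fv.
have euv : entire (a *: u + v) := @entire_lin a _ _ Fu.1 Fv.1.
split=> //; case: q q1 Fu Fv NE ME => [r| |//]; last first.
  move=> _ Fu Fv NE ME; apply: (@le_lt_trans _ _ (modulus a * N + M)%:E); last exact: ltry.
  apply/Fock_norm_infP => z; apply: le_trans (gauss_modulus_lin _ _ _ _) _.
  have [/Fock_norm_infP H1 /Fock_norm_infP H2] : (Fock_norm alpha +oo u <= N%:E)%E /\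
    (Fock_norm alpha +oo v <= M%:E)%E by rewrite NE ME.
  by apply: lerD (H2 z); exact: ler_wpM2l.
rewrite lee_fin => r1 [eu _] [ev _] NE ME; have r0 : 0 < r by exact: lt_le_trans r1.
have lu : (Fock_norm alpha r%:E u <= N%:E)%E by rewrite NE.
have lv : (Fock_norm alpha r%:E v <= M%:E)%E by rewrite ME.
have [iu _] := integrable_gauss_modulus alpha_gt0 (entire_cdiffable eu) r0 N0 lu.
have [iv _] := integrable_gauss_modulus alpha_gt0 (entire_cdiffable ev) r0 M0 lv.
pose h (w : plane R) := 2 `^ r * (modulus a `^ r * 'g[u] (cplx w) `^ r + 'g[v] (cplx w) `^ r).
have ih : integrable leb2 setT (EFin \o h).
  have := integrableZl measurableT (2 `^ r)
    (integrableD measurableT (integrableZl measurableT (modulus a `^ r) iu) iv).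
  by apply: eq_integrable.
have H : (\int[leb2]_w ('g[a *: u + v] (cplx w) `^ r)%:E <= (\int[leb2]_w h w)%:E)%E.
  rewrite fineK; last exact: integrable_fin_num.
  apply: ge0_le_integral => //.
  - by move=> w _; rewrite lee_fin powR_ge0.
  - apply/measurable_EFinP; apply: (measurableT_comp (measurable_powR r)).
    exact: measurable_gauss_modulus (entire_cdiffable euv).
  - exact: measurable_int ih.
  move=> w _; rewrite lee_fin /h -powRM ?gauss_modulus_ge0//.
  apply: le_trans (powR_add_le _ _ (ltW r0)); rewrite ?mulr_ge0 ?gauss_modulus_ge0//.
  apply: ge0_ler_powR; rewrite ?nnegrE ?gauss_modulus_ge0 ?addr_ge0 ?mulr_ge0 ?gauss_modulus_ge0 ?(ltW r0)//.
  exact: gauss_modulus_lin.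
by apply: le_lt_trans (Fock_norm_le_integral r0 H) _; exact: ltry.
Qed.

Lemma Fock0 (q : \bar R) : (1 <= q)%E -> Fock alpha q 0.
Proof.
have g0 z : 'g[0] z = 0 by rewrite /gauss_modulus modulus0 mul0r.
move=> q1; split.
  by apply/entireP => z; exists 0; exact: cdiff_cst.
case: q q1 => [r| |//]; last first.
  move=> _; apply: (@le_lt_trans _ _ 0%E) => //; apply/Fock_norm_infP => z.
  by rewrite g0.
rewrite lee_fin => r1; have r0 : 0 < r by exact: lt_le_trans r1.
apply: (@le_lt_trans _ _ ((Fock_cst alpha r * 0) `^ r^-1)%:E); last exact: ltry.
apply: Fock_norm_le_integral => //; rewrite integral0_eq// => w _.
by rewrite g0 powR0// gt_eqF.
Qed.

(** Estimates are proved for every positive [N] above the norm, which avoids dividing by a norm that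
    may be [0]; letting [N] decrease to the norm gives the linear bound. *)
Lemma homogeneous_bound (x NX : \bar R) (N0 C : R) : 0 < C -> 0 <= N0 -> NX = N0%:E ->
  (forall N, 0 < N -> (NX <= N%:E)%E -> (x <= (C * N)%:E)%E) -> (x <= C%:E * NX)%E.
Proof.
move=> C0 N00 -> H; apply/lee_addgt0Pr => e e0.
have eC : 0 < e / C by exact: divr_gt0.
have := H (N0 + e / C) (ltr_wpDl N00 eC); rewrite lee_fin lerDl (ltW eC).
move=> /(_ isT) /le_trans; apply; rewrite -EFinM -EFinD lee_fin; apply: eq_ler.
by field; rewrite gt_eqF.
Qed.

Lemma conj_exponent_ge2 (p : R) (q : \bar R) : 1 <= p -> p <= 2 ->
  (p%:E^-1 + q^-1 = 1)%E -> (2%:E <= q)%E.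
Proof.
move=> p1 p2; have p0 : 0 < p by exact: lt_le_trans p1.
have ip : 2^-1 <= p^-1 by rewrite lef_pV2 ?posrE.
have ip1 : p^-1 <= 1 by rewrite invf_le1.
case: q => [r| |]; last 2 first.
- by rewrite leey.
- by rewrite inver gt_eqF.
rewrite !inver gt_eqF//; case: eqP => [//|/eqP r0] [E].
have {}E : p^-1 + r^-1 = 1 by exact: E.
have ir : r^-1 = 1 - p^-1 by apply/eqP; rewrite eq_sym subr_eq addrC E.
have r0' : 0 < r.
  by rewrite -invr_gt0 lt_neqAle eq_sym invr_eq0 r0 /= ir subr_ge0.
by rewrite lee_fin -[2]invrK -[r]invrK lef_pV2 ?posrE ?invr_gt0// ir; lra.
Qed.

End FockLinear.

Section HausdorffLinear.
Context {R : realType}.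
Variable mu : {measure set (measurableTypeR R) -> \bar R}.
Local Notation D := (`]0%R, +oo[%classic : set (measurableTypeR R)).

Lemma integrableCZ (g : measurableTypeR R -> R[i]) (c : R[i]) : integrableC mu D g ->
  integrableC mu D (fun t => c * g t).
Proof.
move=> [r s]; have mD : measurable D by exact: measurable_itv.
have rZ (k : R) := integrableZl mD k r; have sZ (k : R) := integrableZl mD k s; split.
- have := integrableB mD (rZ (complex.Re c)) (sZ (complex.Im c)).
  by apply: eq_integrable => // t _; rewrite [in RHS]cReM.
- have := integrableD mD (sZ (complex.Re c)) (rZ (complex.Im c)).
  by apply: eq_integrable => // t _; rewrite [in RHS]cImM.
Qed.

Lemma hausdorff_lin (a : R[i]) (u v : R[i] -> R[i]) z :
  integrableC mu D (hausdorff_integrand u z) -> integrableC mu D (hausdorff_integrand v z) ->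
  hausdorff mu (a *: u + v) z = a * hausdorff mu u z + hausdorff mu v z.
Proof.
move=> iu iv; have mD : measurable D by exact: measurable_itv.
rewrite /hausdorff -(integralCZ a mD iu) -integralCD//; last exact: integrableCZ.
congr integralC; apply/funext => t; rewrite /hausdorff_integrand.
by rewrite mulrA -mulrDl.
Qed.

End HausdorffLinear.

Section Sufficiency.
Context {R : realType}.
Variable mu : {measure set (measurableTypeR R) -> \bar R}.
Variables (alpha p S : R) (q : \bar R).
Hypothesis alpha_gt0 : 0 < alpha.
Hypothesis p_ge1 : 1 <= p.
Hypothesis p_le2 : p <= 2.
Hypothesis conj_pq : (p%:E^-1 + q^-1 = 1)%E.
Local Notation V n := (gauss_moment alpha n.*2).
Local Notation m k := (fine (moment mu k)).
Let k1 k : R := k.+1%:R `^ ((2 - p) / 2).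
Hypothesis S_gt0 : 0 < S.
Hypothesis momentS : forall n, (moment mu n <= S%:E)%E.
Hypothesis series_le : forall N, \sum_(k < N) m k `^ p * k1 k <= S.

(** The loss in [tcoef_Fock_le]; its [p]-th power is precisely the weight [k1 k] of the series. *)
Let h k : R := k.+1%:R `^ (p^-1 - 2^-1).
Let phi k (f : R[i] -> R[i]) : R[i] := tcoef f k * (Num.sqrt (V k) / h k)%:C.

Let p_gt0 : 0 < p. Proof. exact: lt_le_trans p_ge1. Qed.
Let q_ge2 : (2%:E <= q)%E. Proof. exact: conj_exponent_ge2 conj_pq. Qed.
Let q_ge1 : (1 <= q)%E.
Proof. by apply: le_trans q_ge2; rewrite lee_fin ler1n. Qed.
Let h_gt0 k : 0 < h k. Proof. by rewrite powR_gt0. Qed.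
Let hp k : h k `^ p = k1 k.
Proof. by rewrite -powRrM; congr (_ `^ _); field; rewrite gt_eqF. Qed.
Let m_ge0 k : 0 <= m k. Proof. by apply: fine_ge0; exact: moment_ge0. Qed.

Let phi_bound : exists2 C : R, 0 < C & forall k f, Fock alpha q f ->
  ((modulus (phi k f))%:E <= C%:E * Fock_norm alpha q f)%E.
Proof.
have [C C0 CP] := tcoef_Fock_le alpha_gt0 p_ge1 p_le2 conj_pq q_ge1.
exists C => // k f Ff; have [N0 N00 NE] := Fock_norm_fin Ff.
apply: (homogeneous_bound C0 N00 NE) => N Ngt0 fN; rewrite lee_fin.
rewrite modulusM modulus_real ger0_norm; last by rewrite divr_ge0 ?sqrtr_ge0// ltW.
rewrite mulrA ler_pdivrMr//; apply: le_trans (CP f N k Ff.1 Ngt0 fN) _.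
by apply: eq_ler; rewrite /h; ring.
Qed.

Let image_bound : exists2 C : R, 0 < C & forall f A, Fock alpha q f -> 0 < A ->
  (forall N, \sum_(k < N) m k `^ p * k1 k * modulus (phi k f) `^ p <= A) ->
  entire (hausdorff mu f) /\
  (Fock_norm alpha q (hausdorff mu f) <= (C * A `^ p^-1)%:E)%E.
Proof.
have [C C0 CP] := Fock_power_series_le alpha_gt0 q_ge2.
exists C => // f A [ef _] A0 fA.
pose c k : R[i] := (m k)%:C * tcoef f k; pose B := A `^ p^-1.
have B0 : 0 < B by exact: powR_gt0.
have BpA : B `^ p = A by rewrite -powRrM mulVf ?gt_eqF// powRr1// ltW.
pose x k := m k * (modulus (tcoef f k) * Num.sqrt (V k)).
have x0 k : 0 <= x k by rewrite !mulr_ge0 ?sqrtr_ge0.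
have xp k : x k `^ p = m k `^ p * k1 k * modulus (phi k f) `^ p.
  transitivity ((m k * h k * modulus (phi k f)) `^ p); last first.
    by rewrite !powRM ?mulr_ge0 ?(ltW (h_gt0 k))// hp.
  congr (_ `^ _); rewrite /x -mulrA; congr (_ * _).
  rewrite /phi (modulusM (tcoef f k)) modulus_real ger0_norm; last by rewrite divr_ge0 ?sqrtr_ge0// ltW.
  by field; rewrite gt_eqF.
have xB k : x k <= B.
  apply: (@le_trans _ _ ((x k `^ p) `^ p^-1)).
    by rewrite -powRrM mulfV ?gt_eqF// powRr1.
  apply: ge0_ler_powR; rewrite ?nnegrE ?powR_ge0 ?invr_ge0 ?(ltW A0) ?(ltW p_gt0)//.
  apply: le_trans (fA k.+1); rewrite big_ord_recr /= xp lerDr.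
  by apply: sumr_ge0 => j _; rewrite !mulr_ge0 ?powR_ge0.
(* As [x k <= B], [x_k^2 <= B^(2-p) x_k^p], and the sum is at most [B^(2-p) B^p]. *)
have cB N : \sum_(k < N) modulus (c k) ^+ 2 * V k <= B ^+ 2.
  apply: (@le_trans _ _ (\sum_(k < N) B `^ (2 - p) * x k `^ p)).
    apply: ler_sum => k _.
    have -> : modulus (c k) ^+ 2 * V k = x k ^+ 2.
      have sv : Num.sqrt (V k) ^+ 2 = V k by rewrite sqr_sqrtr// gauss_moment_ge0.
      by rewrite modulusM modulus_real ger0_norm// /x !exprMn sv mulrA.
    have [->|xn0] := eqVneq (x k) 0; first by rewrite expr0n /= mulr_ge0 ?powR_ge0.
    rewrite -powR_mulrn// -{1}(subrK p 2) powRD; last by rewrite xn0 implybT.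
    apply: ler_wpM2r; first exact: powR_ge0.
    by apply: ge0_ler_powR; rewrite ?nnegrE ?subr_ge0// ltW.
  rewrite -mulr_sumr; apply: (@le_trans _ _ (B `^ (2 - p) * A)).
    by apply: ler_wpM2l; rewrite ?powR_ge0//; under eq_bigr do rewrite xp.
  rewrite -BpA -powRD; last by apply/implyP => _; rewrite gt_eqF.
  by rewrite subrK powR_mulrn// ltW.
have cf z : ccvg (fun N => \sum_(k < N) c k * z ^+ k) (hausdorff mu f z).
  exact: (hausdorff_series momentS z (entire_cdiffable ef)).2.
split; first exact: power_series_entire cB cf.
exact: CP cB cf.
Qed.

Lemma hausdorff_sufficient : hausdorff_summing mu alpha q p%:E.
Proof.
have [C0 C00 C0P] := phi_bound; have [C1 C10 C1P] := image_bound.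
have intf f : Fock alpha q f -> forall z,
    integrableC mu `]0%R, +oo[%classic (hausdorff_integrand f z).
  by move=> [ef _] z; exact: (hausdorff_series momentS z (entire_cdiffable ef)).1.
have bnd f N : Fock alpha q f -> 0 < N -> (Fock_norm alpha q f <= N%:E)%E ->
    entire (hausdorff mu f) /\
    (Fock_norm alpha q (hausdorff mu f) <= (C1 * S `^ p^-1 * C0 * N)%:E)%E.
  move=> Ff N0 fN; have CN : 0 < C0 * N by rewrite mulr_gt0.
  have [||ef H] := C1P f (S * (C0 * N) `^ p) Ff; first by rewrite mulr_gt0 ?powR_gt0.
    move=> n; apply: le_trans (ler_wpM2r (powR_ge0 _ _) (series_le n)).
    rewrite mulr_suml; apply: ler_sum => k _; apply: ler_wpM2l; first by rewrite mulr_ge0 ?powR_ge0.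
    apply: ge0_ler_powR; rewrite ?nnegrE ?(ltW p_gt0) ?(ltW CN)//.
    have := C0P k f Ff; rewrite -lee_fin EFinM => /le_trans; apply.
    by apply: lee_wpmul2l => //; rewrite lee_fin ltW.
  split=> //; apply: le_trans H _; rewrite lee_fin; apply: eq_ler.
  rewrite powRM ?powR_ge0 ?(ltW S_gt0)// -powRrM mulfV ?gt_eqF// powRr1 ?(ltW CN)//.
  by rewrite !mulrA.
have Cp : 0 < C1 * S `^ p^-1 * C0 by rewrite !mulr_gt0 ?powR_gt0.
have HF f : Fock alpha q f -> Fock alpha q (hausdorff mu f).
  move=> Ff; have [N0 N00 NE] := Fock_norm_fin Ff.
  have [||ef H] := bnd f (N0 + 1) Ff; first by rewrite ltr_wpDl.
    by rewrite NE lee_fin lerDl.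
  by split=> //; apply: le_lt_trans H _; exact: ltry.
split=> //; split; first split.
- exact: HF.
- by move=> a u v Fu Fv; apply/funext => z; apply: hausdorff_lin; exact: intf.
- exists (C1 * S `^ p^-1 * C0) => f Ff; have [N0 N00 NE] := Fock_norm_fin Ff.
  by apply: (homogeneous_bound Cp N00 NE) => N Ngt0 fN; exact: (bnd f N Ff Ngt0 fN).2.
move=> x Fx weak.
have phi_lin n (a : R[i]) u v : Fock alpha q u -> Fock alpha q v ->
    phi n (a *: u + v) = a * phi n u + phi n v.
  move=> [eu _] [ev _]; rewrite /phi.
  have := @tcoefD _ u v a n (fun z => cdiffable_cont (entire_cdiffable eu z))
    (fun z => cdiffable_cont (entire_cdiffable ev z)).
  by move=> E; rewrite -[tcoef (a *: u + v) n]/(tcoef (fun z => a * u z + v z) n) E; ring.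
have [K KP] := @uniform_weak_bound R _ (Fock alpha q) (Fock_norm alpha q) phi x p C0
  p_ge1 (Fock0 alpha_gt0 q_ge1) (fun a u v => Fock_lin alpha_gt0 a q_ge1)
  (@Fock_norm_fin _ alpha q) phi_lin C00 C0P Fx weak.
pose a k n := m n `^ p * k1 n * modulus (phi n (x k)) `^ p.
have a0 k n : (0 <= (a k n)%:E)%E by rewrite lee_fin !mulr_ge0 ?powR_ge0.
have aA k : exists2 A : R, 0 <= A & (\sum_(0 <= n <oo) (a k n)%:E = A%:E)%E.
  have [N0 N00 NE] := Fock_norm_fin (Fx k).
  have H0 : (0 <= \sum_(0 <= n <oo) (a k n)%:E)%E by apply: nneseries_ge0.
  exists (fine (\sum_(0 <= n <oo) (a k n)%:E)%E); first exact: fine_ge0.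
  rewrite fineK// ge0_fin_numE//; apply/nneseries_ltyP => //.
  exists (S * (C0 * N0) `^ p) => N; rewrite sumEFin lee_fin.
  apply: le_trans (ler_wpM2r (powR_ge0 _ _) (series_le N)).
  rewrite mulr_suml; apply: ler_sum => j _; apply: ler_wpM2l; first by rewrite mulr_ge0 ?powR_ge0.
  apply: ge0_ler_powR; rewrite ?nnegrE ?(ltW p_gt0) ?mulr_ge0 ?(ltW C00)//.
  by have := C0P j (x k) (Fx k); rewrite NE -EFinM lee_fin.
pose A k := fine (\sum_(0 <= n <oo) (a k n)%:E)%E.
have AP k : 0 <= A k /\ (\sum_(0 <= n <oo) (a k n)%:E = (A k)%:E)%E.
  by have [B B0 BE] := aA k; rewrite /A BE.
(* Exchanging the sums, the inner sum over [k] is at most [K] uniformly in [n], which leaves the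
   given series. *)
have SA N : \sum_(k < N) A k <= S * K.
  rewrite -lee_fin -sumEFin; under eq_bigr do rewrite -(AP _).2.
  have E := @nneseries_sum _ (index_enum 'I_N) xpredT R (fun (k : 'I_N) n => (a k n)%:E) 0
    (fun k n _ => a0 k n).
  suff : (\sum_(0 <= n <oo) \sum_(k < N) (a k n)%:E <= (S * K)%:E)%E by rewrite E; exact: id.
  apply: lime_le; first by apply: is_cvg_nneseries => n _ _; exact: sume_ge0.
  apply: nearW => M; rewrite big_mkord.
  under eq_bigr do rewrite sumEFin; rewrite sumEFin lee_fin.
  have K0 : 0 <= K by apply: le_trans (KP 0%N 0%N); rewrite big_ord0.
  apply: le_trans (ler_wpM2r K0 (series_le M)); rewrite mulr_suml.
  apply: ler_sum => n _; rewrite /a -mulr_sumr; apply: ler_wpM2l (KP _ _).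
  by rewrite mulr_ge0 ?powR_ge0.
apply/nneseries_ltyP; first by move=> n; exact: poweR_ge0.
exists (C1 `^ p * (S * K + 2)) => N.
(* [image_bound] asks for a positive bound and [A k] may be [0]; the added geometric terms sum to at
   most [2]. *)
apply: (@le_trans _ _ (\sum_(k < N) (C1 `^ p * (A k + 2^-1 ^+ k))%:E)%E).
  apply: lee_sum => k _; have e0 : 0 < A k + 2^-1 ^+ k.
    by rewrite ltr_wpDl ?(AP k).1// exprn_gt0// invr_gt0.
  have [n|_ H] := C1P (x k) _ (Fx k) e0.
    apply: (@le_trans _ _ (A k)); last by rewrite lerDl exprn_ge0// invr_ge0.
    rewrite -lee_fin -(AP k).2 -sumEFin.
    by have := nneseries_lim_ge n (fun j _ _ => a0 k j) (P := xpredT) (m := 0%N); rewrite big_mkord.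
  have := @gt0_ler_poweR _ p (ltW p_gt0) _ _ _ _ H.
  rewrite !in_itv /= !leey !andbT lee_fin => /(_ (Fock_norm_ge0 _ _ _)).
  move=> /(_ (mulr_ge0 (ltW C10) (powR_ge0 _ _))) /le_trans; apply.
  rewrite lee_fin powRM ?powR_ge0 ?(ltW C10)// -powRrM mulVf ?gt_eqF//.
  by rewrite powRr1// ltW.
rewrite sumEFin lee_fin -mulr_sumr; apply: ler_wpM2l; first exact: powR_ge0.
rewrite big_split /=; apply: lerD; first exact: SA.
apply: le_trans (geometric_sum_le N _ _) _; try lra.
by apply: eq_ler; field.
Qed.

End Sufficiency.

(** * Necessity *)

Section LatticeSums.
Context {R : realType}.

Let rho : R := expR (- 10^-1).
Let rho_ge0 : 0 <= rho. Proof. exact: expR_ge0. Qed.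
Let rho_lt1 : rho < 1. Proof. by rewrite expR_lt1 oppr_lt0 invr_gt0. Qed.

Let gauss_le_rho (u : R) i : i%:R <= `|u| -> expR (- (10^-1 * u ^+ 2)) <= rho ^+ i.
Proof.
move=> iu; rewrite -expRM_natl ler_expR mulrN lerN2 [leLHS]mulrC; apply: ler_wpM2l => //.
rewrite -(real_normK (num_real u)); apply: le_trans (lerXn2r 2 _ _ iu); rewrite ?nnegrE//.
by rewrite -natrX ler_nat; case: (i) => // j; rewrite expnS expn1 leq_pmulr.
Qed.

(** On either side of [x] the distances to the integers grow by [1], and [u^2 >= i] once [|u| >= i],
    so each half is dominated by a geometric series of ratio [rho]. *)
Lemma lattice_sum_le : exists2 C : R, 0 < C & forall (x : R) N,
  \sum_(s < N) expR (- (10^-1 * (x - s%:R) ^+ 2)) <= C.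
Proof.
exists (2 * (1 - rho)^-1); first by rewrite mulr_gt0// invr_gt0 subr_gt0.
move=> x N; have G n := geometric_sum_le n rho_ge0 rho_lt1.
have i0 : 0 <= (1 - rho)^-1 by rewrite invr_ge0 subr_ge0 ltW.
have [x0|x0] := leP 0 x; last first.
  apply: (@le_trans _ _ (\sum_(s < N) rho ^+ s)).
    apply: ler_sum => s _; apply: gauss_le_rho; rewrite distrC.
    by apply: le_trans (ler_norm _); rewrite lerDl oppr_ge0 ltW.
  by apply: le_trans (G N) _; lra.
pose k := Num.truncn x; have /andP[kx xk] := truncn_itv x0.
apply: (@le_trans _ _ (\sum_(s < k.+1 + N) expR (- (10^-1 * (x - s%:R) ^+ 2)))).
  rewrite addnC big_split_ord /= lerDl; apply: sumr_ge0 => s _; exact: expR_ge0.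
rewrite big_split_ord /= mulr_natl mulr2n; apply: lerD.
  apply: le_trans (G k.+1); rewrite (reindex_inj rev_ord_inj) /=.
  apply: ler_sum => s _; apply: gauss_le_rho.
  have sk : (s <= k)%N by rewrite -ltnS.
  rewrite subSS (natrB _ sk); apply: le_trans (ler_norm _).
  by move: kx; rewrite -/k; lra.
apply: le_trans (G N); apply: ler_sum => s _; apply: gauss_le_rho; rewrite distrC.
by apply: le_trans (ler_norm _); rewrite natrD -/k; move: xk; rewrite -/k; lra.
Qed.

Definition lattice_step (p : nat * nat) : nat * nat :=
  if p.2 == p.1.*2 then (p.1.+1, 0%N) else (p.1, p.2.+1).

(* The points [(s, j)] with [j <= 2 s], enumerated so that [n = s ^ 2 + j]. *)
Definition lattice_pt n : nat * nat := iter n lattice_step (0%N, 0%N).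

Lemma lattice_ptP n : ((lattice_pt n).1 ^ 2 + (lattice_pt n).2 = n)%N /\
  ((lattice_pt n).2 <= (lattice_pt n).1.*2)%N.
Proof.
elim: n => // n [ih1 ih2]; rewrite /lattice_pt iterS -/(lattice_pt n) /lattice_step.
move: ih1 ih2; case: (lattice_pt n) => s j /= E jl; case: ifP => [/eqP js|/negbT js] /=.
  by split=> //; rewrite addn0 -E js -(addn1 s) sqrnD exp1n muln1 mul2n addnAC addn1.
by split; [rewrite addnS E|rewrite ltn_neqAle js].
Qed.

Lemma lattice_pt_norm n :
  ((lattice_pt n).1 ^ 2 + (lattice_pt n).2 ^ 2 <= 5 * n)%N.
Proof.
have [] := lattice_ptP n; case: (lattice_pt n) => s j /= E jl.
have j2 : (j ^ 2 <= 4 * s ^ 2)%N by rewrite -[4%N]/(2 ^ 2)%N -expnMn mul2n leq_exp2r.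
by rewrite -E mulnDr; apply: leq_trans (leq_addr _ _); rewrite (mulSn 4) leq_add2l.
Qed.

(** The points are distinct, as [n] is recovered as [s ^ 2 + j], and the first [N] of them lie in a
    square of side [N + 1]. *)
Lemma lattice_pt_sum_le (F : nat -> R) (G : nat -> R) N :
  (forall s, 0 <= F s) -> (forall s, 0 <= G s) ->
  \sum_(n < N) F (lattice_pt n).1 * G (lattice_pt n).2 <=
  (\sum_(s < N.+1) F s) * (\sum_(j < N.+1) G j).
Proof.
move=> F0 G0; rewrite big_distrlr /= pair_big /=.
have b n : (n < N -> (lattice_pt n).1 < N.+1 /\ (lattice_pt n).2 < N.+1)%N.
  move=> nN; have [E _] := lattice_ptP n; split; rewrite ltnS; apply: leq_trans (ltnW nN).
    apply: (@leq_trans ((lattice_pt n).1 ^ 2)%N); last by rewrite -[X in (_ <= X)%N]E leq_addr.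
    by case: (_.1) => // s; rewrite expnS expn1 leq_pmulr.
  by rewrite -[X in (_ <= X)%N]E leq_addl.
pose h (n : 'I_N) : 'I_N.+1 * 'I_N.+1 := (inord (lattice_pt n).1, inord (lattice_pt n).2).
have h1 n : ((h n).1 = (lattice_pt n).1 :> nat) * ((h n).2 = (lattice_pt n).2 :> nat).
  by have [b1 b2] := b n (ltn_ord n); rewrite /h /= !inordK.
have hinj : injective h.
  move=> n n' hn; apply: val_inj => /=; have [<- _] := lattice_ptP n.
  by have [<- _] := lattice_ptP n'; rewrite -!h1 hn.
clearbody h; rewrite [leRHS](bigID (mem (imset h (mem (@predT 'I_N))))) /= -[leLHS]addr0; apply: lerD; last first.
  by apply: sumr_ge0 => p _; rewrite mulr_ge0.
rewrite big_imset /=; last by move=> n n' _ _; exact: hinj.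
by apply: ler_sum => n _; rewrite !h1.
Qed.

End LatticeSums.

(** * Weak summability of the kernels at lattice points *)

Section Kernels.
Context {R : realType}.
Variable alpha : R.
Hypothesis alpha_gt0 : 0 < alpha.
Implicit Types (z w : R[i]).
Local Notation "'g[ f ]" := (gauss_modulus alpha f) (at level 0, format "''g[' f ]").

(* The normalised reproducing kernel at [w]. *)
Definition fock_kernel w z : R[i] :=
  cexp (alpha%:C * z * w^* - (alpha / 2 * modulus w ^+ 2)%:C).

Lemma gauss_kernel w z :
  'g[fock_kernel w] z = expR (- (alpha / 2 * modulus (z - w) ^+ 2)).
Proof.
rewrite /gauss_modulus modulus_cexp -expRD; congr expR.
by rewrite !sqr_modulus; case: z => a b; case: w => c d /=; field.
Qed.

Lemma entire_kernel w : entire (fock_kernel w).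
Proof.
apply/entireP => z; apply: cdiffable_comp; first exact: cdiffable_cexp.
apply: cdiffableD; last exact: cdiffable_cst.
apply: cdiffableM; last exact: cdiffable_cst.
by apply: cdiffableM; [exact: cdiffable_cst|exact: cdiffable_id].
Qed.

Let a20 : 0 < alpha / 2. Proof. by rewrite divr_gt0. Qed.
Let I0 : R := gauss_moment (alpha / 2) 0.

Lemma integral_gauss_kernel w :
  (\int[leb2]_v ('g[fock_kernel w] (cplx v))%:E = I0%:E)%E.
Proof.
have mg b : measurable_fun setT (fun v : plane R => (gauss2 b v)%:E).
  by apply/measurable_EFinP; exact: measurable_gauss2.
rewrite /I0 -gauss_momentE//.
have T := @ge0_integral_plane_translation _ (- complex.Re w) (- complex.Im w) _ (mg (alpha / 2))
  (fun v => expR_ge0 _).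
transitivity (\int[leb2]_v (gauss2 (alpha / 2) v)%:E)%E; last first.
  by apply: eq_integral => v _; rewrite expr0 mul1r.
apply: eq_trans T; apply: eq_integral => v _; rewrite gauss_kernel /gauss2.
by congr ((expR (- (_ * modulus _ ^+ 2)))%:E); case: (w).
Qed.

Lemma gauss_kernel_le1 w z : 'g[fock_kernel w] z <= 1.
Proof.
rewrite gauss_kernel -[leRHS]expR0 ler_expR oppr_le0 mulr_ge0 ?sqr_ge0//; exact: ltW.
Qed.

(** The bump is at most [1], so its [r]-th power is at most itself, and its integral does not depend
    on [w]. *)
Lemma Fock_kernel_norm_le (a : \bar R) : (1 <= a)%E -> exists2 C : R, 0 < C &
  forall w, (Fock_norm alpha a (fock_kernel w) <= C%:E)%E.
Proof.
case: a => [r| |//]; last first.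
  by move=> _; exists 1 => // w; apply/Fock_norm_infP => z; exact: gauss_kernel_le1.
rewrite lee_fin => r1; have r0 : 0 < r by exact: lt_le_trans r1.
exists ((Fock_cst alpha r * I0) `^ r^-1).
  by rewrite powR_gt0// mulr_gt0 ?Fock_cst_gt0// gauss_moment0_gt0.
move=> w; apply: Fock_norm_le_integral => //; rewrite -(integral_gauss_kernel w).
have mg := @measurable_gauss_modulus _ alpha _ (entire_cdiffable (@entire_kernel w)).
apply: ge0_le_integral => //.
- by move=> v _; rewrite lee_fin powR_ge0.
- by apply/measurable_EFinP; exact: measurableT_comp (measurable_powR r) mg.
- exact/measurable_EFinP.
move=> v _; rewrite lee_fin; set x := 'g[_] _; have x0 : 0 <= x by exact: gauss_modulus_ge0.
have x1 : x <= 1 by exact: gauss_kernel_le1.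
have xp : 0 < x by rewrite /x gauss_kernel expR_gt0.
by rewrite -[leRHS](powRr1 x0) ger_powR// xp.
Qed.

(** The mesh turns the [5 * n] of [lattice_pt_norm] into [n]. It also gives
    [alpha / 2 * delta^2 = 1 / 10], the exponent in [lattice_sum_le]. *)
Let delta : R := Num.sqrt (5 * alpha)^-1.
Let delta_gt0 : 0 < delta. Proof. by rewrite sqrtr_gt0 invr_gt0 mulr_gt0. Qed.
Let delta2 : alpha * delta ^+ 2 = 5^-1.
Proof.
rewrite sqr_sqrtr; last by rewrite invr_ge0 mulr_ge0// ltW.
by field; rewrite gt_eqF.
Qed.

Definition kernel_pt n : R[i] :=
  Complex (delta * (lattice_pt n).1%:R) (delta * (lattice_pt n).2%:R).

Lemma kernel_pt_le n : alpha * modulus (kernel_pt n) ^+ 2 <= n%:R.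
Proof.
rewrite sqr_modulus /= !exprMn -mulrDr mulrA delta2 -!natrX -natrD mulrC ler_pdivrMr//.
by rewrite mulrC -natrM ler_nat lattice_pt_norm.
Qed.

Lemma kernel_pt_sum_le : exists2 C : R, 0 < C & forall z N,
  \sum_(n < N) 'g[fock_kernel (kernel_pt n)] z <= C.
Proof.
have [C C0 CP] := @lattice_sum_le R; exists (C * C); first exact: mulr_gt0.
move=> z N; pose F (x : R) (s : nat) : R := expR (- (10^-1 * (x / delta - s%:R) ^+ 2)).
have E n : 'g[fock_kernel (kernel_pt n)] z =
    F (complex.Re z) (lattice_pt n).1 * F (complex.Im z) (lattice_pt n).2.
  rewrite gauss_kernel -expRD; congr expR; rewrite sqr_modulus.
  have K (x s : R) : alpha / 2 * (x - delta * s) ^+ 2 = 10^-1 * (x / delta - s) ^+ 2.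
    have -> : x - delta * s = delta * (x / delta - s) by field; rewrite gt_eqF.
    rewrite exprMn mulrA; congr (_ * _).
    rewrite mulrAC delta2; by field.
  by rewrite cReD cImD cReN cImN mulrDr opprD /= !K.
under eq_bigr do rewrite E.
have F0 x s : 0 <= F x s by exact: expR_ge0.
apply: le_trans (lattice_pt_sum_le N (F0 _) (F0 _)) _.
by apply: ler_pM; [apply: sumr_ge0 => s _; exact: F0|apply: sumr_ge0 => s _; exact: F0|exact: CP|exact: CP].
Qed.

(* With [t = Q ^ 1/r], [c <= t + c ^ r t ^ (1-r)] replaces Jensen's inequality. *)
Lemma weighted_sum_powR_le (r C : R) (c G : nat -> R) N : 1 <= r -> 0 < C ->
  (forall k, 0 <= c k) -> (forall k, 0 < G k) -> \sum_(k < N) G k <= C ->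
  (\sum_(k < N) c k * G k) `^ r <= (C + 1) `^ r * \sum_(k < N) c k `^ r * G k.
Proof.
move=> r1 C0 c0 G0 GC; have r0 : 0 < r by exact: lt_le_trans r1.
set Q := \sum_(k < N) c k `^ r * G k.
have Qk k : 0 <= c k `^ r * G k by rewrite mulr_ge0 ?powR_ge0// ltW.
have [Q0|Qn0] := eqVneq Q 0.
  rewrite Q0 mulr0 big1 ?powR0 ?gt_eqF// => k _.
  have /eqP : c k `^ r * G k = 0.
    apply/eqP; rewrite eq_le Qk andbT -Q0 /Q (bigD1 k)//= lerDl.
    by apply: sumr_ge0 => j _.
  rewrite mulf_eq0 [G k == 0]gt_eqF// orbF powR_eq0 => /andP[/eqP -> _].
  by rewrite mul0r.
have Qp : 0 < Q by rewrite lt_neqAle eq_sym Qn0 sumr_ge0// => j _.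
pose t := Q `^ r^-1; have t0 : 0 < t by exact: powR_gt0.
have tr : t `^ r = Q by rewrite -powRrM mulVf ?gt_eqF// powRr1// ltW.
have H : \sum_(k < N) c k * G k <= (C + 1) * t.
  apply: (@le_trans _ _ (\sum_(k < N) (t * G k + t `^ (1 - r) * (c k `^ r * G k)))).
    apply: ler_sum => k _; rewrite mulrA -mulrDl; apply: ler_wpM2r; first exact: ltW.
    have [ct|tc] := leP (c k) t; first by rewrite ler_wpDr// mulr_ge0 ?powR_ge0.
    apply: (@le_trans _ _ (t `^ (1 - r) * c k `^ r)); last by rewrite lerDr ltW.
    have ck0 := lt_trans t0 tc.
    rewrite -{1}(powRr1 (c0 k)) -{1}(subrK r 1) powRD; last by rewrite (gt_eqF ck0) implybT.
    apply: ler_wpM2r; first exact: powR_ge0.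
    rewrite -[1 - r]opprB !powRN lef_pV2 ?posrE ?powR_gt0//.
    by apply: ge0_ler_powR; rewrite ?nnegrE ?subr_ge0// ltW.
  rewrite big_split /= -!mulr_sumr -/Q mulrDl mul1r mulrC.
  apply: lerD; first by rewrite ler_pM2r.
  rewrite -tr -powRD; last by apply/implyP => _; rewrite gt_eqF.
  by rewrite subrK powRr1// ltW.
rewrite -tr -powRM ?(ltW t0) ?addr_ge0 ?(ltW C0)//.
apply: ge0_ler_powR H; rewrite ?nnegrE ?(ltW r0) ?mulr_ge0 ?addr_ge0 ?(ltW C0) ?(ltW t0)//.
by apply: sumr_ge0 => k _; rewrite mulr_ge0// ltW.
Qed.

Let x n := fock_kernel (kernel_pt n).

Lemma gauss_kernel_comb_le (c : nat -> R[i]) N z :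
  'g[\sum_(k < N) c k *: x k] z <= \sum_(k < N) modulus (c k) * 'g[x k] z.
Proof.
elim: N => [|N ih].
  by rewrite !big_ord0 /gauss_modulus modulus0 mul0r.
rewrite !big_ord_recr /= addrC; apply: le_trans (gauss_modulus_lin alpha _ _ _ z) _.
by rewrite [leRHS]addrC lerD2l.
Qed.

Lemma entire_kernel_comb (c : nat -> R[i]) N : entire (\sum_(k < N) c k *: x k).
Proof.
elim: N => [|N ih].
  by rewrite big_ord0; apply/entireP => z; exists 0; exact: cdiff_cst.
rewrite big_ord_recr /= addrC.
exact: (@entire_lin R (c N) (x N) _ (@entire_kernel _) ih).
Qed.

(** The bumps have bounded sum, so [weighted_sum_powR_le] moves the power [r] from the combination
    to its coefficients. Since [(b - 1) r = b], these satisfy [|c_k|^r <= s_k^b], and integration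
    leaves a multiple of their sum. For [a = +oo] the coefficients are at most [1] and the bounded
    sum suffices. *)
Lemma Fock_test_vector_le (a : \bar R) (b : R) : 1 <= b -> (1 <= a)%E ->
  (b%:E^-1 + a^-1 = 1)%E -> exists2 C : R, 0 < C &
  forall y, test_vector x b y -> (Fock_norm alpha a y <= C%:E)%E.
Proof.
move=> b1 a1 ba; have b0 : 0 < b by exact: lt_le_trans b1.
have [C C0 CP] := kernel_pt_sum_le.
case: a a1 ba => [r| |//]; last first.
  rewrite invey adde0 => _ bE; have {}bE : b = 1.
    have : (b^-1)%:E = 1%E :> \bar R by rewrite -bE inver gt_eqF.
    by move=> -[] /(congr1 GRing.inv); rewrite invrK invr1.
  exists C => // y [N [s [e [s0 e1 _ ->]]]]; apply/Fock_norm_infP => z.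
  apply: le_trans (gauss_kernel_comb_le (fun k => (s k `^ (b - 1))%:C * e k) N z) _.
  apply: le_trans (CP z N); apply: ler_sum => k _.
  rewrite bE subrr powRr0 ler_piMl ?gauss_modulus_ge0// modulusM modulus_real normr1 mul1r.
  exact: e1.
rewrite lee_fin => r1 br; have r0 : 0 < r by exact: lt_le_trans r1.
have {}br : b^-1 + r^-1 = 1.
  by apply: EFin_inj; move: br; rewrite !inver !gt_eqF.
have I00 : 0 < I0 by exact: gauss_moment0_gt0.
exists ((Fock_cst alpha r * ((C + 1) `^ r * I0)) `^ r^-1).
  by rewrite powR_gt0// mulr_gt0 ?Fock_cst_gt0// mulr_gt0// powR_gt0// addr_gt0.
move=> y [N [s [e [s0 e1 s1 ->]]]]; apply: Fock_norm_le_integral => //.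
pose c k := (s k `^ (b - 1))%:C * e k.
have cr k : modulus (c k) `^ r <= s k `^ b.
  have br' : (b - 1) * r = b.
    have E : r + b = b * r by rewrite -[RHS]mul1r -br; field; rewrite !gt_eqF.
    by rewrite mulrBl mul1r -E addrAC subrr add0r.
  have m1 : modulus (c k) <= s k `^ (b - 1).
    by rewrite modulusM modulus_real ger0_norm ?powR_ge0// ler_piMr ?powR_ge0.
  rewrite -[X in _ <= s k `^ X]br' powRrM; apply: ge0_ler_powR m1; rewrite ?nnegrE ?powR_ge0 ?(ltW r0)//.
have mx k : measurable_fun setT (fun v : plane R => ('g[x k] (cplx v))%:E).
  apply/measurable_EFinP.
  exact: measurable_gauss_modulus (entire_cdiffable (@entire_kernel _)).
have step : (\int[leb2]_v ('g[(\sum_(k < N) c k *: x k)%R] (cplx v) `^ r)%:E <=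
    ((C + 1) `^ r)%:E * \sum_(k < N) (s k `^ b)%:E * \int[leb2]_v ('g[x k] (cplx v))%:E)%E.
  have -> : (\sum_(k < N) (s k `^ b)%:E * \int[leb2]_v ('g[x k] (cplx v))%:E =
      \int[leb2]_v (\sum_(k < N) (s k `^ b)%:E * ('g[x k] (cplx v))%:E))%E.
    rewrite ge0_integral_sum//.
    - apply: eq_bigr => k _; rewrite ge0_integralZl//.
      + by move=> v _; rewrite lee_fin gauss_modulus_ge0.
      + by rewrite lee_fin powR_ge0.
    - by move=> k; exact: measurable_funeM.
    - by move=> k v _; rewrite -EFinM lee_fin mulr_ge0 ?powR_ge0 ?gauss_modulus_ge0.
  have ms : measurable_fun setT (fun v : plane R =>
      (\sum_(k < N) (s k `^ b)%:E * ('g[x k] (cplx v))%:E)%E).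
    by apply: emeasurable_sum => k; exact: measurable_funeM.
  have s00 v : (0 <= \sum_(k < N) (s k `^ b)%:E * ('g[x k] (cplx (v : plane R)))%:E)%E.
    by apply: sume_ge0 => k _; rewrite -EFinM lee_fin mulr_ge0 ?powR_ge0 ?gauss_modulus_ge0.
  rewrite -ge0_integralZl//; last by rewrite lee_fin powR_ge0.
  apply: ge0_le_integral => //.
  - by move=> v _; rewrite lee_fin powR_ge0.
  - apply/measurable_EFinP; apply: (measurableT_comp (measurable_powR r)).
    exact: measurable_gauss_modulus (entire_cdiffable (@entire_kernel_comb _ _)).
  - exact: measurable_funeM.
  move=> v _.
  have -> : (\sum_(k < N) (s k `^ b)%:E * ('g[x k] (cplx v))%:E =
      (\sum_(k < N) s k `^ b * 'g[x k] (cplx v))%:E)%E.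
    by rewrite -sumEFin; apply: eq_bigr => k _; rewrite EFinM.
  rewrite -EFinM lee_fin.
  set z := cplx v; have Gk k : 0 < 'g[x k] z by rewrite gauss_kernel expR_gt0.
  apply: (@le_trans _ _ ((\sum_(k < N) modulus (c k) * 'g[x k] z) `^ r)).
    apply: ge0_ler_powR (gauss_kernel_comb_le c N z); rewrite ?nnegrE ?(ltW r0) ?gauss_modulus_ge0//.
    by apply: sumr_ge0 => k _; rewrite mulr_ge0// ltW.
  have := @weighted_sum_powR_le r C (fun k => modulus (c k)) (fun k => 'g[x k] z) N
    r1 C0 (fun k => modulus_ge0 _) Gk (CP z N).
  move/le_trans; apply; apply: ler_wpM2l; first exact: powR_ge0.
  by apply: ler_sum => k _; apply: ler_wpM2r; [exact: ltW|exact: cr].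
apply: le_trans step _; under eq_bigr do rewrite integral_gauss_kernel -EFinM.
rewrite sumEFin -EFinM lee_fin -mulr_suml; apply: ler_wpM2l; first exact: powR_ge0.
by rewrite ler_piMl// ltW.
Qed.

(** The converse direction of the test vectors: [test_vector_norming], for the constant family
    [psi], turns a bound on them into a bound on the partial sums. *)
Lemma kernel_weakly_summable (a : \bar R) (b : R) : 1 <= b -> (1 <= a)%E ->
  (b%:E^-1 + a^-1 = 1)%E -> forall psi,
  bounded_functional (Fock alpha a) (Fock_norm alpha a) psi ->
  (\sum_(0 <= n <oo) (modulus (psi (x n)) `^ b)%:E < +oo)%E.
Proof.
move=> b1 a1 ba psi [lpsi [M MP]]; have b0 : 0 < b by exact: lt_le_trans b1.
have [C C0 CP] := Fock_test_vector_le b1 a1 ba.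
have [C1 C10 C1P] := Fock_kernel_norm_le a1.
have Fx k : Fock alpha a (x k).
  by split; [exact: entire_kernel|apply: le_lt_trans (C1P _) _; exact: ltry].
apply/nneseries_ltyP => [n|]; first by rewrite lee_fin powR_ge0.
have M10 : 0 <= `|M| + 1 by rewrite addr_ge0.
exists (((`|M| + 1) * C) `^ b) => N; rewrite sumEFin lee_fin.
set T := \sum_(k < N) _; have [T0|T0] := leP T 0; first by apply: le_trans T0 _; exact: powR_ge0.
have [y ty Ty] := @test_vector_norming _ _ (Fock alpha a) (fun=> psi) x b b1 (Fock0 alpha_gt0 a1)
  (fun c u v => Fock_lin alpha_gt0 c a1) (fun _ => lpsi) Fx 0%N N T T0 (lexx T).
have Fy : Fock alpha a y.
  case: ty => [N' [s [e [_ _ _ ->]]]].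
  exact: (@X_sum _ _ (Fock alpha a) x (Fock0 alpha_gt0 a1) (fun c u v => Fock_lin alpha_gt0 c a1) Fx
    (fun k => (s k `^ (b - 1))%:C * e k) N').
have [Y Y0 YE] := Fock_norm_fin Fy.
have YC : Y <= C by rewrite -lee_fin -YE; exact: CP.
have H : modulus (psi y) <= (`|M| + 1) * C.
  have := MP y Fy; rewrite YE -EFinM lee_fin => /le_trans; apply.
  apply: (@le_trans _ _ ((`|M| + 1) * Y)); last exact: ler_wpM2l.
  apply: ler_wpM2r => //; have := ler_norm M; lra.
have := le_trans Ty H; move/(ge0_ler_powR (ltW b0)).
rewrite !nnegrE powR_ge0 (mulr_ge0 M10 (ltW C0)) -powRrM mulVf ?gt_eqF// powRr1 ?(ltW T0)//.
exact.
Qed.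

End Kernels.

(** * Lower bounds for the images of the kernels *)

Section Necessity.
Context {R : realType}.
Variable mu : {measure set (measurableTypeR R) -> \bar R}.
Variable alpha : R.
Hypothesis alpha_gt0 : 0 < alpha.
Local Notation D := (`]0%R, +oo[%classic : set (measurableTypeR R)).
Local Notation D1 := (`[1%R, +oo[%classic : set (measurableTypeR R)).
Local Notation "'g[ f ]" := (gauss_modulus alpha f) (at level 0, format "''g[' f ]").

Let mD : measurable D. Proof. exact: measurable_itv. Qed.
Let mD1 : measurable D1. Proof. exact: measurable_itv. Qed.

Let J (L : R) (t : measurableTypeR R) : R := expR (L * ((t : R)^-1 - 1)) / (t : R).

Lemma hausdorff_kernel w :
  integrableC mu D (hausdorff_integrand (fock_kernel alpha w) w) ->
  mu.-integrable D (EFin \o J (alpha * modulus w ^+ 2)) /\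
  'g[hausdorff mu (fock_kernel alpha w)] w = \int[mu]_(t in D) J (alpha * modulus w ^+ 2) t.
Proof.
(* Half of the [- L] in the exponent of [J] is the normalisation of the kernel, the other half the
   Gaussian weight at [w]. *)
set L := alpha * modulus w ^+ 2; pose h (t : measurableTypeR R) : R := expR (L / (t : R) - L / 2) / (t : R).
have hE t : hausdorff_integrand (fock_kernel alpha w) w t = (h t)%:C.
  have VC (u : R) : (u%:C)^-1 = (u^-1)%:C by rewrite (fmorphV (real_complex R)).
  have MC (u v : R) : (u * v)%:C = u%:C * v%:C by rewrite (rmorphM (real_complex R)).
  have BC (u v : R) : (u - v)%:C = u%:C - v%:C by rewrite (rmorphB (real_complex R)).
  rewrite /hausdorff_integrand VC /h MC -cexp_real; congr (cexp _ * _).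
  rewrite BC (_ : L / 2 = alpha / 2 * modulus w ^+ 2); last by rewrite /L; ring.
  by congr (_ - _); rewrite (MC L) /L (MC alpha) -mul_conj; ring.
have hJ t : expR (- (L / 2)) * h t = J L t.
  by rewrite /h /J mulrA -expRD; congr (expR _ / _); move: (t^-1) => u; field.
move=> [ir ii].
have ih : mu.-integrable D (EFin \o h) by apply: eq_integrable ir => // t _; rewrite hE.
have iJ : mu.-integrable D (EFin \o J L).
  by have := integrableZl mD (expR (- (L / 2))) ih; apply: eq_integrable => // t _; rewrite /= -hJ EFinM.
split=> //.
have -> : \int[mu]_(t in D) J L t = expR (- (L / 2)) * \int[mu]_(t in D) h t.
  by rewrite -RintegralZl//; apply: eq_Rintegral => t _; rewrite hJ.
have h0 : 0 <= \int[mu]_(t in D) h t.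
  apply: Rintegral_ge0 => // t; rewrite /= in_itv /= andbT => t0.
  by rewrite divr_ge0 ?expR_ge0// ltW.
rewrite /gauss_modulus /hausdorff (_ : hausdorff_integrand _ w = (fun t => (h t)%:C)); last first.
  by apply/funext => t; rewrite hE.
rewrite integralC_real modulus_real (ger0_norm h0) mulrC; congr (expR _ * _).
by rewrite /L; field.
Qed.

(** The [k]-th power of [1 / t <= exp (1 / t - 1)], valid for every [t > 0]. *)
Let pow_le_J (k : nat) t : D t -> ((t : R) ^+ k.+1)^-1 <= J k%:R t.
Proof.
rewrite /= in_itv /= andbT => t0; rewrite /J exprS invfM mulrC.
apply: ler_wpM2r; first by rewrite invr_ge0 ltW.
rewrite expRM_natl -exprVn; apply: lerXn2r; rewrite ?nnegrE ?invr_ge0 ?(ltW t0) ?expR_ge0//.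
by have := expR_ge1Dx (t^-1 - 1); rewrite addrC subrK.
Qed.

Let mJ L A : A `<=` D -> measurable A -> mu.-integrable D (EFin \o J L) ->
  measurable_fun A (EFin \o J L).
Proof. by move=> AD mA /measurable_int; exact: measurable_funS. Qed.

Variables (a s : \bar R).
Hypothesis a_ge1 : (1 <= a)%E.
Hypothesis Hsumming : hausdorff_summing mu alpha a s.

Let kernel_Fock w : Fock alpha a (fock_kernel alpha w).
Proof.
have [C C0 CP] := Fock_kernel_norm_le alpha_gt0 a_ge1.
split; first exact: entire_kernel.
by apply: le_lt_trans (CP w) _; exact: ltry.
Qed.

Let iK w : integrableC mu D (hausdorff_integrand (fock_kernel alpha w) w).
Proof. by have [H _] := Hsumming; apply: H. Qed.

Let HF w : Fock alpha a (hausdorff mu (fock_kernel alpha w)).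
Proof. by have [_ [[H _ _] _]] := Hsumming; apply: H. Qed.

Let norm_ge : exists2 C : R, 0 < C & forall w,
  ((\int[mu]_(t in D) J (alpha * modulus w ^+ 2) t)%:E <=
    C%:E * Fock_norm alpha a (hausdorff mu (fock_kernel alpha w)))%E.
Proof.
have [C C0 CP] := Fock_gauss_le alpha_gt0 a_ge1; exists C => // w.
have [N0 N00 NE] := Fock_norm_fin (HF w).
apply: (homogeneous_bound C0 N00 NE) => N Ngt0 fN; rewrite lee_fin.
have [_ <-] := hausdorff_kernel (iK w); exact: (CP _ _ (HF w).1 Ngt0 fN w).
Qed.

Lemma moment_bounded : exists2 S : R, 0 < S & forall n, (moment mu n <= S%:E)%E.
Proof.
have [C C0 CP] := norm_ge; have [C1 C10 C1P] := Fock_kernel_norm_le alpha_gt0 a_ge1.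
have [_ [[_ _ [M MP]] _]] := Hsumming.
exists (C * (`|M| + 1) * C1); first by rewrite !mulr_gt0// ltr_wpDl.
(* Here [alpha |w|^2] equals [n], so that [pow_le_J] applies on the whole half line, before anything
   is known of [mu] near [0]. *)
move=> n; pose w : R[i] := (Num.sqrt (n%:R / alpha))%:C.
have Lw : alpha * modulus w ^+ 2 = n%:R.
  rewrite /w modulus_real real_normK ?num_real// sqr_sqrtr; last by rewrite divr_ge0// ltW.
  by rewrite mulrC divfK// gt_eqF.
have := CP w; rewrite Lw; have [iJ _] := hausdorff_kernel (iK w); rewrite Lw in iJ.
have [N0 N00 NE] := Fock_norm_fin (kernel_Fock w).
have NC : N0 <= C1 by rewrite -lee_fin -NE.
have nH : (Fock_norm alpha a (hausdorff mu (fock_kernel alpha w)) <= ((`|M| + 1) * C1)%:E)%E.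
  apply: le_trans (MP _ (kernel_Fock w)) _; rewrite NE -EFinM lee_fin.
  apply: (@le_trans _ _ ((`|M| + 1) * N0)).
    by apply: ler_wpM2r => //; have := ler_norm M; lra.
  by apply: ler_wpM2l => //; rewrite addr_ge0.
move=> H; apply: (@le_trans _ _ (\int[mu]_(t in D) J n%:R t)%:E).
  rewrite fineK; last exact: integrable_fin_num.
  apply: ge0_le_integral => //.
  - by move=> t; rewrite /= in_itv /= andbT => t0; rewrite lee_fin invr_ge0 exprn_ge0// ltW.
  - by apply/measurable_EFinP; exact: measurable_inv_itv.
  - exact: mJ.
  by move=> t Dt; rewrite lee_fin; exact: pow_le_J.
apply: le_trans H _; rewrite -mulrA EFinM; apply: lee_wpmul2l nH.
by rewrite lee_fin ltW.
Qed.

(** At a lattice point only [L <= n] holds. Once [mu] is known to live on [t >= 1], this suffices: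
    [1 / t - 1 <= 0] there, so [J L t] decreases in [L]. *)
Lemma moment_le_kernel_image : exists2 C : R, 0 < C & forall n, (moment mu n <=
  C%:E * Fock_norm alpha a (hausdorff mu (fock_kernel alpha (kernel_pt alpha n))))%E.
Proof.
have [C C0 CP] := norm_ge; have [S S0 SP] := moment_bounded; exists C => // n.
apply: le_trans (CP _); set w := kernel_pt alpha n.
have [iJ _] := hausdorff_kernel (iK w).
set L := alpha * modulus w ^+ 2 in iJ *; have Ln : L <= n%:R by exact: kernel_pt_le.
have D1D : D1 `<=` D by move=> t; rewrite /= !in_itv /= !andbT; exact: lt_le_trans.
rewrite (moment_fin SP) lee_fin -[fine _]/(\int[mu]_(t in D) ((t : R) ^+ n.+1)^-1).
rewrite (Rintegral_restrict SP (integrable_inv SP n)) (Rintegral_restrict SP iJ).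
apply: le_Rintegral => //.
- exact: integrableS (integrable_inv SP n).
- exact: integrableS iJ.
move=> t D1t; apply: le_trans (pow_le_J n (D1D _ D1t)) _.
move: D1t; rewrite /= in_itv /= andbT => t1; have t0 : 0 < t by exact: lt_le_trans t1.
rewrite /J; apply: ler_wpM2r; first by rewrite invr_ge0 ltW.
rewrite ler_expR; apply: ler_wnM2r => //.
by rewrite subr_le0 invf_le1.
Qed.

End Necessity.

(** * The three assertions *)

Lemma summing_moments {R : realType} (mu : {measure set (measurableTypeR R) -> \bar R})
    (alpha b : R) (a : \bar R) : 0 < alpha -> 1 <= b -> (1 <= a)%E ->
  (b%:E^-1 + a^-1 = 1)%E -> hausdorff_summing mu alpha a b%:E ->
  (\sum_(0 <= n <oo) (moment mu n `^ b) < +oo)%E.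
Proof.
move=> al0 b1 a1 ba Hs; have b0 : 0 < b by exact: lt_le_trans b1.
have [C C0 CP] := moment_le_kernel_image al0 a1 Hs.
have [C1 C10 C1P] := Fock_kernel_norm_le al0 a1.
pose x n := fock_kernel alpha (kernel_pt alpha n).
have Fx n : Fock alpha a (x n).
  by split; [exact: entire_kernel|apply: le_lt_trans (C1P _) _; exact: ltry].
have [_ [_ sm]] := Hs.
have /nneseries_ltyP := sm x Fx (kernel_weakly_summable al0 b1 a1 ba).
move=> /(_ (fun n => poweR_ge0 _ _)) [S SP].
apply/nneseries_ltyP; first by move=> n; exact: poweR_ge0.
exists (C `^ b * S) => N; apply: (@le_trans _ _ ((C `^ b)%:E *
  \sum_(k < N) (Fock_norm alpha a (hausdorff mu (x k)) `^ b))%E); last first.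
  by rewrite EFinM; apply: lee_wpmul2l; [rewrite lee_fin powR_ge0|exact: SP].
rewrite ge0_sume_distrr; last by move=> k _; exact: poweR_ge0.
apply: lee_sum => k _; have N0 := Fock_norm_ge0 alpha a (hausdorff mu (x k)).
have CN : (0 <= C%:E * Fock_norm alpha a (hausdorff mu (x k)))%E.
  by rewrite mule_ge0// lee_fin ltW.
have := @gt0_ler_poweR _ b (ltW b0) _ _ _ _ (CP k).
rewrite !in_itv /= !leey !andbT moment_ge0 CN => /(_ isT isT) /le_trans; apply.
by rewrite poweRM ?lee_fin ?(ltW C0)// poweR_EFin.
Qed.

Local Open Scope ereal_scope.

Theorem proposition9p4 (R : realType) (alpha : R)
    (mu : {measure set (measurableTypeR R) -> \bar R}) (p : R) (q : \bar R)
    (alpha_gt0 : (0 < alpha)%R) (p_ge1 : (1 <= p)%R) (p_le2 : (p <= 2)%R)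
    (conj_pq : p%:E^-1 + q^-1 = 1) :
  [/\ \sum_(0 <= n <oo)
          (moment mu n `^ p * (n.+1%:R `^ ((2 - p) / 2))%R%:E) < +oo ->
        hausdorff_summing mu alpha q p%:E,
      hausdorff_summing mu alpha q p%:E ->
        \sum_(0 <= n <oo)
          (moment mu n `^ p * (n.+1%:R `^ ((p - 2) / 2))%R%:E) < +oo
    & hausdorff_summing mu alpha p%:E q -> ell q (moment mu)].
Proof.
have p_gt0 : (0 < p)%R by exact: lt_le_trans p_ge1.
have q2 := conj_exponent_ge2 p_ge1 p_le2 conj_pq.
have q1 : 1 <= q by apply: le_trans q2; rewrite lee_fin ler1n.
split.
- pose u n := moment mu n `^ p * (n.+1%:R `^ ((2 - p) / 2))%R%:E; have u0 n : 0 <= u n.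
    by rewrite mule_ge0 ?poweR_ge0// lee_fin powR_ge0.
  move=> /(nneseries_ltyP u0) [S SP].
  have k1 (n : nat) : (1 <= n.+1%:R `^ ((2 - p) / 2) :> R)%R.
    rewrite -[leLHS](@powRr0 R n.+1%:R); apply: ler_powR; first by rewrite ler1n.
    by rewrite divr_ge0 ?subr_ge0.
  (* The weights are at least [1] because [p <= 2], so a convergent series bounds every moment. *)
  have pow_le n : moment mu n `^ p <= S%:E.
    apply: le_trans (SP n.+1); rewrite big_ord_recr /=.
    apply: (@le_trans _ _ (u n)); last by rewrite leeDr// sume_ge0.
    by rewrite /u lee_pemulr ?poweR_ge0// lee_fin.
  have S0 : (0 <= S)%R by rewrite -lee_fin; apply: le_trans (pow_le 0%N); exact: poweR_ge0.
  have mS n : moment mu n <= (S + 1)%:E.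
    have := pow_le n; have := moment_ge0 mu n; case: (moment mu n) => [m| |//].
      rewrite poweR_EFin !lee_fin => m0 mp; have := le_1_powR m0 p_ge1; lra.
    by move=> _; rewrite poweRyr ?gt_eqF// leye_eq.
  apply: (hausdorff_sufficient alpha_gt0 p_ge1 p_le2 conj_pq (S := (S + 1)%R)) => //.
    by rewrite ltr_wpDl.
  move=> N; rewrite -lee_fin -sumEFin; apply: le_trans (@le_trans _ _ S%:E _ _ _ _); last 2 first.
  + exact: SP N.
  + by rewrite lee_fin lerDl.
  apply: lee_sum => k _; rewrite /u [X in (X `^ p)%E](moment_fin mS) poweR_EFin -EFinM.
  exact: lexx.
(* The moments are even in [l^p], and the weights of (ii) are at most [1]. *)
- move=> /(summing_moments alpha_gt0 p_ge1 q1 conj_pq).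
  apply: le_lt_trans; apply: lee_nneseries => n _.
    by rewrite mule_ge0 ?poweR_ge0// lee_fin powR_ge0.
  rewrite -[leRHS]mule1; apply: lee_wpmul2l; first exact: poweR_ge0.
  rewrite lee_fin -[leRHS](@powRr0 R n.+1%:R); apply: ler_powR.
    by rewrite ler1n.
  by rewrite ler_pdivrMr// mul0r subr_le0.
- have p1 : 1 <= p%:E by rewrite lee_fin.
  have abs n : `|moment mu n| = moment mu n by rewrite gee0_abs ?moment_ge0.
  case: q conj_pq q1 q2 => [r| |//] pq q1 q2 Hs.
    rewrite /ell; under eq_eseriesr do rewrite abs.
    (* The conjugate pair is swapped: summing exponent [q], space exponent [p]. *)
    apply: (summing_moments alpha_gt0 _ p1 _ Hs); first by rewrite -lee_fin.
    by rewrite addeC.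
  (* For [q = +oo] the operator is only bounded, which already bounds the moments. *)
  have [S S0 SP] := moment_bounded alpha_gt0 p1 Hs.
  apply: (@le_lt_trans _ _ S%:E); last exact: ltry.
  by apply: ge_ereal_sup => _ [n _ <-]; rewrite abs.
Qed.
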